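(* Define, for $\Re s>0$, $$\zeta_{\mathcal{M}}(s)=\sum_{n\in\mathbb{Z}}\frac{c_n}{(\log 2-2\pi i n)^{s}},$$ where $c_n=\int_0^1\Psi(x)e^{-2\pi inx}\,\mathrm{d}x$ are the Fourier coefficients of $\Psi(x)=-2^{x}(F(x)-1)$, and $(\log2-2\pi in)^{s}=e^{s\log(\log2-2\pi in)}$ with the branch of $\arg$ taking values in $(-\pi/2,\pi/2)$. Then $\zeta_{\mathcal{M}}$ extends to an entire function on $\mathbb{C}$ satisfying $$\zeta_{\mathcal{M}}(s)\Gamma(s)=-\zeta_{\mathcal{M}}(-s)\Gamma(-s).$$ Moreover: $\zeta_{\mathcal{M}}(L)=\frac{M_L}{L!}$ for integers $L\geq 1$; $\zeta_{\mathcal{M}}(-L)=0$ and $\zeta_{\mathcal{M}}'(-L)=(L-1)!(-1)^{L-1}M_L$ for integers $L\geq 1$; $\zeta_{\mathcal{M}}$ is real on the real line, so $\zeta_{\mathcal{M}}(\overline{s})=\overline{\zeta_{\mathcal{M}}(s)}$; and for any real $a\leq b$, $$|\zeta_{\mathcal{M}}(\sigma+it)|\ll |t|^{-\sigma-1/2}e^{\pi|t|/2}$$ uniformly for $a\leq\sigma\leq b$ as $|t|\to\infty$.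
   Context: $F:[0,\infty)\to[0,1)$ is the Minkowski question mark function: if $x\geq 0$ has regular continued fraction expansion $x=[a_0;a_1,a_2,\dots]$, then $F(x)=1-2^{-a_0}+2^{-(a_0+a_1)}-2^{-(a_0+a_1+a_2)}+\cdots$, the series terminating for rational $x$; it satisfies $F(x)+F(1/x)=1$. $F$ is extended to $\mathbb{R}$ by $F(x+1)=\frac12+\frac12F(x)$, which makes $\Psi$ $1$-periodic. $M_L=\int_0^\infty x^L\,\mathrm{d}F(x)$. *)

(* Defs.v *)
From Stdlib Require Import Reals ZArith Lra Lia.
From Coquelicot Require Import Coquelicot.

Local Open Scope R_scope.

(** Complete quotients of the regular continued fraction algorithm: [None] once
    the expansion has terminated. *)
Fixpoint cf_tail (x : R) (k : nat) : option R :=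
  match k with
  | O => Some x
  | S j =>
      match cf_tail x j with
      | Some y => if Req_EM_T (frac_part y) 0 then None else Some (/ frac_part y)
      | None => None
      end
  end.

Definition cf_quotient (x : R) (k : nat) : Z :=
  match cf_tail x k with
  | Some y => Int_part y
  | None => 0%Z
  end.

Fixpoint cf_quotient_sum (x : R) (k : nat) : Z :=
  match k with
  | O => cf_quotient x 0
  | S j => (cf_quotient_sum x j + cf_quotient x (S j))%Z
  end.

Definition question_mark_term (x : R) (k : nat) : R :=
  match cf_tail x k with
  | Some _ => (-1) ^ (S k) * powerRZ 2 (- cf_quotient_sum x k)
  | None => 0
  end.

(** For [0 <= x] this is the defining alternating series of F.  For [x < 0] the
    same formula, with the negative integer part as zeroth quotient, is the
    extension by F (x + 1) = 1/2 + F x / 2; see [question_mark_shift]. *)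
Definition question_mark (x : R) : R := 1 + Series (question_mark_term x).

Lemma Int_part_plus1 (x : R) : Int_part (x + 1) = (Int_part x + 1)%Z.
Proof.
  symmetry; apply Int_part_spec; rewrite plus_IZR.
  destruct (base_Int_part x); lra.
Qed.

Lemma frac_part_plus1 (x : R) : frac_part (x + 1) = frac_part x.
Proof. unfold frac_part; rewrite Int_part_plus1, plus_IZR; lra. Qed.

Lemma cf_tail_plus1 (x : R) (k : nat) : cf_tail (x + 1) (S k) = cf_tail x (S k).
Proof.
  induction k as [|k IH].
  - simpl; rewrite frac_part_plus1; reflexivity.
  - change (cf_tail (x + 1) (S (S k))) with
      (match cf_tail (x + 1) (S k) with
       | Some y => if Req_EM_T (frac_part y) 0 then None else Some (/ frac_part y)
       | None => None end).
    rewrite IH; reflexivity.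
Qed.

Lemma cf_quotient_sum_plus1 (x : R) (k : nat) :
  cf_quotient_sum (x + 1) k = (cf_quotient_sum x k + 1)%Z.
Proof.
  induction k as [|k IH].
  - exact (Int_part_plus1 x).
  - change (cf_quotient_sum (x + 1) (S k)) with
      (cf_quotient_sum (x + 1) k + cf_quotient (x + 1) (S k))%Z.
    rewrite IH; unfold cf_quotient; rewrite cf_tail_plus1.
    change (cf_quotient_sum x (S k)) with
      (cf_quotient_sum x k + cf_quotient x (S k))%Z.
    unfold cf_quotient; lia.
Qed.

Lemma question_mark_shift (x : R) :
  question_mark (x + 1) = 1 / 2 + 1 / 2 * question_mark x.
Proof.
  unfold question_mark.
  rewrite (Series_ext _ (fun k => / 2 * question_mark_term x k)).
  - rewrite Series_scal_l; lra.
  - intros k; unfold question_mark_term; rewrite cf_quotient_sum_plus1.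
    replace (- (cf_quotient_sum x k + 1))%Z
      with (- cf_quotient_sum x k + -1)%Z by lia.
    rewrite powerRZ_add by lra.
    replace (powerRZ 2 (-1)) with (/ 2) by (simpl; lra).
    destruct k as [|k]; [| rewrite cf_tail_plus1].
    + cbn [cf_tail]; ring.
    + destruct (cf_tail x (S k)); ring.
Qed.

Definition Psi (x : R) : R := - Rpower 2 x * (question_mark x - 1).

Definition RS_sum (f g : R -> R) (ptd : SF_seq) : R :=
  seq.foldr Rplus 0
    (seq.pairmap (fun x y : R * R => f (snd y) * (g (fst y) - g (fst x)))
       (SF_h ptd, 0) (SF_t ptd)).

(** To be used with [a <= b]: no sign is attached to reversed bounds. *)
Definition is_RSInt (f g : R -> R) (a b l : R) : Prop :=
  filterlim (RS_sum f g) (Riemann_fine a b) (locally l).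

Definition RSInt (f g : R -> R) (a b : R) : R := iota (is_RSInt f g a b).

Definition moment (L : nat) : R :=
  real (Lim (fun b => RSInt (fun x => x ^ L) question_mark 0 b) p_infty).

Definition Cexp (z : C) : C := (exp (Re z) * cos (Im z), exp (Re z) * sin (Im z)).

(** Logarithm on the half-plane [0 < Re z], where [atan (Im z / Re z)] is the
    argument in (-PI/2, PI/2). *)
Definition Clog_right (z : C) : C := (ln (Cmod z), atan (Im z / Re z)).

Definition Cpow_right (z s : C) : C := Cexp (s * Clog_right z)%C.

Definition Gamma_integral (s : C) : C :=
  RInt_gen (V := C_R_CompleteNormedModule)
    (fun t : R => (RtoC (exp (- t)) * Cpow_right (RtoC t) (s - 1))%C)
    (at_right 0) (Rbar_locally p_infty).

Fixpoint Crising (s : C) (n : nat) : C :=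
  match n with
  | O => 1%C
  | S k => (Crising s k * (s + RtoC (INR k)))%C
  end.

(** Number of unit steps to the right from [s] into the half-plane [0 < Re s]
    (none if [s] is already there). *)
Definition Gamma_shift (s : C) : nat := Z.to_nat (up (- Re s)).

(** Euler's integral for [0 < Re s], continued by Gamma (s + 1) = s Gamma s.  The
    value at the poles 0, -1, -2, ... is meaningless. *)
Definition CGamma (s : C) : C :=
  (Gamma_integral (s + RtoC (INR (Gamma_shift s))) / Crising s (Gamma_shift s))%C.

Definition Psi_coef (n : Z) : C :=
  RInt (V := C_R_CompleteNormedModule)
    (fun x : R => (RtoC (Psi x) * Cexp (- (2 * PI * Ci * IZR n * x)))%C) 0 1.

Definition zeta_M_term (s : C) (n : Z) : C :=
  (Psi_coef n / Cpow_right (ln 2 - 2 * PI * Ci * IZR n) s)%C.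

(** Bilateral series: the sums over [0 <= n] and over [n < 0] both converge. *)
Definition is_bilateral_series (a : Z -> C) (l : C) : Prop :=
  exists lp ln : C,
    is_series (K := C_AbsRing) (V := C_NormedModule)
      (fun k : nat => a (Z.of_nat k)) lp /\
    is_series (K := C_AbsRing) (V := C_NormedModule)
      (fun k : nat => a (- Z.of_nat (S k))%Z) ln /\
    l = (lp + ln)%C.

Definition entire (f : C -> C) : Prop :=
  forall s : C, ex_derive (K := C_AbsRing) (V := C_NormedModule) f s.

(* Main.v *)
Require Import Defs.
From Stdlib Require Import Reals ZArith Lra Lia.
From Coquelicot Require Import Coquelicot.
Local Open Scope R_scope.

(** Let N(s) = 1 + s ∫_1^∞ (x^(s-1) - x^(-s-1)) (1 - F(x)) dx, an entire even function which equals
    s ∫_0^∞ x^(s-1) (1 - F(x)) dx for Re s > 0 because F(x) + F(1/x) = 1.  Integrating by parts,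
    N(s) = ∫_1^∞ (x^s + x^-s) dF(x), so N is bounded in vertical strips and N(L) = M_L.  The
    continuation is zeta(s) = N(s) / Gamma(s + 1).

    For Re s > 0 each term satisfies Gamma(s) (log 2 - 2 pi i n)^-s = ∫_0^∞ x^(s-1) 2^-x e^(2 pi i n x) dx.
    Since c_n = O(1/n) the series converges absolutely, hence has the same sum as its Cesaro means,
    and those converge to ∫_0^∞ x^(s-1) 2^-x Psi(x) dx / Gamma(s) because the Fejer means of the
    continuous function Psi converge uniformly.

    For the growth of 1 / Gamma: |Gamma(x + i t)| >= Gamma(x) (1 - t^2 / (2 (x - 1))), so that
    |Gamma(x + i t)| / Gamma(x) is the infinite product of the (x + k) / |x + k + i t|, whose
    logarithm is compared with an integral.

    All integrals over (0, ∞) are written in the variable u = log x. *)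

(** * Complex-valued functions of a real variable *)

(** From zeta(s) = N(s) / Gamma(s + 1) one reads off zeta(s) Gamma(s) = N(s) / s, so the functional
    equation is just the evenness of N. The zeros at -L and the derivatives there come from the
    simple zeros of 1 / Gamma at 0, -1, -2, ... together with N(-L) = N(L) = M_L.

    The variable u = log x turns powers into exponentials, the symmetry F(x) + F(1/x) = 1 into the
    reflection u -> -u, and both ends of (0, ∞) into half-lines on which the integrands decay
    exponentially; one notion of convergence then serves everywhere.

    Two obstacles shape the rest. The coefficients are only shown to be O(1/n), so the Fourier
    series of Psi cannot be integrated term by term by absolute convergence; at the level of Psi it
    is the Fejer means that converge uniformly. And N must be bounded in strips although it contains
    the factor s: this uses only the positivity of dF, by comparing an integral by parts with that
    of a majorant. *)

Notation CRint := (RInt (V := C_R_CompleteNormedModule)).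
Notation Ccontinuous :=
  (continuous (U := C_R_NormedModule)).
Notation is_derive_RC := (is_derive (K := R_AbsRing) (V := C_R_NormedModule)).
Notation is_Cderive := (is_derive (K := C_AbsRing) (V := C_NormedModule)).

Lemma Ceq (x y : C) : Re x = Re y -> Im x = Im y -> x = y.
Proof. intros; apply injective_projections; assumption. Qed.

Ltac creal := apply Ceq; unfold Re, Im; simpl; ring.

Lemma Cconj_RtoC (x : R) : Cconj (RtoC x) = RtoC x.
Proof. creal. Qed.

Lemma Re_plus (x y : C) : Re (x + y)%C = Re x + Re y.
Proof. reflexivity. Qed.

Lemma C_R_norm (z : C) : norm (K := R_AbsRing) (V := C_R_NormedModule) z = Cmod z.
Proof.
  unfold norm; simpl; unfold prod_norm, Cmod, norm; simpl; unfold abs; simpl.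
  rewrite !Rmult_1_r, <- !Rabs_mult, !Rabs_pos_eq; [reflexivity | apply Rle_0_sqr ..].
Qed.

Lemma Im_le_Cmod (z : C) : Rabs (Im z) <= Cmod z.
Proof.
  eapply Rle_trans; [| apply Rmax_Cmod]; apply Rmax_r.
Qed.

Lemma Re_le_Cmod (z : C) : Re z <= Cmod z.
Proof. eapply Rle_trans; [apply Rle_abs | apply re_le_Cmod]. Qed.

Lemma Cmod_le_add (z : C) : Cmod z <= Rabs (Re z) + Rabs (Im z).
Proof.
  replace z with (RtoC (Re z) + Ci * RtoC (Im z))%C at 1.
  - eapply Rle_trans; [apply Cmod_triangle|].
    rewrite Cmod_mult, Cmod_Ci, !Cmod_R; lra.
  - creal.
Qed.

Lemma Cmod_triangle_sub (x y : C) : Cmod x - Cmod y <= Cmod (x - y)%C.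
Proof.
  replace x with (x - y + y)%C at 1 by ring.
  pose proof (Cmod_triangle (x - y)%C y); lra.
Qed.

(** The topology on [C_R_NormedModule] is that of a product of two copies of R; this is the bridge
    to [Cmod], through which limits are handled below. *)
Lemma Clim_iff {T} (F : (T -> Prop) -> Prop) {FF : Filter F} (f : T -> C) (l : C) :
  filterlim f F (locally (T := C_R_NormedModule) l) <->
  forall eps : R, 0 < eps -> F (fun x => Cmod (f x - l)%C < eps).
Proof.
  rewrite (filterlim_locally_ball_norm (K := R_AbsRing) (U := C_R_NormedModule)).
  unfold ball_norm; split; intros H eps.
  - intros He; specialize (H (mkposreal eps He)).
    eapply filter_imp; [| exact H]; intros x; cbv beta; rewrite C_R_norm; exact (fun h => h).
  - eapply filter_imp; [| exact (H eps (cond_pos eps))].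
    intros x; rewrite C_R_norm; exact (fun h => h).
Qed.

Lemma Rlim_iff {T} (F : (T -> Prop) -> Prop) {FF : Filter F} (f : T -> R) (l : R) :
  filterlim f F (locally l) <->
  forall eps : R, 0 < eps -> F (fun x => Rabs (f x - l) < eps).
Proof.
  rewrite filterlim_locally; split; intros H eps.
  - intros He; exact (H (mkposreal eps He)).
  - exact (H eps (cond_pos eps)).
Qed.

Lemma Clim_Re {T} (F : (T -> Prop) -> Prop) {FF : Filter F} (f : T -> C) (l : C) :
  filterlim f F (locally (T := C_R_NormedModule) l) ->
  filterlim (fun x => Re (f x)) F (locally (Re l)).
Proof.
  rewrite Clim_iff, Rlim_iff by assumption; intros H eps He.
  eapply filter_imp; [| exact (H eps He)]; intros x Hx; cbv beta.
  eapply Rle_lt_trans; [| exact Hx].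
  exact (re_le_Cmod (f x - l)%C).
Qed.

Lemma Clim_Im {T} (F : (T -> Prop) -> Prop) {FF : Filter F} (f : T -> C) (l : C) :
  filterlim f F (locally (T := C_R_NormedModule) l) ->
  filterlim (fun x => Im (f x)) F (locally (Im l)).
Proof.
  rewrite Clim_iff, Rlim_iff by assumption; intros H eps He.
  eapply filter_imp; [| exact (H eps He)]; intros x Hx; cbv beta.
  eapply Rle_lt_trans; [| exact Hx].
  exact (Im_le_Cmod (f x - l)%C).
Qed.

Lemma Clim_pair {T} (F : (T -> Prop) -> Prop) {FF : Filter F} (f : T -> C) (l : C) :
  filterlim (fun x => Re (f x)) F (locally (Re l)) ->
  filterlim (fun x => Im (f x)) F (locally (Im l)) ->
  filterlim f F (locally (T := C_R_NormedModule) l).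
Proof.
  rewrite Clim_iff, !Rlim_iff by assumption; intros H1 H2 eps He.
  assert (He2 : 0 < eps / 2) by lra.
  generalize (filter_and _ _ (H1 _ He2) (H2 _ He2)); apply filter_imp.
  intros x [h1 h2].
  eapply Rle_lt_trans; [apply Cmod_le_add|].
  replace (Re (f x - l)%C) with (Re (f x) - Re l) by (unfold Re, Im; simpl; ring).
  replace (Im (f x - l)%C) with (Im (f x) - Im l) by (unfold Re, Im; simpl; ring).
  lra.
Qed.

Lemma Clim_plus {T} (F : (T -> Prop) -> Prop) {FF : Filter F} (f g : T -> C) (l m : C) :
  filterlim f F (locally (T := C_R_NormedModule) l) ->
  filterlim g F (locally (T := C_R_NormedModule) m) ->
  filterlim (fun x => f x + g x)%C F (locally (T := C_R_NormedModule) (l + m)%C).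
Proof.
  rewrite !Clim_iff by assumption; intros H1 H2 eps He.
  assert (He2 : 0 < eps / 2) by lra.
  generalize (filter_and _ _ (H1 _ He2) (H2 _ He2)); apply filter_imp.
  intros x [h1 h2].
  replace (f x + g x - (l + m))%C with ((f x - l) + (g x - m))%C by ring.
  eapply Rle_lt_trans; [apply Cmod_triangle| lra].
Qed.

Lemma Clim_scal {T} (F : (T -> Prop) -> Prop) {FF : Filter F} (f : T -> C) (c l : C) :
  filterlim f F (locally (T := C_R_NormedModule) l) ->
  filterlim (fun x => c * f x)%C F (locally (T := C_R_NormedModule) (c * l)%C).
Proof.
  rewrite !Clim_iff by assumption; intros H eps He.
  assert (Hc : 0 < Cmod c + 1) by (pose proof (Cmod_ge_0 c); lra).
  assert (He2 : 0 < eps / (Cmod c + 1)) by (apply Rdiv_lt_0_compat; lra).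
  generalize (H _ He2); apply filter_imp; intros x Hx.
  replace (c * f x - c * l)%C with (c * (f x - l))%C by ring.
  rewrite Cmod_mult.
  apply Rle_lt_trans with ((Cmod c) * (eps / (Cmod c + 1))).
  - apply Rmult_le_compat_l; [apply Cmod_ge_0 | lra].
  - apply Rlt_le_trans with ((Cmod c + 1) * (eps / (Cmod c + 1))).
    + apply Rmult_lt_compat_r; lra.
    + right; field; lra.
Qed.

Lemma Clim_unique {T} (F : (T -> Prop) -> Prop) {FF : ProperFilter' F}
  (f : T -> C) (l m : C) :
  filterlim f F (locally (T := C_R_NormedModule) l) ->
  filterlim f F (locally (T := C_R_NormedModule) m) -> l = m.
Proof.
  intros H1 H2.
  exact (filterlim_locally_unique (V := C_R_NormedModule) f l m H1 H2).
Qed.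

Lemma Ccontinuous_pair {T : UniformSpace} (f : T -> C) (x : T) :
  continuous (fun u => Re (f u)) x -> continuous (fun u => Im (f u)) x -> Ccontinuous f x.
Proof. intros; apply (Clim_pair (locally x)); assumption. Qed.

Lemma Ccontinuous_Re {T : UniformSpace} (f : T -> C) (x : T) : Ccontinuous f x -> continuous (fun u => Re (f u)) x.
Proof. intros H; apply (Clim_Re (locally x)); assumption. Qed.

Lemma Ccontinuous_Im {T : UniformSpace} (f : T -> C) (x : T) : Ccontinuous f x -> continuous (fun u => Im (f u)) x.
Proof. intros H; apply (Clim_Im (locally x)); assumption. Qed.

Lemma Ccontinuous_const {T : UniformSpace} (c : C) (x : T) : Ccontinuous (fun _ => c) x.
Proof. apply continuous_const. Qed.

Lemma Ccontinuous_RtoC {T : UniformSpace} (f : T -> R) (x : T) :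
  continuous f x -> Ccontinuous (fun u => RtoC (f u)) x.
Proof.
  intros H; apply Ccontinuous_pair; [exact H | apply continuous_const].
Qed.

Lemma Ccontinuous_plus {T : UniformSpace} (f g : T -> C) (x : T) :
  Ccontinuous f x -> Ccontinuous g x -> Ccontinuous (fun u => f u + g u)%C x.
Proof. intros Hf Hg; exact (Clim_plus (locally x) f g _ _ Hf Hg). Qed.

Lemma Ccontinuous_mult {T : UniformSpace} (f g : T -> C) (x : T) :
  Ccontinuous f x -> Ccontinuous g x -> Ccontinuous (fun u => f u * g u)%C x.
Proof.
  intros Hf Hg.
  pose proof (Ccontinuous_Re _ _ Hf); pose proof (Ccontinuous_Re _ _ Hg).
  pose proof (Ccontinuous_Im _ _ Hf); pose proof (Ccontinuous_Im _ _ Hg).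
  apply Ccontinuous_pair; simpl.
  - apply (continuous_minus (V := R_NormedModule));
      apply (continuous_mult (K := R_AbsRing)); assumption.
  - apply (continuous_plus (V := R_NormedModule));
      apply (continuous_mult (K := R_AbsRing)); assumption.
Qed.

Lemma Ccontinuous_opp {T : UniformSpace} (f : T -> C) (x : T) :
  Ccontinuous f x -> Ccontinuous (fun u => - f u)%C x.
Proof.
  intros H; eapply continuous_ext;
    [| exact (Ccontinuous_mult _ _ x (Ccontinuous_const (RtoC (-1)) x) H)].
  intros u; simpl; creal.
Qed.

Lemma Ccontinuous_minus {T : UniformSpace} (f g : T -> C) (x : T) :
  Ccontinuous f x -> Ccontinuous g x -> Ccontinuous (fun u => f u - g u)%C x.
Proof. intros Hf Hg; apply Ccontinuous_plus; [| apply Ccontinuous_opp]; assumption. Qed.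

Lemma Ccontinuous_exp {T : UniformSpace} (f : T -> C) (x : T) :
  Ccontinuous f x -> Ccontinuous (fun u => Cexp (f u)) x.
Proof.
  intros H; pose proof (Ccontinuous_Re _ _ H); pose proof (Ccontinuous_Im _ _ H).
  assert (E := continuous_comp (fun u => Re (f u)) exp x ltac:(assumption) (continuous_exp _)).
  apply Ccontinuous_pair.
  - exact (continuous_mult (K := R_AbsRing) _ (fun u => cos (Im (f u))) x E
      (continuous_comp (fun u => Im (f u)) cos x ltac:(assumption) (continuous_cos _))).
  - exact (continuous_mult (K := R_AbsRing) _ (fun u => sin (Im (f u))) x E
      (continuous_comp (fun u => Im (f u)) sin x ltac:(assumption) (continuous_sin _))).
Qed.

Lemma Ccontinuous_conj {T : UniformSpace} (f : T -> C) (x : T) :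
  Ccontinuous f x -> Ccontinuous (fun u => Cconj (f u)) x.
Proof.
  intros H; apply Ccontinuous_pair; simpl.
  - exact (Ccontinuous_Re _ _ H).
  - apply (continuous_opp (V := R_NormedModule)); exact (Ccontinuous_Im _ _ H).
Qed.

(** Products and exponentials are differentiated componentwise through this lemma, which reduces
    them to the real rules. *)
Lemma is_derive_RC_pair (f : R -> C) (x : R) (l : C) :
  is_derive (fun u => Re (f u)) x (Re l) -> is_derive (fun u => Im (f u)) x (Im l) ->
  is_derive_RC f x l.
Proof.
  intros H1 H2.
  apply (filterdiff_ext_lin (K := R_AbsRing) (V := C_R_NormedModule)) with
    (l1 := fun y : R => (y * Re l, y * Im l)); [| reflexivity].
  apply (filterdiff_ext (K := R_AbsRing) (V := C_R_NormedModule)) with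
    (f := fun u => (Re (f u), Im (f u))).
  { intros u; destruct (f u); reflexivity. }
  split.
  { split.
    - intros u v; apply Ceq; simpl; unfold plus; simpl; ring.
    - intros k u; apply Ceq; simpl; unfold scal; simpl; unfold mult; simpl; ring.
    - exists (Cmod l + 1); split; [pose proof (Cmod_ge_0 l); lra|].
      intros u; rewrite C_R_norm.
      replace (u * Re l, u * Im l) with (RtoC u * l)%C by (apply Ceq; simpl; unfold Re, Im; ring).
      rewrite Cmod_mult, Cmod_R; unfold norm; simpl; unfold abs; simpl.
      pose proof (Rabs_pos u); nra. }
  intros y Hy eps.
  destruct H1 as [_ H1]; destruct H2 as [_ H2].
  specialize (H1 y Hy (mkposreal _ (is_pos_div_2 eps))).
  specialize (H2 y Hy (mkposreal _ (is_pos_div_2 eps))).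
  generalize (filter_and _ _ H1 H2); apply filter_imp.
  intros u [h1 h2]; simpl in h1, h2.
  rewrite C_R_norm; eapply Rle_trans; [apply Cmod_le_add|].
  unfold norm in *; simpl in *; unfold abs, scal, mult in *; simpl in *.
  unfold minus, plus, opp, mult in *; simpl in *.
  unfold plus, opp in *; simpl in *.
  unfold norm; simpl; unfold abs; simpl.
  lra.
Qed.

Lemma is_derive_RC_Re (f : R -> C) (x : R) (l : C) :
  is_derive_RC f x l -> is_derive (fun u => Re (f u)) x (Re l).
Proof.
  intros [_ H]; split; [apply is_linear_scal_l|].
  intros y Hy eps; generalize (H y Hy eps); apply filter_imp; intros u Hu.
  eapply Rle_trans; [| exact Hu]; rewrite C_R_norm.
  eapply Rle_trans; [| apply re_le_Cmod]; right; reflexivity.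
Qed.

Lemma is_derive_RC_Im (f : R -> C) (x : R) (l : C) :
  is_derive_RC f x l -> is_derive (fun u => Im (f u)) x (Im l).
Proof.
  intros [_ H]; split; [apply is_linear_scal_l|].
  intros y Hy eps; generalize (H y Hy eps); apply filter_imp; intros u Hu.
  eapply Rle_trans; [| exact Hu]; rewrite C_R_norm.
  eapply Rle_trans; [| apply Im_le_Cmod]; right; reflexivity.
Qed.

Lemma is_derive_RC_mult (f g : R -> C) (x : R) (l m : C) :
  is_derive_RC f x l -> is_derive_RC g x m ->
  is_derive_RC (fun u => f u * g u)%C x (l * g x + f x * m)%C.
Proof.
  intros Hf Hg.
  pose proof (is_derive_RC_Re _ _ _ Hf) as f1; pose proof (is_derive_RC_Im _ _ _ Hf) as f2.
  pose proof (is_derive_RC_Re _ _ _ Hg) as g1; pose proof (is_derive_RC_Im _ _ _ Hg) as g2.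
  apply is_derive_RC_pair; simpl.
  - evar_last;
     [apply (is_derive_minus (V := R_NormedModule)); apply Derive.is_derive_mult; eassumption|].
    unfold minus, plus, opp, Re, Im; simpl; ring.
  - evar_last;
     [apply (is_derive_plus (V := R_NormedModule)); apply Derive.is_derive_mult; eassumption|].
    unfold minus, plus, opp, Re, Im; simpl; ring.
Qed.

Lemma is_derive_RC_plus (f g : R -> C) (x : R) (l m : C) :
  is_derive_RC f x l -> is_derive_RC g x m ->
  is_derive_RC (fun u => f u + g u)%C x (l + m)%C.
Proof. exact (is_derive_plus (V := C_R_NormedModule) f g x l m). Qed.

Lemma is_derive_RC_minus (f g : R -> C) (x : R) (l m : C) :
  is_derive_RC f x l -> is_derive_RC g x m ->
  is_derive_RC (fun u => f u - g u)%C x (l - m)%C.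
Proof. exact (is_derive_minus (V := C_R_NormedModule) f g x l m). Qed.

Lemma is_derive_RC_opp (f : R -> C) (x : R) (l : C) :
  is_derive_RC f x l -> is_derive_RC (fun u => - f u)%C x (- l)%C.
Proof. exact (is_derive_opp (V := C_R_NormedModule) f x l). Qed.

Lemma is_derive_RC_const (c : C) (x : R) : is_derive_RC (fun _ => c) x (RtoC 0).
Proof. exact (is_derive_const (V := C_R_NormedModule) c x). Qed.

Lemma is_derive_RC_RtoC (f : R -> R) (x l : R) :
  is_derive f x l -> is_derive_RC (fun u => RtoC (f u)) x (RtoC l).
Proof.
  intros H; apply is_derive_RC_pair; [exact H |].
  exact (is_derive_const (V := R_NormedModule) 0 x).
Qed.

Lemma is_derive_RC_exp (f : R -> C) (x : R) (l : C) :
  is_derive_RC f x l -> is_derive_RC (fun u => Cexp (f u)) x (l * Cexp (f x))%C.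
Proof.
  intros Hf.
  pose proof (is_derive_RC_Re _ _ _ Hf) as f1; pose proof (is_derive_RC_Im _ _ _ Hf) as f2.
  apply is_derive_RC_pair; unfold Cexp; simpl.
  - evar_last.
    + apply Derive.is_derive_mult.
      * apply (is_derive_comp exp (fun u => Re (f u))); [apply is_derive_exp | eassumption].
      * apply (is_derive_comp cos (fun u => Im (f u))); [apply is_derive_cos | eassumption].
    + unfold scal; simpl; unfold mult, Re, Im; simpl; ring.
  - evar_last.
    + apply Derive.is_derive_mult.
      * apply (is_derive_comp exp (fun u => Re (f u))); [apply is_derive_exp | eassumption].
      * apply (is_derive_comp sin (fun u => Im (f u))); [apply is_derive_sin | eassumption].
    + unfold scal; simpl; unfold mult, Re, Im; simpl; ring.
Qed.

(** * The complex exponential *)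

Lemma Cexp_plus (z w : C) : Cexp (z + w)%C = (Cexp z * Cexp w)%C.
Proof.
  apply Ceq; unfold Cexp, Re, Im; simpl; rewrite exp_plus, ?cos_plus, ?sin_plus; ring.
Qed.

Lemma Cexp_0 : Cexp 0 = 1.
Proof. apply Ceq; unfold Cexp, Re, Im; simpl; rewrite exp_0, ?cos_0, ?sin_0; ring. Qed.

Lemma Cmod_Cexp (z : C) : Cmod (Cexp z) = exp (Re z).
Proof.
  unfold Cexp, Cmod; simpl.
  replace (_ + _) with (exp (Re z) * exp (Re z)).
  - apply sqrt_square; left; apply exp_pos.
  - pose proof (sin2_cos2 (Im z)) as H; unfold Rsqr in H.
    transitivity (exp (Re z) * exp (Re z) * (sin (Im z) * sin (Im z) + cos (Im z) * cos (Im z))).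
    + rewrite H; ring.
    + ring.
Qed.

Lemma Cexp_neq_0 (z : C) : Cexp z <> 0.
Proof.
  apply Cmod_gt_0; rewrite Cmod_Cexp; apply exp_pos.
Qed.

Lemma Cexp_RtoC (x : R) : Cexp (RtoC x) = RtoC (exp x).
Proof. apply Ceq; unfold Cexp, Re, Im; simpl; rewrite ?cos_0, ?sin_0; ring. Qed.

Lemma Cexp_conj (z : C) : Cexp (Cconj z) = Cconj (Cexp z).
Proof. apply Ceq; unfold Cexp, Re, Im; simpl; rewrite ?cos_neg, ?sin_neg; ring. Qed.

Lemma Cexp_opp (z : C) : Cexp (- z)%C = (/ Cexp z)%C.
Proof.
  pose proof (Cexp_neq_0 z) as H.
  assert (E : (Cexp (- z) * Cexp z)%C = 1).
  { rewrite <- Cexp_plus; replace (- z + z)%C with (RtoC 0) by ring; apply Cexp_0. }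
  replace (Cexp (- z)%C) with (Cexp (- z) * Cexp z * / Cexp z)%C by (field; exact H).
  rewrite E; ring.
Qed.

(** * Complex-valued integrals over segments *)

Lemma CRint_pair (f : R -> C) (a b : R) :
  ex_RInt (V := C_R_NormedModule) f a b ->
  CRint f a b = (RInt (fun u => Re (f u)) a b, RInt (fun u => Im (f u)) a b).
Proof.
  intros [l Hl].
  rewrite (is_RInt_unique (V := C_R_CompleteNormedModule) f a b l Hl).
  pose proof (is_RInt_fct_extend_fst (U := R_NormedModule) (V := R_NormedModule) _ _ _ _ Hl) as H1.
  pose proof (is_RInt_fct_extend_snd (U := R_NormedModule) (V := R_NormedModule) _ _ _ _ Hl) as H2.
  apply injective_projections; simpl; symmetry; apply is_RInt_unique; assumption.
Qed.

Lemma ex_CRint (f : R -> C) (a b : R) :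
  (forall u, Ccontinuous f u) -> ex_RInt (V := C_R_NormedModule) f a b.
Proof.
  intros H; apply (ex_RInt_continuous (V := C_R_CompleteNormedModule)); intros; apply H.
Qed.

Lemma ex_RInt_cont (f : R -> R) (a b : R) : (forall u, continuous f u) -> ex_RInt f a b.
Proof.
  intros H; apply (ex_RInt_continuous (V := R_CompleteNormedModule)); intros; apply H.
Qed.

Lemma RInt_Rext (f g : R -> R) (a b : R) : (forall t, f t = g t) -> RInt f a b = RInt g a b.
Proof. intros H; apply (RInt_ext (V := R_CompleteNormedModule)); intros; apply H. Qed.

Lemma RInt_Rplus (f g : R -> R) (a b : R) : ex_RInt f a b -> ex_RInt g a b ->
  RInt (fun t => f t + g t) a b = RInt f a b + RInt g a b.
Proof. exact (RInt_plus (V := R_CompleteNormedModule) f g a b). Qed.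

Lemma RInt_Rminus (f g : R -> R) (a b : R) : ex_RInt f a b -> ex_RInt g a b ->
  RInt (fun t => f t - g t) a b = RInt f a b - RInt g a b.
Proof. exact (RInt_minus (V := R_CompleteNormedModule) f g a b). Qed.

Lemma RInt_Rscal (c : R) (f : R -> R) (a b : R) : ex_RInt f a b ->
  RInt (fun t => c * f t) a b = c * RInt f a b.
Proof. exact (RInt_scal (V := R_CompleteNormedModule) f a b c). Qed.

Lemma CRint_Re (f : R -> C) (a b : R) :
  ex_RInt (V := C_R_NormedModule) f a b -> Re (CRint f a b) = RInt (fun u => Re (f u)) a b.
Proof. intros H; rewrite CRint_pair by exact H; reflexivity. Qed.

Lemma CRint_Im (f : R -> C) (a b : R) :
  ex_RInt (V := C_R_NormedModule) f a b -> Im (CRint f a b) = RInt (fun u => Im (f u)) a b.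
Proof. intros H; rewrite CRint_pair by exact H; reflexivity. Qed.

Lemma CRint_plus (f g : R -> C) (a b : R) :
  ex_RInt (V := C_R_NormedModule) f a b -> ex_RInt (V := C_R_NormedModule) g a b ->
  CRint (fun u => f u + g u)%C a b = (CRint f a b + CRint g a b)%C.
Proof. exact (RInt_plus (V := C_R_CompleteNormedModule) f g a b). Qed.

(** Multiplication by a complex constant is not a scalar multiplication of C as a real module, so it
    is checked on the components. *)
Lemma is_CRint_scal (c : C) (f : R -> C) (a b : R) (l : C) :
  is_RInt (V := C_R_NormedModule) f a b l ->
  is_RInt (V := C_R_NormedModule) (fun u => c * f u)%C a b (c * l)%C.
Proof.
  intros Hl.
  pose proof (is_RInt_fct_extend_fst (U := R_NormedModule) (V := R_NormedModule) _ _ _ _ Hl) as H1.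
  pose proof (is_RInt_fct_extend_snd (U := R_NormedModule) (V := R_NormedModule) _ _ _ _ Hl) as H2.
  apply (is_RInt_fct_extend_pair (U := R_NormedModule) (V := R_NormedModule)
           (fun u => (c * f u)%C) a b); simpl.
  - apply (is_RInt_minus (V := R_NormedModule));
      apply (is_RInt_scal (V := R_NormedModule)); assumption.
  - apply (is_RInt_plus (V := R_NormedModule));
      apply (is_RInt_scal (V := R_NormedModule)); assumption.
Qed.

Lemma CRint_scal (c : C) (f : R -> C) (a b : R) :
  ex_RInt (V := C_R_NormedModule) f a b ->
  CRint (fun u => c * f u)%C a b = (c * CRint f a b)%C.
Proof.
  intros [l Hl].
  rewrite (is_RInt_unique (V := C_R_CompleteNormedModule) f a b l Hl).
  apply (is_RInt_unique (V := C_R_CompleteNormedModule)), is_CRint_scal, Hl.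
Qed.

Lemma CRint_le (f : R -> C) (g : R -> R) (a b : R) :
  a <= b -> ex_RInt (V := C_R_NormedModule) f a b -> ex_RInt g a b ->
  (forall u, a <= u <= b -> Cmod (f u) <= g u) -> Cmod (CRint f a b) <= RInt g a b.
Proof.
  intros Hab Hf Hg H; rewrite <- C_R_norm.
  apply (norm_RInt_le (V := C_R_NormedModule) f g a b).
  - exact Hab.
  - intros x Hx; rewrite C_R_norm; apply H, Hx.
  - apply (RInt_correct (V := C_R_CompleteNormedModule)), Hf.
  - apply (RInt_correct (V := R_CompleteNormedModule)), Hg.
Qed.

Lemma CRint_derive (f df : R -> C) (a b : R) :
  (forall x, is_derive_RC f x (df x)) -> (forall x, Ccontinuous df x) ->
  CRint df a b = (f b - f a)%C.
Proof.
  intros H1 H2; apply (is_RInt_unique (V := C_R_CompleteNormedModule)).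
  apply (is_RInt_derive (V := C_R_CompleteNormedModule) f df a b); intros; auto.
Qed.

(** * Half-line integrals and Laplace transforms *)

Lemma Cplus_minus_cancel (a b : C) : (a + (b - a))%C = b.
Proof. ring. Qed.

(** The epsilon-delta form in which the differentiation rules over C are proved. *)
Lemma is_Cderive_iff (f : C -> C) (s l : C) :
  is_Cderive f s l <->
  forall eps : R, 0 < eps -> exists d : R, 0 < d /\
    forall w : C, Cmod w < d -> Cmod (f (s + w) - f s - w * l)%C <= eps * Cmod w.
Proof.
  split.
  - intros [_ H] eps He.
    destruct (H s (fun P h => h) (mkposreal eps He)) as [d Hd].
    exists d; split; [apply cond_pos|]; intros w Hw.
    specialize (Hd (s + w)%C).
    assert (Hd' : Cmod (s + w - s)%C < d ->
      Cmod (f (s + w) - f s - (s + w - s) * l)%C <= eps * Cmod (s + w - s)%C) by exact Hd.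
    replace (s + w - s)%C with w in Hd' by ring.
    exact (Hd' Hw).
  - intros H; split; [apply is_linear_scal_l|].
    intros y Hy eps.
    (* The definition asks for the estimate at every limit [y] of the neighbourhood filter of [s];
       the only one is [s]. *)
    apply (is_filter_lim_locally_unique (V := AbsRing_NormedModule C_AbsRing)) in Hy.
    rewrite <- Hy; clear y Hy.
    destruct (H eps (cond_pos eps)) as [d [Hd0 Hd]].
    exists (mkposreal d Hd0); intros y Hy.
    specialize (Hd (y - s)%C Hy).
    rewrite (Cplus_minus_cancel s y) in Hd.
    exact Hd.
Qed.

(** Laplace transforms are differentiated in this form: their remainder is of second order in
    [w]. *)
Lemma is_Cderive_quad (f : C -> C) (s l : C) (M d : R) :
  0 < d ->
  (forall w : C, Cmod w < d -> Cmod (f (s + w) - f s - w * l)%C <= M * Cmod w ^ 2) ->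
  is_Cderive f s l.
Proof.
  intros Hd H; apply is_Cderive_iff; intros eps He.
  assert (HM : 0 < Rabs M + 1) by (pose proof (Rabs_pos M); lra).
  exists (Rmin d (eps / (Rabs M + 1))); split.
  { apply Rmin_pos; [assumption | apply Rdiv_lt_0_compat; lra]. }
  intros w Hw.
  assert (H1 := Rlt_le_trans _ _ _ Hw (Rmin_l _ _)).
  assert (H2 := Rlt_le_trans _ _ _ Hw (Rmin_r _ _)).
  eapply Rle_trans; [apply H, H1|].
  pose proof (Cmod_ge_0 w); pose proof (Rle_abs M).
  apply Rle_trans with ((Rabs M + 1) * Cmod w ^ 2); [nra|].
  replace ((Rabs M + 1) * Cmod w ^ 2) with (((Rabs M + 1) * Cmod w) * Cmod w) by ring.
  apply Rmult_le_compat_r; [assumption|].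
  apply Rle_trans with ((Rabs M + 1) * (eps / (Rabs M + 1))).
  - apply Rmult_le_compat_l; lra.
  - right; field; lra.
Qed.

Lemma exp_decay_integral (K c a b : R) : 0 < c ->
  is_RInt (fun u => K * exp (- (c * u))) a b
    (K / c * (exp (- (c * a)) - exp (- (c * b)))).
Proof.
  intros Hc.
  evar_last.
  - apply (is_RInt_derive (V := R_CompleteNormedModule)
             (fun u => - (K / c) * exp (- (c * u)))); intros x _.
    + auto_derive; [exact I | field; lra].
    + apply (ex_derive_continuous (V := R_NormedModule)); auto_derive; exact I.
  - unfold minus, plus, opp; simpl; ring.
Qed.

(* [HI f] is the integral of [f] over [0, oo), and [TI f] below the integral over R. *)
Definition is_HI (f : R -> C) (l : C) : Prop :=
  filterlim (fun B => CRint f 0 B) (Rbar_locally p_infty) (locally (T := C_R_NormedModule) l).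

Definition HI (f : R -> C) : C := iota (T := C_R_CompleteNormedModule) (is_HI f).

(** Continuity is asked on all of R so that every integral over a segment exists; the explicit rate
    gives the bound [K / c] for the integral. *)
Definition decays (f : R -> C) (c K : R) : Prop :=
  (forall u, Ccontinuous f u) /\ 0 < c /\
  forall u, 0 <= u -> Cmod (f u) <= K * exp (- (c * u)).

Definition decaying (f : R -> C) : Prop := exists c K, decays f c K.

Lemma HI_unique (f : R -> C) (l : C) : is_HI f l -> HI f = l.
Proof. exact (iota_filterlim_locally (V := C_R_CompleteNormedModule) _ l). Qed.

Lemma decays_K_ge0 (f : R -> C) (c K : R) : decays f c K -> 0 <= K.
Proof.
  intros (_ & _ & H); specialize (H 0 (Rle_refl 0)).
  rewrite Rmult_0_r, Ropp_0, exp_0 in H; pose proof (Cmod_ge_0 (f 0)); lra.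
Qed.

Lemma decays_increment (f : R -> C) (c K a b : R) :
  decays f c K -> 0 <= a <= b ->
  Cmod (CRint f 0 b - CRint f 0 a)%C <= K / c * exp (- (c * a)).
Proof.
  intros D Hab; pose proof (decays_K_ge0 _ _ _ D) as HK; destruct D as (Hf & Hc & H).
  assert (E : (CRint f 0 b - CRint f 0 a)%C = CRint f a b).
  { assert (Ch : (CRint f 0 a + CRint f a b)%C = CRint f 0 b)
      by (apply (RInt_Chasles (V := C_R_CompleteNormedModule) f 0 a b); apply ex_CRint; exact Hf).
    rewrite <- Ch; ring. }
  rewrite E.
  eapply Rle_trans.
  - apply (CRint_le f (fun u => K * exp (- (c * u)))); [lra | apply ex_CRint; exact Hf | |].
    + eexists; apply exp_decay_integral, Hc.
    + intros u Hu; apply H; lra.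
  - rewrite (is_RInt_unique (V := R_CompleteNormedModule) _ _ _ _ (exp_decay_integral K c a b Hc)).
    pose proof (exp_pos (- (c * b))).
    assert (0 <= K / c) by (apply Rdiv_le_0_compat; lra).
    nra.
Qed.

Lemma exp_small (c K eps : R) : 0 < c -> 0 <= K -> 0 < eps ->
  exists B, 0 <= B /\ forall u, B <= u -> K * exp (- (c * u)) < eps.
Proof.
  intros Hc HK He.
  (* Since [exp (c u) >= 1 + c u], the value is below [eps] as soon as [c u >= K / eps]. *)
  exists (Rmax 0 (K / eps / c)); split; [apply Rmax_l|]; intros u Hu.
  assert (H1 := Rle_trans _ _ _ (Rmax_l _ _) Hu).
  assert (H2 := Rle_trans _ _ _ (Rmax_r _ _) Hu).
  assert (Hcu : K / eps <= c * u).
  { apply Rle_trans with (c * (K / eps / c)); [right; field; lra|].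
    apply Rmult_le_compat_l; lra. }
  rewrite exp_Ropp.
  pose proof (exp_ineq1_le (c * u)).
  assert (0 < exp (c * u)) by apply exp_pos.
  apply (Rmult_lt_reg_r (exp (c * u))); [assumption|].
  rewrite Rmult_assoc, Rinv_l, Rmult_1_r by lra.
  apply Rle_lt_trans with (eps * (c * u)).
  - apply Rle_trans with (eps * (K / eps)); [right; field; lra|].
    apply Rmult_le_compat_l; lra.
  - apply Rmult_lt_compat_l; lra.
Qed.

Lemma decays_is_HI (f : R -> C) (c K : R) : decays f c K -> is_HI f (HI f).
Proof.
  intros D; pose proof (decays_K_ge0 _ _ _ D) as HK.
  assert (Hc : 0 < c) by apply D.
  assert (X : exists l, is_HI f l).
  { apply (filterlim_locally_cauchy (U := C_R_CompleteNormedModule)); intros eps.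
    assert (HKc : 0 <= 2 * (K / c)) by (assert (0 <= K / c) by (apply Rdiv_le_0_compat; lra); lra).
    (* The factor 2 is for the two endpoints of the Cauchy criterion, each compared with [B]. *)
    destruct (exp_small c (2 * (K / c)) eps Hc HKc (cond_pos eps)) as [B [HB0 HB]].
    exists (fun x => B < x); split; [exists B; auto|].
    assert (Y : forall u v, B < u -> B < v ->
      Cmod (CRint f 0 v - CRint f 0 u)%C < eps).
    { intros u v Hu Hv.
      replace (CRint f 0 v - CRint f 0 u)%C
        with ((CRint f 0 v - CRint f 0 B) - (CRint f 0 u - CRint f 0 B))%C by ring.
      eapply Rle_lt_trans; [apply Cmod_triangle|]; rewrite Cmod_opp.
      assert (U := decays_increment f c K B u D); assert (V := decays_increment f c K B v D).
      specialize (HB B (Rle_refl B)).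
      eapply Rle_lt_trans; [| exact HB].
      eapply Rle_trans; [apply Rplus_le_compat; [apply V | apply U]; lra|]; right; ring. }
    intros u v Hu Hv.
    apply C_NormedModule_mixin_compat1.
    exact (Y u v Hu Hv). }
  destruct X as [l Hl]; rewrite (HI_unique f l Hl); exact Hl.
Qed.

Lemma decaying_is_HI (f : R -> C) : decaying f -> is_HI f (HI f).
Proof. intros (c & K & D); exact (decays_is_HI f c K D). Qed.

Lemma decaying_continuous (f : R -> C) : decaying f -> forall u, Ccontinuous f u.
Proof. intros (c & K & D); apply D. Qed.

Lemma filter_infty_ge (B : R) : Rbar_locally p_infty (fun x => B <= x).
Proof. exists B; intros; lra. Qed.

Lemma HI_tail (f : R -> C) (c K B : R) : decays f c K -> 0 <= B ->
  Cmod (HI f - CRint f 0 B)%C <= K / c * exp (- (c * B)).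
Proof.
  intros D HB.
  apply le_epsilon; intros eps He.
  pose proof (decays_is_HI f c K D) as L; unfold is_HI in L.
  apply (proj1 (Clim_iff (Rbar_locally p_infty) _ _)) with (eps := eps) in L; [| exact He].
  destruct (filter_ex _ (filter_and _ _ L (filter_infty_ge B))) as [x [Hx HxB]].
  replace (HI f - CRint f 0 B)%C
    with ((CRint f 0 x - CRint f 0 B) - (CRint f 0 x - HI f))%C by ring.
  eapply Rle_trans; [apply Cmod_triangle|]; rewrite Cmod_opp.
  pose proof (decays_increment f c K B x D (conj HB HxB)); lra.
Qed.

Lemma CRint_point (f : R -> C) (a : R) : CRint f a a = RtoC 0.
Proof. exact (RInt_point (V := C_R_CompleteNormedModule) a f). Qed.

Lemma HI_le (f : R -> C) (c K : R) : decays f c K -> Cmod (HI f) <= K / c.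
Proof.
  intros D; pose proof (HI_tail f c K 0 D (Rle_refl 0)) as H.
  rewrite CRint_point, Rmult_0_r, Ropp_0, exp_0, Rmult_1_r in H.
  replace (HI f - 0)%C with (HI f) in H by ring; exact H.
Qed.

Lemma HI_ext (f g : R -> C) : decaying f -> (forall u, 0 < u -> f u = g u) -> HI g = HI f.
Proof.
  intros Hf H; apply HI_unique.
  eapply (filterlim_ext_loc (F := Rbar_locally p_infty)); [| exact (decaying_is_HI f Hf)].
  eapply filter_imp; [| exact (filter_infty_ge 0)]; intros B HB.
  apply RInt_ext; intros x; rewrite Rmin_left by lra; intros Hx; apply H, Hx.
Qed.

Lemma decaying_plus (f g : R -> C) :
  decaying f -> decaying g -> decaying (fun u => f u + g u)%C.
Proof.
  intros (c & K & D) (d & M & E).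
  pose proof (decays_K_ge0 _ _ _ D) as HK; pose proof (decays_K_ge0 _ _ _ E) as HM.
  destruct D as (D1 & D2 & D3); destruct E as (E1 & E2 & E3).
  exists (Rmin c d), (K + M); split; [| split].
  - intros u; apply Ccontinuous_plus; auto.
  - apply Rmin_pos; assumption.
  - intros u Hu; eapply Rle_trans; [apply Cmod_triangle|].
    specialize (D3 u Hu); specialize (E3 u Hu).
    assert (L : forall x, Rmin c d <= x -> exp (- (x * u)) <= exp (- (Rmin c d * u))).
    { intros x Hx; destruct (Rle_lt_or_eq_dec 0 u Hu) as [h|h].
      - destruct Hx as [Hx | Hx]; [left; apply exp_increasing; nra | rewrite Hx; lra].
      - rewrite <- h, !Rmult_0_r; lra. }
    pose proof (L c (Rmin_l _ _)); pose proof (L d (Rmin_r _ _)); nra.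
Qed.

Lemma decaying_scal (a : C) (f : R -> C) : decaying f -> decaying (fun u => a * f u)%C.
Proof.
  intros (c & K & D1 & D2 & D3); exists c, (Cmod a * K); split; [| split; [assumption|]].
  - intros u; apply Ccontinuous_mult; [apply Ccontinuous_const | apply D1].
  - intros u Hu; rewrite Cmod_mult, Rmult_assoc.
    apply Rmult_le_compat_l; [apply Cmod_ge_0 | apply D3, Hu].
Qed.

Lemma HI_plus (f g : R -> C) :
  decaying f -> decaying g -> HI (fun u => f u + g u)%C = (HI f + HI g)%C.
Proof.
  intros Hf Hg; apply HI_unique; unfold is_HI.
  eapply filterlim_ext;
    [| apply Clim_plus; [typeclasses eauto | exact (decaying_is_HI f Hf) | exact (decaying_is_HI g Hg)]].
  intros B; symmetry; apply CRint_plus; apply ex_CRint, decaying_continuous; assumption.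
Qed.

Lemma HI_scal (a : C) (f : R -> C) : decaying f -> HI (fun u => a * f u)%C = (a * HI f)%C.
Proof.
  intros Hf; apply HI_unique; unfold is_HI.
  eapply filterlim_ext; [| apply Clim_scal; [typeclasses eauto | exact (decaying_is_HI f Hf)]].
  intros B; symmetry; apply CRint_scal; apply ex_CRint, decaying_continuous; assumption.
Qed.

Lemma decaying_ext (f g : R -> C) : (forall u, f u = g u) -> decaying f -> decaying g.
Proof.
  intros E (c & K & D1 & D2 & D3); exists c, K; split; [| split; [assumption|]].
  - intros u; eapply continuous_ext; [exact E | apply D1].
  - intros u Hu; rewrite <- E; apply D3, Hu.
Qed.

Lemma decaying_minus (f g : R -> C) :
  decaying f -> decaying g -> decaying (fun u => f u - g u)%C.
Proof.
  intros Hf Hg; eapply decaying_ext; [| exact (decaying_plus _ _ Hf (decaying_scal (RtoC (-1)) _ Hg))].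
  intros u; simpl; creal.
Qed.

Lemma HI_minus (f g : R -> C) :
  decaying f -> decaying g -> HI (fun u => f u - g u)%C = (HI f - HI g)%C.
Proof.
  intros Hf Hg.
  pose proof (decaying_scal (RtoC (-1)) g Hg) as Hg'.
  rewrite (HI_ext (fun u => f u + RtoC (-1) * g u)%C).
  - rewrite HI_plus, HI_scal by assumption; creal.
  - apply decaying_plus; assumption.
  - intros u _; creal.
Qed.

Lemma HI_Re_ge0 (f : R -> C) : decaying f -> (forall u, 0 < u -> 0 <= Re (f u)) -> 0 <= Re (HI f).
Proof.
  intros Hf H.
  pose proof (decaying_is_HI f Hf) as L.
  apply Clim_Re in L; [| typeclasses eauto].
  assert (X : Rbar_le (Finite 0) (Finite (Re (HI f)))); [| exact X].
  refine (filterlim_le (F := Rbar_locally p_infty) (fun _ => 0) (fun B => Re (CRint f 0 B)) _ _ _ _ _).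
  - eapply filter_imp; [| exact (filter_infty_ge 0)]; intros B HB; cbv beta.
    assert (C0 := decaying_continuous f Hf).
    rewrite CRint_Re by (apply ex_CRint; exact C0).
    apply RInt_ge_0; [exact HB | |].
    + apply ex_RInt_cont; intros; apply Ccontinuous_Re, C0.
    + intros x Hx; apply H; lra.
  - apply filterlim_const.
  - exact L.
Qed.

Lemma decaying_conj (f : R -> C) : decaying f -> decaying (fun u => Cconj (f u)).
Proof.
  intros (c & K & D1 & D2 & D3); exists c, K; split; [| split; [assumption|]].
  - intros u; apply Ccontinuous_conj, D1.
  - intros u Hu; rewrite Cmod_conj; apply D3, Hu.
Qed.

Lemma HI_conj (f : R -> C) : decaying f -> HI (fun u => Cconj (f u)) = Cconj (HI f).
Proof.
  intros Hf; pose proof (decaying_is_HI f Hf) as L.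
  pose proof (decaying_continuous _ Hf) as C0.
  pose proof (decaying_continuous _ (decaying_conj _ Hf)) as C1.
  apply HI_unique, Clim_pair; [typeclasses eauto | |].
  - rewrite re_conj.
    eapply filterlim_ext; [| apply Clim_Re; [typeclasses eauto | exact L]].
    intros B; cbv beta; rewrite !CRint_Re by (apply ex_CRint; assumption); reflexivity.
  - rewrite im_conj.
    apply filterlim_ext with (f := fun B => - Im (CRint f 0 B)).
    + intros B; cbv beta; rewrite !CRint_Im by (apply ex_CRint; assumption).
      symmetry; apply (RInt_opp (V := R_CompleteNormedModule)).
      apply ex_RInt_cont; intros; apply Ccontinuous_Im, C0.
    + eapply filterlim_comp; [apply Clim_Im; [typeclasses eauto | exact L]|].
      apply (filterlim_opp (V := R_NormedModule)).
Qed.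

Lemma HI_derive (phi f : R -> C) (l : C) :
  (forall u, is_derive_RC phi u (f u)) -> (forall u, Ccontinuous f u) ->
  filterlim phi (Rbar_locally p_infty) (locally (T := C_R_NormedModule) l) ->
  HI f = (l - phi 0)%C.
Proof.
  intros H1 H2 H3; apply HI_unique; unfold is_HI.
  apply (filterlim_ext (fun B => phi B + - phi 0)%C).
  - intros B; rewrite (CRint_derive phi f) by assumption; reflexivity.
  - apply Clim_plus; [typeclasses eauto | exact H3 | apply filterlim_const].
Qed.

Lemma is_derive_RC_lin (z : C) (x : R) : is_derive_RC (fun t => z * RtoC t)%C x z.
Proof.
  evar_last.
  - apply is_derive_RC_mult; [apply is_derive_RC_const|].
    apply is_derive_RC_RtoC, is_derive_id.
  - unfold one; simpl; ring.
Qed.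

Lemma Ccontinuous_lin (z : C) (x : R) : Ccontinuous (fun t => z * RtoC t)%C x.
Proof.
  apply Ccontinuous_mult; [apply Ccontinuous_const|].
  apply Ccontinuous_RtoC, continuous_id.
Qed.

(** Integrate the derivative [z exp (z t)] of [exp (z t)] over [0 <= t <= 1]. *)
Lemma Cexp_sub1_le (z : C) : Cmod (Cexp z - 1)%C <= Cmod z * exp (Cmod z).
Proof.
  assert (D : forall x, is_derive_RC (fun t => Cexp (z * RtoC t)%C) x (z * Cexp (z * RtoC x))%C).
  { intros x; evar_last.
    - apply is_derive_RC_exp, is_derive_RC_lin.
    - reflexivity. }
  assert (Ct : forall x, Ccontinuous (fun t => z * Cexp (z * RtoC t))%C x).
  { intros x; apply Ccontinuous_mult; [apply Ccontinuous_const|].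
    apply Ccontinuous_exp, Ccontinuous_lin. }
  pose proof (CRint_derive _ _ 0 1 D Ct) as E; cbv beta in E.
  replace (z * RtoC 1)%C with z in E by ring.
  replace (z * RtoC 0)%C with (RtoC 0) in E by ring.
  rewrite Cexp_0 in E; rewrite <- E.
  eapply Rle_trans.
  - apply (CRint_le _ (fun _ => Cmod z * exp (Cmod z))); [lra | apply ex_CRint, Ct | |].
    + apply ex_RInt_const.
    + intros u Hu; rewrite Cmod_mult, Cmod_Cexp.
      apply Rmult_le_compat_l; [apply Cmod_ge_0|].
      assert (L : Re (z * RtoC u)%C <= Cmod z).
      { eapply Rle_trans; [apply Re_le_Cmod|].
        rewrite Cmod_mult, Cmod_R, Rabs_pos_eq by lra.
        pose proof (Cmod_ge_0 z); nra. }
      destruct L as [L|L]; [left; apply exp_increasing, L | rewrite L; lra].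
  - rewrite RInt_const; unfold scal; simpl; unfold mult; simpl; lra.
Qed.

Lemma exp_le (x y : R) : x <= y -> exp x <= exp y.
Proof. intros [H|H]; [left; apply exp_increasing, H | rewrite H; lra]. Qed.

(** The same once more: the derivative of [exp (z t) - z t] is [z (exp (z t) - 1)], which the
    previous bound controls. *)
Lemma Cexp_sub2_le (z : C) : Cmod (Cexp z - 1 - z)%C <= Cmod z ^ 2 * exp (Cmod z).
Proof.
  assert (D : forall x, is_derive_RC (fun t => Cexp (z * RtoC t) - z * RtoC t)%C x
     (z * (Cexp (z * RtoC x) - 1))%C).
  { intros x; evar_last.
    - apply is_derive_RC_minus; [apply is_derive_RC_exp|]; apply is_derive_RC_lin.
    - cbv beta; ring. }
  assert (Ct : forall x, Ccontinuous (fun t => z * (Cexp (z * RtoC t) - 1))%C x).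
  { intros x; apply Ccontinuous_mult; [apply Ccontinuous_const|].
    apply Ccontinuous_minus; [| apply Ccontinuous_const].
    apply Ccontinuous_exp, Ccontinuous_lin. }
  pose proof (CRint_derive _ _ 0 1 D Ct) as E; cbv beta in E.
  replace (z * RtoC 1)%C with z in E by ring.
  replace (z * RtoC 0)%C with (RtoC 0) in E by ring.
  rewrite Cexp_0 in E.
  replace (Cexp z - z - (1 - 0))%C with (Cexp z - 1 - z)%C in E by ring.
  rewrite <- E.
  eapply Rle_trans.
  - apply (CRint_le _ (fun _ => Cmod z ^ 2 * exp (Cmod z))); [lra | apply ex_CRint, Ct | |].
    + apply ex_RInt_const.
    + intros u Hu; rewrite Cmod_mult.
      simpl; rewrite Rmult_1_r, Rmult_assoc.
      apply Rmult_le_compat_l; [apply Cmod_ge_0|].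
      eapply Rle_trans; [apply Cexp_sub1_le|].
      assert (L : Cmod (z * RtoC u)%C <= Cmod z).
      { rewrite Cmod_mult, Cmod_R, Rabs_pos_eq by lra.
        pose proof (Cmod_ge_0 z); nra. }
      apply Rmult_le_compat; [apply Cmod_ge_0 | left; apply exp_pos | exact L | apply exp_le, L].
  - rewrite RInt_const; unfold scal; simpl; unfold mult; simpl; lra.
Qed.

(** With the sign [exp (s u)] and x = exp u this is the Mellin integral of x^(s-1) k(log x) over [1,
    ∞). *)
Definition Laplace (k : R -> R) (s : C) : C := HI (fun u => Cexp (s * RtoC u) * RtoC (k u))%C.

Lemma Laplace_decays (k : R -> R) (A K : R) (s : C) :
  (forall u, continuous k u) -> (forall u, 0 <= u -> Rabs (k u) <= K * exp (- (A * u))) ->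
  Re s < A -> decays (fun u => Cexp (s * RtoC u) * RtoC (k u))%C (A - Re s) K.
Proof.
  intros Hk HK Hs; split; [| split; [lra|]].
  - intros u; apply Ccontinuous_mult; [| apply Ccontinuous_RtoC, Hk].
    apply Ccontinuous_exp, Ccontinuous_lin.
  - intros u Hu; rewrite Cmod_mult, Cmod_Cexp, Cmod_R.
    replace (Re (s * RtoC u)%C) with (Re s * u) by (unfold Re; simpl; ring).
    replace (- ((A - Re s) * u)) with (Re s * u + - (A * u)) by ring.
    rewrite exp_plus; specialize (HK u Hu); pose proof (exp_pos (Re s * u)); nra.
Qed.

Lemma exp_ge_sq (x : R) : 0 <= x -> x ^ 2 / 4 <= exp x.
Proof.
  intros H; replace (exp x) with (exp (x / 2 + x / 2)) by (f_equal; field).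
  rewrite exp_plus; pose proof (exp_ineq1_le (x / 2)); nra.
Qed.

Lemma Laplace_derive (k : R -> R) (A K : R) (s : C) :
  (forall u, continuous k u) -> (forall u, 0 <= u -> Rabs (k u) <= K * exp (- (A * u))) ->
  Re s < A -> is_Cderive (Laplace k) s (Laplace (fun u => u * k u) s).
Proof.
  intros Hk HK Hs.
  (* The gap [A - Re s] is cut in four: one [d] absorbs the factor [u ^ 2], one the growth
     [exp (Cmod w * u)], and [2 * d] is left to make the remainder integrable. *)
  set (d := (A - Re s) / 4); assert (Hd : 0 < d) by (unfold d; lra).
  assert (HK0 : 0 <= K).
  { specialize (HK 0 (Rle_refl 0)); rewrite Rmult_0_r, Ropp_0, exp_0 in HK.
    pose proof (Rabs_pos (k 0)); lra. }
  assert (Hu2 : forall u, 0 <= u -> u ^ 2 <= 4 / d ^ 2 * exp (d * u)).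
  { intros u Hu; assert (H := exp_ge_sq (d * u)).
    apply Rmult_le_reg_l with (d ^ 2); [nra|].
    replace (d ^ 2 * (4 / d ^ 2 * exp (d * u))) with (4 * exp (d * u)) by (field; lra).
    assert (H0 : 0 <= d * u) by nra; specialize (H H0).
    replace (d ^ 2 * u ^ 2) with ((d * u) ^ 2) by ring; lra. }
  assert (Hku : forall u, continuous (fun u => u * k u) u).
  { intros u; apply (continuous_mult (K := R_AbsRing)); [apply continuous_id | apply Hk]. }
  assert (HKu : forall u, 0 <= u -> Rabs (u * k u) <= K / d * exp (- ((A - d) * u))).
  { intros u Hu; rewrite Rabs_mult, (Rabs_pos_eq u) by assumption.
    replace (- ((A - d) * u)) with (d * u + - (A * u)) by ring; rewrite exp_plus.
    specialize (HK u Hu).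
    assert (u <= / d * exp (d * u)).
    { apply Rmult_le_reg_l with d; [assumption|].
      rewrite <- Rmult_assoc, Rinv_r by lra.
      pose proof (exp_ineq1_le (d * u)); lra. }
    replace (K / d * (exp (d * u) * exp (- (A * u))))
      with ((/ d * exp (d * u)) * (K * exp (- (A * u)))) by (field; lra).
    apply Rmult_le_compat; try assumption; apply Rabs_pos. }
  assert (Ds := Laplace_decays k A K s Hk HK Hs).
  assert (Dus : decaying (fun u => Cexp (s * RtoC u) * RtoC (u * k u))%C).
  { exists (A - d - Re s), (K / d); apply Laplace_decays; [assumption | assumption | unfold d; lra]. }
  apply is_Cderive_quad with (M := K * (4 / d ^ 2) / (2 * d)) (d := d); [assumption|].
  intros w Hw.
  assert (Dw : decaying (fun u => Cexp ((s + w) * RtoC u) * RtoC (k u))%C).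
  { exists (A - Re (s + w)%C), K; apply Laplace_decays; [assumption | assumption |].
    pose proof (Re_le_Cmod w); change (Re (s + w)%C) with (Re s + Re w); unfold d in *; lra. }
  assert (D : decays (fun u => Cexp ((s + w) * RtoC u) * RtoC (k u)
      - Cexp (s * RtoC u) * RtoC (k u) - w * (Cexp (s * RtoC u) * RtoC (u * k u)))%C
      (2 * d) (K * (4 / d ^ 2) * Cmod w ^ 2)).
  { split; [| split; [lra |]].
    - apply decaying_continuous, decaying_minus;
       [apply decaying_minus; [exact Dw | exists (A - Re s), K; exact Ds] | apply decaying_scal, Dus].
    - intros u Hu.
      replace (Cexp ((s + w) * RtoC u) * RtoC (k u) - Cexp (s * RtoC u) * RtoC (k u)
                - w * (Cexp (s * RtoC u) * RtoC (u * k u)))%C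
        with ((Cexp (s * RtoC u) * RtoC (k u)) * (Cexp (w * RtoC u) - 1 - w * RtoC u))%C.
      2: { replace ((s + w) * RtoC u)%C with (s * RtoC u + w * RtoC u)%C by ring.
           rewrite Cexp_plus, RtoC_mult; ring. }
      rewrite Cmod_mult.
      destruct Ds as (_ & _ & Ds); specialize (Ds u Hu).
      pose proof (Cexp_sub2_le (w * RtoC u)) as T.
      rewrite Cmod_mult, Cmod_R, (Rabs_pos_eq u) in T by assumption.
      assert (T2 : exp (Cmod w * u) <= exp (d * u)) by (apply exp_le; nra).
      replace (A - Re s) with (4 * d) in Ds by (unfold d; field).
      apply Rle_trans with ((K * exp (- (4 * d * u))) * (Cmod w ^ 2 * (4 / d ^ 2 * exp (d * u)) * exp (d * u))).
      + apply Rmult_le_compat; [apply Cmod_ge_0 | apply Cmod_ge_0 | exact Ds |].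
        eapply Rle_trans; [exact T|].
        apply Rmult_le_compat; [apply pow2_ge_0 | left; apply exp_pos | | exact T2].
        rewrite Rpow_mult_distr; apply Rmult_le_compat_l; [apply pow2_ge_0 | apply Hu2, Hu].
      + right; replace (- (2 * d * u)) with (- (4 * d * u) + (d * u + d * u)) by ring.
        rewrite !exp_plus; ring. }
  assert (Ds' : decaying (fun u => Cexp (s * RtoC u) * RtoC (k u))%C) by (exists (A - Re s), K; exact Ds).
  apply HI_le in D.
  rewrite HI_minus, HI_minus, HI_scal in D;
    [| assumption | assumption | assumption | apply decaying_minus; assumption
     | apply decaying_scal; assumption].
  unfold Laplace; eapply Rle_trans; [exact D|]; right; field; lra.
Qed.

Lemma Laplace_conj (k : R -> R) (A K : R) (s : C) :
  (forall u, continuous k u) -> (forall u, 0 <= u -> Rabs (k u) <= K * exp (- (A * u))) ->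
  Re s < A -> Laplace k (Cconj s) = Cconj (Laplace k s).
Proof.
  intros H1 H2 H3; unfold Laplace.
  assert (D : decaying (fun u => Cexp (s * RtoC u) * RtoC (k u))%C)
    by (exists (A - Re s), K; apply Laplace_decays; assumption).
  rewrite <- HI_conj by exact D.
  apply HI_ext; [apply decaying_conj, D|].
  intros u _; rewrite Cmult_conj, <- Cexp_conj, Cmult_conj.
  rewrite !Cconj_RtoC; reflexivity.
Qed.

(** * The question mark function *)

(** The tool for the order properties of F: the functional equations halve any defect, so in the end
    there is none. *)
Lemma le_halving (y d : R) : (forall n : nat, y <= d * (/ 2) ^ n) -> y <= 0.
Proof.
  intros H.
  assert (L : is_lim_seq (fun n => d * (/ 2) ^ n) (d * 0)).
  { apply (is_lim_seq_scal_l _ d (Finite 0)), is_lim_seq_geom.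
    rewrite Rabs_pos_eq; lra. }
  rewrite Rmult_0_r in L.
  exact (is_lim_seq_le _ _ (Finite y) (Finite 0) H (is_lim_seq_const y) L).
Qed.

Lemma cf_tail_gt1 (x : R) (k : nat) (y : R) : cf_tail x (S k) = Some y -> 1 < y.
Proof.
  simpl; destruct (cf_tail x k) as [z|]; [| discriminate].
  destruct (Req_EM_T (frac_part z) 0) as [e|n]; [discriminate|].
  intros E; injection E as <-.
  destruct (base_fp z) as [h1 h2].
  rewrite <- Rinv_1; apply Rinv_lt_contravar; lra.
Qed.

(** Complete quotients after the zeroth exceed 1, so their integer parts are at least 1. This gives
    the series of F a geometric majorant of ratio 1/2. *)
Lemma cf_quotient_sum_ge (x : R) (k : nat) (y : R) :
  cf_tail x k = Some y -> (Int_part x + Z.of_nat k <= cf_quotient_sum x k)%Z.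
Proof.
  revert y; induction k as [|k IH]; intros y E.
  - simpl; unfold cf_quotient; simpl; lia.
  - assert (Q : (1 <= cf_quotient x (S k))%Z).
    { unfold cf_quotient; rewrite E.
      pose proof (cf_tail_gt1 x k y E) as H.
      destruct (base_Int_part y) as [h1 h2].
      assert (0 < Int_part y)%Z by (apply lt_IZR; lra); lia. }
    assert (exists z, cf_tail x k = Some z) as [z Hz].
    { simpl in E; destruct (cf_tail x k) as [z|]; [exists z; reflexivity | discriminate]. }
    specialize (IH z Hz); change (cf_quotient_sum x (S k)) with
      (cf_quotient_sum x k + cf_quotient x (S k))%Z; lia.
Qed.

Lemma powerRZ_2_opp_le (m n : Z) : (m <= n)%Z -> powerRZ 2 (- n) <= powerRZ 2 (- m).
Proof.
  intros H; replace (- m)%Z with (- n + Z.of_nat (Z.to_nat (n - m)))%Z by lia.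
  rewrite powerRZ_add, <- pow_powerRZ by lra.
  pose proof (powerRZ_lt 2 (- n) ltac:(lra)).
  assert (1 <= 2 ^ Z.to_nat (n - m)) by (apply pow_R1_Rle; lra).
  nra.
Qed.

Lemma question_mark_term_le (x : R) (k : nat) :
  Rabs (question_mark_term x k) <= powerRZ 2 (- Int_part x) * (/ 2) ^ k.
Proof.
  pose proof (powerRZ_lt 2 (- Int_part x) ltac:(lra)) as P.
  assert (Q : 0 < (/ 2) ^ k) by (apply pow_lt; lra).
  unfold question_mark_term; destruct (cf_tail x k) as [y|] eqn:E.
  - rewrite Rabs_mult, pow_1_abs, Rmult_1_l.
    rewrite Rabs_pos_eq by (left; apply powerRZ_lt; lra).
    eapply Rle_trans; [apply powerRZ_2_opp_le, (cf_quotient_sum_ge x k y E)|].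
    replace (- (Int_part x + Z.of_nat k))%Z with (- Int_part x + - Z.of_nat k)%Z by lia.
    rewrite powerRZ_add, (powerRZ_neg' _ (Z.of_nat k)), <- pow_powerRZ, pow_inv by lra; lra.
  - rewrite Rabs_R0; nra.
Qed.

Lemma ex_series_question_mark_abs (x : R) :
  ex_series (fun k => Rabs (question_mark_term x k)).
Proof.
  apply (ex_series_le (K := R_AbsRing) (V := R_CompleteNormedModule) _
           (fun k => powerRZ 2 (- Int_part x) * (/ 2) ^ k)).
  - intros k; unfold norm; simpl; unfold abs; simpl; rewrite Rabs_Rabsolu.
    apply question_mark_term_le.
  - apply (ex_series_scal (V := R_NormedModule)), ex_series_geom.
    rewrite Rabs_pos_eq; lra.
Qed.

Lemma ex_series_question_mark (x : R) : ex_series (question_mark_term x).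
Proof. apply ex_series_Rabs, ex_series_question_mark_abs. Qed.

Lemma frac_part_01 (x : R) : 0 <= x < 1 -> Int_part x = 0%Z /\ frac_part x = x.
Proof.
  intros H; assert (E : Int_part x = 0%Z) by (symmetry; apply Int_part_spec; simpl; lra).
  split; [exact E|]; unfold frac_part; rewrite E; lra.
Qed.

Lemma question_mark_0 : question_mark 0 = 0.
Proof.
  destruct (frac_part_01 0 ltac:(lra)) as [E1 E2].
  unfold question_mark; rewrite Series_incr_1 by apply ex_series_question_mark.
  assert (T : forall k, cf_tail 0 (S k) = None).
  { induction k as [|k IH].
    - simpl; rewrite E2; destruct (Req_EM_T 0 0); [reflexivity | lra].
    - change (match cf_tail 0 (S k) with
       | Some y => if Req_EM_T (frac_part y) 0 then None else Some (/ frac_part y)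
       | None => None end = None); rewrite IH; reflexivity. }
  (* The expansion of 0 stops at once, so the tail vanishes; the factor 0 in front lets
     [Series_scal_l] evaluate it. *)
  rewrite (Series_ext _ (fun k => 0 * 0 ^ k)).
  - rewrite Series_scal_l.
    unfold question_mark_term; simpl; unfold cf_quotient; simpl; rewrite E1; simpl; lra.
  - intros k; unfold question_mark_term; rewrite T; lra.
Qed.

(** The expansion of [/ x] is that of [x] without its leading quotient 0. Deleting this quotient
    keeps the partial sums of quotients and flips every sign; the deleted term is -1. *)
Lemma question_mark_inv_lt1 (x : R) : 0 < x < 1 -> question_mark x = 1 - question_mark (/ x).
Proof.
  intros Hx; destruct (frac_part_01 x ltac:(lra)) as [E1 E2].
  assert (T : forall k, cf_tail x (S k) = cf_tail (/ x) k).
  { induction k as [|k IH].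
    - simpl; rewrite E2; destruct (Req_EM_T x 0); [lra | reflexivity].
    - change (match cf_tail x (S k) with
       | Some y => if Req_EM_T (frac_part y) 0 then None else Some (/ frac_part y)
       | None => None end = cf_tail (/ x) (S k)); rewrite IH; reflexivity. }
  assert (S : forall k, cf_quotient_sum x (S k) = cf_quotient_sum (/ x) k).
  { induction k as [|k IH].
    - simpl; unfold cf_quotient; rewrite T; simpl; rewrite E1; lia.
    - change (cf_quotient_sum x (S k) + cf_quotient x (S (S k)) = cf_quotient_sum (/ x) (S k))%Z.
      rewrite IH; simpl; unfold cf_quotient; rewrite T; reflexivity. }
  unfold question_mark; rewrite (Series_incr_1 (question_mark_term x))
    by apply ex_series_question_mark.
  rewrite (Series_ext (fun k => question_mark_term x (Datatypes.S k))
             (fun k => -1 * question_mark_term (/ x) k)).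
  - rewrite Series_scal_l.
    unfold question_mark_term at 1; simpl; unfold cf_quotient; simpl; rewrite E1; simpl; lra.
  - intros k; unfold question_mark_term; rewrite T, S.
    destruct (cf_tail (/ x) k); [rewrite <- tech_pow_Rmult; ring | ring].
Qed.

Lemma question_mark_1 : question_mark 1 = / 2.
Proof.
  replace 1 with (0 + 1) by lra; rewrite question_mark_shift, question_mark_0; lra.
Qed.

Lemma question_mark_sub1 (x : R) : question_mark x = 1 / 2 + 1 / 2 * question_mark (x - 1).
Proof. rewrite <- question_mark_shift; f_equal; lra. Qed.

Lemma question_mark_inv (x : R) : 0 < x -> question_mark (/ x) = 1 - question_mark x.
Proof.
  intros H; destruct (Rtotal_order x 1) as [L|[L|L]].
  - rewrite (question_mark_inv_lt1 x) by lra; lra.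
  - subst x; rewrite Rinv_1, question_mark_1; lra.
  - rewrite (question_mark_inv_lt1 (/ x)); [rewrite Rinv_inv; lra|].
    split; [apply Rinv_0_lt_compat; lra|].
    rewrite <- Rinv_1; apply Rinv_lt_contravar; lra.
Qed.

Lemma Rinv_ge1 (x : R) : 0 < x <= 1 -> 1 <= / x.
Proof. intros H; rewrite <- Rinv_1; apply Rinv_le_contravar; lra. Qed.

(** Summing the geometric majorant gives a crude bound on F. The shift equation then halves the
    excess over [[0, 1]] on arguments at least 1, and inversion carries this to [(0, 1)]. *)
Lemma question_mark_bounds (x : R) : 0 <= x -> 0 <= question_mark x <= 1.
Proof.
  assert (B : forall x, 0 <= x -> Rabs (question_mark x - 1) <= 2).
  { intros y Hy; unfold question_mark.
    replace (1 + Series (question_mark_term y) - 1) with (Series (question_mark_term y)) by ring.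
    eapply Rle_trans; [apply Series_Rabs, ex_series_question_mark_abs|].
    assert (Hi : (0 <= Int_part y)%Z).
    { destruct (base_Int_part y) as [h1 h2].
      assert (-1 < Int_part y)%Z by (apply lt_IZR; simpl; lra); lia. }
    eapply Rle_trans.
    - apply (Series_le _ (fun k => powerRZ 2 (- Int_part y) * (/ 2) ^ k)).
      + intros k; split; [apply Rabs_pos | apply question_mark_term_le].
      + apply (ex_series_scal (V := R_NormedModule)), ex_series_geom; rewrite Rabs_pos_eq; lra.
    - rewrite Series_scal_l, Series_geom by (rewrite Rabs_pos_eq; lra).
      pose proof (powerRZ_2_opp_le 0 (Int_part y) Hi) as H; simpl in H; lra. }
  (* The 3 only has to cover the crude bound at [n = 0], where F lies in [[-1, 3]]. *)
  assert (H : forall n x, 0 <= x -> - (3 * (/ 2) ^ n) <= question_mark x <= 1 + 3 * (/ 2) ^ n).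
  { induction n as [|n IH]; intros y Hy.
    - specialize (B y Hy); apply Rabs_le_between in B; simpl; lra.
    - assert (G : forall z, 1 <= z -> 1 / 2 - 3 * (/ 2) ^ S n <= question_mark z <= 1 + 3 * (/ 2) ^ S n).
      { intros z Hz; rewrite question_mark_sub1; specialize (IH (z - 1) ltac:(lra)); simpl; lra. }
      assert (0 < (/ 2) ^ S n) by (apply pow_lt; lra).
      destruct (Rle_lt_dec 1 y) as [L|L].
      + specialize (G y L); lra.
      + destruct Hy as [Hy|Hy].
        * specialize (G (/ y) (Rinv_ge1 y ltac:(lra))); rewrite question_mark_inv in G by lra; lra.
        * rewrite <- Hy, question_mark_0; lra. }
  intros Hx; split.
  - cut (- question_mark x <= 0); [lra|]; apply (le_halving _ 3).
    intros n; specialize (H n x Hx); lra.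
  - cut (question_mark x - 1 <= 0); [lra|]; apply (le_halving _ 3).
    intros n; specialize (H n x Hx); lra.
Qed.

Lemma question_mark_ge1 (x : R) : 1 <= x -> / 2 <= question_mark x.
Proof.
  intros H; rewrite question_mark_sub1.
  pose proof (question_mark_bounds (x - 1) ltac:(lra)); lra.
Qed.

Lemma question_mark_le1 (x : R) : 0 <= x <= 1 -> question_mark x <= / 2.
Proof.
  intros [[H|H] H1].
  - pose proof (question_mark_ge1 (/ x) (Rinv_ge1 x ltac:(lra))) as G.
    rewrite question_mark_inv in G by lra; lra.
  - rewrite <- H, question_mark_0; lra.
Qed.

(* If the defect F x - F y on pairs x <= y is at most d, both functional equations halve it. *)
Lemma question_mark_le (x y : R) : 0 <= x <= y -> question_mark x <= question_mark y.
Proof.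
  assert (H : forall n x y, 0 <= x <= y -> question_mark x - question_mark y <= 1 * (/ 2) ^ n).
  { induction n as [|n IH]; intros a b Hab.
    - pose proof (question_mark_bounds a ltac:(lra)); pose proof (question_mark_bounds b ltac:(lra)).
      simpl; lra.
    - assert (P : 0 < (/ 2) ^ S n) by (apply pow_lt; lra).
      assert (G : forall u v, 1 <= u <= v -> question_mark u - question_mark v <= 1 * (/ 2) ^ S n).
      { intros u v Huv; rewrite (question_mark_sub1 u), (question_mark_sub1 v).
        specialize (IH (u - 1) (v - 1) ltac:(lra)); simpl; lra. }
      destruct (Rle_lt_dec 1 a) as [L|L]; [apply G; lra|].
      destruct (Rle_lt_dec 1 b) as [M|M].
      + pose proof (question_mark_ge1 b M); pose proof (question_mark_le1 a ltac:(lra)); lra.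
      + destruct Hab as [[Ha|Ha] Hab].
        * assert (1 <= / b) by (apply Rinv_ge1; lra).
          assert (/ b <= / a) by (apply Rinv_le_contravar; lra).
          specialize (G (/ b) (/ a) ltac:(lra)).
          rewrite !question_mark_inv in G by lra; lra.
        * rewrite <- Ha, question_mark_0.
          pose proof (question_mark_bounds b ltac:(lra)); lra. }
  intros Hxy; cut (question_mark x - question_mark y <= 0); [lra|].
  apply (le_halving _ 1); intros n; apply H, Hxy.
Qed.

Lemma question_mark_shift_n (n : nat) (x : R) :
  1 - question_mark (x + INR n) = (1 - question_mark x) * (/ 2) ^ n.
Proof.
  induction n as [|n IH].
  - simpl; rewrite Rplus_0_r; ring.
  - rewrite S_INR; replace (x + (INR n + 1)) with (x + INR n + 1) by ring.
    rewrite question_mark_shift; simpl.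
    replace (1 - (1 / 2 + 1 / 2 * question_mark (x + INR n)))
      with (/ 2 * (1 - question_mark (x + INR n))) by field.
    rewrite IH; ring.
Qed.

(** * Periodicity and boundedness of Psi *)

Lemma Psi_shift (x : R) : Psi (x + 1) = Psi x.
Proof.
  unfold Psi; rewrite question_mark_shift, Rpower_plus, Rpower_1 by lra; field.
Qed.

Lemma Psi_shift_n (n : nat) (x : R) : Psi (x + INR n) = Psi x.
Proof.
  induction n as [|n IH]; [simpl; f_equal; ring|].
  rewrite S_INR; replace (x + (INR n + 1)) with (x + INR n + 1) by ring.
  rewrite Psi_shift; exact IH.
Qed.

Lemma Psi_shift_Z (n : Z) (x : R) : Psi (x + IZR n) = Psi x.
Proof.
  destruct (Z_le_gt_dec 0 n) as [H|H].
  - rewrite <- (Z2Nat.id n H), <- INR_IZR_INZ; apply Psi_shift_n.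
  - rewrite <- (Psi_shift_n (Z.to_nat (- n)) (x + IZR n)), INR_IZR_INZ, Z2Nat.id by lia.
    rewrite opp_IZR; f_equal; ring.
Qed.

(** By periodicity the argument may be taken in [[0, 1)], where [1 - F] lies in [[0, 1]] and the
    power of 2 is at most 2. *)
Lemma Psi_bounds (x : R) : 0 <= Psi x <= 2.
Proof.
  rewrite <- (Psi_shift_Z (- Int_part x) x), opp_IZR.
  destruct (base_fp x) as [h1 h2]; unfold frac_part in *.
  set (y := x + - IZR (Int_part x)); assert (Hy : 0 <= y < 1) by (unfold y; lra).
  unfold Psi; pose proof (question_mark_bounds y ltac:(lra)).
  assert (0 < Rpower 2 y) by apply exp_pos.
  assert (Rpower 2 y <= 2).
  { rewrite <- (Rpower_1 2) at 2 by lra; apply Rle_Rpower; lra. }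
  nra.
Qed.

Lemma question_mark_Psi (x : R) : 1 - question_mark x = Rpower 2 (- x) * Psi x.
Proof.
  unfold Psi; rewrite Rpower_Ropp; field.
  apply Rgt_not_eq, exp_pos.
Qed.

(** The boundedness of the periodic factor is the exponential decay of [1 - F]. *)
Lemma question_mark_tail (x : R) : 0 <= 1 - question_mark x <= 2 * Rpower 2 (- x).
Proof.
  rewrite question_mark_Psi; pose proof (Psi_bounds x).
  assert (0 < Rpower 2 (- x)) by apply exp_pos; nra.
Qed.

(** The shift halves the oscillation for arguments at least 1, and inversion carries it to [(0, 1)].
    Two places need another argument: near 0, where inversion is not Lipschitz, and around 1, where
    a pair may straddle the two cases. There smallness of F near 0 is used, directly or after the
    functional equations. *)
Lemma question_mark_modulus (n : nat) :
  exists d, 0 < d /\ forall x y, 0 <= x <= y -> y <= x + d ->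
    question_mark y - question_mark x <= (/ 2) ^ n.
Proof.
  induction n as [|n [d [Hd IH]]].
  - exists 1; split; [lra|]; intros x y Hxy _.
    pose proof (question_mark_bounds x ltac:(lra)); pose proof (question_mark_bounds y ltac:(lra)).
    simpl; lra.
  (* By the functional equations F(1/m) = 2^-m; the 4 provides a spare factor 1/16 and also
     [h <= / 4]. *)
  - set (h := / INR (n + 4)).
    assert (Hh : 0 < h) by (apply Rinv_0_lt_compat, lt_0_INR; lia).
    assert (Hsmall : forall y, 0 <= y <= h -> question_mark y <= (/ 2) ^ (n + 4)).
    { intros y Hy; eapply Rle_trans; [apply (question_mark_le y h); lra|].
      unfold h; rewrite question_mark_inv by (apply lt_0_INR; lia).
      replace (INR (n + 4)) with (0 + INR (n + 4)) by ring.
      rewrite question_mark_shift_n, question_mark_0; lra. }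
    assert (P : 0 < (/ 2) ^ n) by (apply pow_lt; lra).
    assert (Pn : (/ 2) ^ (n + 4) = (/ 2) ^ n / 16) by (rewrite pow_add; simpl; field).
    rewrite Pn in Hsmall.
    assert (G : forall x y, 1 <= x <= y -> y <= x + d ->
              question_mark y - question_mark x <= (/ 2) ^ n / 2).
    { intros x y Hxy Hd'; rewrite (question_mark_sub1 x), (question_mark_sub1 y).
      specialize (IH (x - 1) (y - 1) ltac:(lra) ltac:(lra)); lra. }
    (* The bound [d] serves pairs beyond 1, [h / 2] pairs near 0 or across 1, and [d * (h / 2) ^ 2]
       pairs above [h / 2], whose inverses differ by [(y - x) / (x y)]. *)
    set (e := Rmin d (Rmin (h / 2) (d * (h / 2) ^ 2))).
    assert (e1 : e <= d) by apply Rmin_l.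
    assert (e2 : e <= h / 2) by (eapply Rle_trans; [apply Rmin_r | apply Rmin_l]).
    assert (e3 : e <= d * (h / 2) ^ 2) by (eapply Rle_trans; [apply Rmin_r | apply Rmin_r]).
    assert (Hh4 : h <= / 4).
    { apply Rinv_le_contravar; [lra|]; rewrite plus_INR; pose proof (pos_INR n); simpl; lra. }
    exists e; split.
    { repeat apply Rmin_pos; try lra; apply Rmult_lt_0_compat; [lra | apply pow_lt; lra]. }
    intros x y Hxy Hyx; simpl.
    destruct (Rle_lt_dec 1 x) as [L|L]; [specialize (G x y ltac:(lra) ltac:(lra)); lra|].
    destruct (Rle_lt_dec 1 y) as [M|M].
    + pose proof (Hsmall (y - 1) ltac:(lra)) as S1.
      assert (Hx : 1 <= / x) by (apply Rinv_ge1; lra).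
      assert (Hx2 : / x - 1 <= h).
      { apply Rmult_le_reg_l with x; [lra|].
        rewrite Rmult_minus_distr_l, Rinv_r by lra; nra. }
      pose proof (Hsmall (/ x - 1) ltac:(lra)) as S2.
      pose proof (question_mark_sub1 y) as Q1; pose proof (question_mark_sub1 (/ x)) as Q2.
      rewrite question_mark_inv in Q2 by lra; lra.
    + destruct (Rlt_le_dec x (h / 2)) as [N|N].
      * pose proof (Hsmall y ltac:(lra)); pose proof (question_mark_bounds x ltac:(lra)); lra.
      * (* Inverting the pair is Lipschitz here, away from 0. *)
        assert (I1 : 1 <= / y) by (apply Rinv_ge1; lra).
        assert (I2 : / y <= / x) by (apply Rinv_le_contravar; lra).
        assert (I3 : / x <= / y + d).
        { apply Rmult_le_reg_l with (x * y); [nra|].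
          replace (x * y * / x) with y by (field; lra).
          replace (x * y * (/ y + d)) with (x + d * (x * y)) by (field; lra).
          assert ((h / 2) ^ 2 <= x * y) by (simpl; nra); nra. }
        specialize (G (/ y) (/ x) ltac:(lra) I3).
        rewrite !question_mark_inv in G by lra; lra.
Qed.

Lemma half_pow_small (eps : R) : 0 < eps -> exists n, (/ 2) ^ n < eps.
Proof.
  intros He; destruct (pow_lt_1_zero (/ 2) ltac:(rewrite Rabs_pos_eq; lra) eps He) as [n Hn].
  exists n; specialize (Hn n (Nat.le_refl n)); rewrite Rabs_pos_eq in Hn; [exact Hn|].
  left; apply pow_lt; lra.
Qed.

Lemma question_mark_unif (eps : R) : 0 < eps ->
  exists d, 0 < d /\ forall x y, 0 <= x -> 0 <= y -> Rabs (x - y) <= d ->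
    Rabs (question_mark x - question_mark y) < eps.
Proof.
  intros He; destruct (half_pow_small eps He) as [n Hn].
  destruct (question_mark_modulus n) as [d [Hd H]].
  exists d; split; [exact Hd|]; intros x y Hx Hy Hxy.
  destruct (Rle_lt_dec x y) as [L|L].
  - rewrite Rabs_minus_sym in Hxy |- *; rewrite Rabs_pos_eq in Hxy by lra.
    rewrite Rabs_pos_eq by (pose proof (question_mark_le x y); lra).
    specialize (H x y ltac:(lra) ltac:(lra)); lra.
  - rewrite Rabs_pos_eq in Hxy by lra.
    rewrite Rabs_pos_eq by (pose proof (question_mark_le y x); lra).
    specialize (H y x ltac:(lra) ltac:(lra)); lra.
Qed.

Lemma continuous_question_mark (x : R) : continuous question_mark x.
Proof.
  (* The modulus concerns nonnegative arguments; the shift by [n] moves the ball of radius 1 around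
     [x] there, so negative [x] are covered too. *)
  destruct (INR_unbounded (1 - x)) as [n Hn].
  apply (continuous_ext (fun z => 1 - 2 ^ n * (1 - question_mark (z + INR n)))).
  { intros z; rewrite question_mark_shift_n, pow_inv.
    change (1 - 2 ^ n * ((1 - question_mark z) * / 2 ^ n) = question_mark z :> R).
    field; apply pow_nonzero; lra. }
  apply (continuous_minus (V := R_NormedModule)); [apply continuous_const|].
  apply (continuous_mult (K := R_AbsRing)); [apply continuous_const|].
  apply (continuous_minus (V := R_NormedModule)); [apply continuous_const|].
  apply (continuous_comp (fun z => z + INR n) question_mark).
  - apply (continuous_plus (V := R_NormedModule)); [apply continuous_id | apply continuous_const].
  - apply (filterlim_locally (F := locally (x + INR n))); intros eps.
    destruct (question_mark_unif eps (cond_pos eps)) as [d [Hd H]].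
    assert (Hd1 : 0 < Rmin d 1) by (apply Rmin_pos; lra).
    exists (mkposreal _ Hd1); intros z Hz.
    assert (Hz' : Rabs (z - (x + INR n)) < Rmin d 1) by exact Hz.
    pose proof (Rmin_l d 1); pose proof (Rmin_r d 1).
    apply H; [| lra | lra].
    apply Rabs_lt_between in Hz'; lra.
Qed.

Lemma continuous_Psi (x : R) : continuous Psi x.
Proof.
  unfold Psi; apply (continuous_mult (K := R_AbsRing)).
  - apply (ex_derive_continuous (V := R_NormedModule)); unfold Rpower; auto_derive; exact I.
  - apply (continuous_minus (V := R_NormedModule)); [apply continuous_question_mark | apply continuous_const].
Qed.

(** * Riemann-Stieltjes integration by parts *)

(* With [g] nondecreasing, the error of one Riemann-Stieltjes block is
   [∫_u^ξ (g - g u) f' + ∫_ξ^v (g - g v) f'], at most [sup |f'| (v - u) (g v - g u)]. *)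
Lemma RS_block (f df g : R -> R) (M u x v : R) :
  (forall t, is_derive f t (df t)) -> (forall t, continuous df t) ->
  (forall t, continuous g t) -> u <= x <= v ->
  (forall s t, u <= s <= t -> t <= v -> g s <= g t) ->
  (forall t, u <= t <= v -> Rabs (df t) <= M) ->
  Rabs (f x * (g v - g u) - (f v * g v - f u * g u) + RInt (fun t => g t * df t) u v)
    <= M * (v - u) * (g v - g u).
Proof.
  intros Hf Hdf Hg Hx Hm HM.
  assert (C1 : forall t, continuous (fun t => g t * df t) t)
    by (intros t; apply (continuous_mult (K := R_AbsRing)); auto).
  assert (C2 : forall c t, continuous (fun t => (g t - c) * df t) t).
  { intros c t; apply (continuous_mult (K := R_AbsRing)); [| apply Hdf].
    apply (continuous_minus (V := R_NormedModule)); [apply Hg | apply continuous_const]. }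
  assert (E : forall c p q, RInt (fun t => (g t - c) * df t) p q
            = RInt (fun t => g t * df t) p q - c * (f q - f p)).
  { intros c p q; apply is_RInt_unique.
    apply (is_RInt_ext (fun t => minus (g t * df t) (scal c (df t)))).
    { intros; unfold minus, plus, opp, scal; simpl; unfold mult; simpl; ring. }
    apply (is_RInt_minus (V := R_NormedModule)).
    - apply (RInt_correct (V := R_CompleteNormedModule)), ex_RInt_cont, C1.
    - apply (is_RInt_scal (V := R_NormedModule)).
      apply (is_RInt_derive (V := R_CompleteNormedModule)); intros; auto. }
  assert (Ch : RInt (fun t => g t * df t) u x + RInt (fun t => g t * df t) x v
               = RInt (fun t => g t * df t) u v)
    by (apply (RInt_Chasles (V := R_CompleteNormedModule)); apply ex_RInt_cont, C1).
  replace (_ + _) with (RInt (fun t => (g t - g u) * df t) u x + RInt (fun t => (g t - g v) * df t) x v)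
    by (rewrite !E, <- Ch; ring).
  assert (G : 0 <= g v - g u) by (assert (g u <= g v) by (apply Hm; lra); lra).
  assert (B1 : Rabs (RInt (fun t => (g t - g u) * df t) u x) <= (x - u) * ((g v - g u) * M)).
  { apply abs_RInt_le_const; [lra | apply ex_RInt_cont, C2 |].
    intros t Ht; rewrite Rabs_mult; apply Rmult_le_compat; try apply Rabs_pos; [| apply HM; lra].
    assert (g u <= g t) by (apply Hm; lra); assert (g t <= g v) by (apply Hm; lra).
    rewrite Rabs_pos_eq; lra. }
  assert (B2 : Rabs (RInt (fun t => (g t - g v) * df t) x v) <= (v - x) * ((g v - g u) * M)).
  { apply abs_RInt_le_const; [lra | apply ex_RInt_cont, C2 |].
    intros t Ht; rewrite Rabs_mult; apply Rmult_le_compat; try apply Rabs_pos; [| apply HM; lra].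
    assert (g u <= g t) by (apply Hm; lra); assert (g t <= g v) by (apply Hm; lra).
    rewrite Rabs_left1; lra. }
  eapply Rle_trans; [apply Rabs_triang|]; lra.
Qed.

Lemma RS_sum_cons (f g : R -> R) (h : R * R) (s : SF_seq) :
  RS_sum f g (SF_cons h s) = f (snd h) * (g (SF_h s) - g (fst h)) + RS_sum f g s.
Proof.
  unfold RS_sum; simpl; f_equal.
  destruct (SF_t s) as [|p l]; reflexivity.
Qed.

Lemma pointed_subdiv_head (h : R * R) (s : SF_seq) :
  pointed_subdiv (SF_cons h s) -> fst h <= snd h <= SF_h s.
Proof.
  intros P; apply (P O); rewrite SF_size_cons; apply Nat.lt_0_succ.
Qed.

(** Each block contributes at most [M d] times the increment of [g] over it, and these increments
    telescope. The order of the two endpoints is proved along with it, since the induction needs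
    it. *)
Lemma RS_sum_error (f df g : R -> R) (M d a b : R) :
  (forall t, is_derive f t (df t)) -> (forall t, continuous df t) ->
  (forall t, continuous g t) ->
  (forall s t, a <= s <= t -> t <= b -> g s <= g t) ->
  (forall t, a <= t <= b -> Rabs (df t) <= M) -> 0 <= M ->
  forall s : SF_seq, pointed_subdiv s ->
    SF_h s <= seq.last (SF_h s) (SF_lx s) /\
    (a <= SF_h s -> seq.last (SF_h s) (SF_lx s) <= b -> seq_step (SF_lx s) <= d ->
     Rabs (RS_sum f g s
       - (f (seq.last (SF_h s) (SF_lx s)) * g (seq.last (SF_h s) (SF_lx s)) - f (SF_h s) * g (SF_h s))
       + RInt (fun t => g t * df t) (SF_h s) (seq.last (SF_h s) (SF_lx s)))
     <= M * d * (g (seq.last (SF_h s) (SF_lx s)) - g (SF_h s))).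
Proof.
  intros Hf Hdf Hg Hm HM HM0 s; pattern s; apply SF_cons_ind; clear s.
  - intros x _; simpl; split; [lra|]; intros _ _ _.
    rewrite (RInt_point (V := R_CompleteNormedModule)); unfold zero, RS_sum; simpl.
    rewrite Rabs_right; lra.
  - intros h s IH P.
    destruct (pointed_subdiv_head h s P) as [P1 P2]; destruct (IH (ptd_cons h s P)) as [IH1 IH2].
    assert (El : seq.last (SF_h (SF_cons h s)) (SF_lx (SF_cons h s)) = seq.last (SF_h s) (SF_lx s))
      by reflexivity.
    rewrite El; change (SF_h (SF_cons h s)) with (fst h).
    set (z := seq.last (SF_h s) (SF_lx s)) in *.
    split; [lra|]; intros Ha Hb Hs.
    change (seq_step (SF_lx (SF_cons h s)))
      with (Rmax (Rabs (SF_h s - fst h)) (seq_step (SF_lx s))) in Hs.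
    assert (S1 := Rle_trans _ _ _ (Rmax_l _ _) Hs); assert (S2 := Rle_trans _ _ _ (Rmax_r _ _) Hs).
    rewrite Rabs_pos_eq in S1 by lra.
    specialize (IH2 ltac:(lra) Hb S2).
    assert (B : Rabs (f (snd h) * (g (SF_h s) - g (fst h)) - (f (SF_h s) * g (SF_h s) - f (fst h) * g (fst h))
       + RInt (fun t => g t * df t) (fst h) (SF_h s)) <= M * (SF_h s - fst h) * (g (SF_h s) - g (fst h))).
    { apply RS_block; try assumption; [lra | |].
      - intros p q H1 H2; apply Hm; lra.
      - intros t Ht; apply HM; lra. }
    assert (B' : M * (SF_h s - fst h) * (g (SF_h s) - g (fst h)) <= M * d * (g (SF_h s) - g (fst h))).
    { apply Rmult_le_compat_r; [| apply Rmult_le_compat_l; lra].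
      assert (g (fst h) <= g (SF_h s)) by (apply Hm; lra); lra. }
    rewrite RS_sum_cons.
    assert (Ch : RInt (fun t => g t * df t) (fst h) (SF_h s) + RInt (fun t => g t * df t) (SF_h s) z
               = RInt (fun t => g t * df t) (fst h) z).
    { apply (RInt_Chasles (V := R_CompleteNormedModule)); apply ex_RInt_cont; intros t;
        apply (continuous_mult (K := R_AbsRing)); auto. }
    rewrite <- Ch.
    match type of B with Rabs ?X <= _ => match type of IH2 with Rabs ?Y <= _ =>
      replace (_ + _ - _ + _) with (X + Y) by ring end end.
    eapply Rle_trans; [apply Rabs_triang|]; lra.
Qed.

Lemma is_RSInt_by_parts (f df g : R -> R) (a b : R) :
  a <= b ->
  (forall t, is_derive f t (df t)) -> (forall t, continuous df t) ->
  (forall t, continuous g t) ->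
  (forall s t, a <= s <= t -> t <= b -> g s <= g t) ->
  is_RSInt f g a b (f b * g b - f a * g a - RInt (fun t => g t * df t) a b).
Proof.
  intros Hab Hf Hdf Hg Hm; unfold is_RSInt.
  destruct (ex_RInt_ub df a b (ex_RInt_cont df a b Hdf)) as [M HM].
  rewrite Rmin_left, Rmax_right in HM by lra.
  assert (HM0 : 0 <= M) by (eapply Rle_trans; [apply (norm_ge_0 (df a)) | apply HM; lra]).
  assert (G : 0 <= g b - g a) by (assert (g a <= g b) by (apply Hm; lra); lra).
  apply (proj2 (Rlim_iff (Riemann_fine a b) _ _)); intros eps He.
  (* The [+ 1] keeps the denominator positive when [M] or the increment of [g] is 0. *)
  assert (Hd : 0 < eps / (M * (g b - g a) + 1)) by (apply Rdiv_lt_0_compat; nra).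
  exists (mkposreal _ Hd); intros s Hs (P1 & P2 & P3); simpl in Hs.
  rewrite Rmin_left in P2 by lra; rewrite Rmax_right in P3 by lra.
  destruct (RS_sum_error f df g M (eps / (M * (g b - g a) + 1)) a b Hf Hdf Hg Hm HM HM0 s P1) as [_ Q].
  rewrite P3, P2 in Q; specialize (Q (Rle_refl a) (Rle_refl b) ltac:(lra)).
  replace (RS_sum f g s - _) with
    (RS_sum f g s - (f b * g b - f a * g a) + RInt (fun t => g t * df t) a b) by ring.
  eapply Rle_lt_trans; [exact Q|].
  apply (Rmult_lt_reg_r (M * (g b - g a) + 1)); [nra|].
  replace (M * (eps / (M * (g b - g a) + 1)) * (g b - g a) * (M * (g b - g a) + 1))
    with (eps * (M * (g b - g a))) by (field; nra).
  nra.
Qed.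

Lemma RSInt_unique (f g : R -> R) (a b l : R) : is_RSInt f g a b l -> RSInt f g a b = l.
Proof.
  exact (iota_filterlim_locally (V := R_CompleteNormedModule) (F := Riemann_fine a b) (RS_sum f g) l).
Qed.

Lemma RS_sum_ge0 (f g : R -> R) (a b : R) :
  (forall s t, a <= s <= t -> t <= b -> g s <= g t) -> (forall t, a <= t <= b -> 0 <= f t) ->
  forall s : SF_seq, pointed_subdiv s ->
    SF_h s <= seq.last (SF_h s) (SF_lx s) /\
    (a <= SF_h s -> seq.last (SF_h s) (SF_lx s) <= b -> 0 <= RS_sum f g s).
Proof.
  intros Hm H s; pattern s; apply SF_cons_ind; clear s.
  - intros x _; simpl; split; [lra|]; intros _ _; unfold RS_sum; simpl; lra.
  - intros h s IH P.
    destruct (pointed_subdiv_head h s P) as [P1 P2]; destruct (IH (ptd_cons h s P)) as [IH1 IH2].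
    change (seq.last (SF_h (SF_cons h s)) (SF_lx (SF_cons h s))) with (seq.last (SF_h s) (SF_lx s)).
    change (SF_h (SF_cons h s)) with (fst h).
    split; [lra|]; intros Ha Hb; rewrite RS_sum_cons.
    specialize (IH2 ltac:(lra) Hb).
    assert (0 <= f (snd h)) by (apply H; lra).
    assert (g (fst h) <= g (SF_h s)) by (apply Hm; lra); nra.
Qed.

(** The expression is the limit of Riemann-Stieltjes sums with nonnegative terms. In this form the
    positivity of [dg] is available for ordinary integrals. *)
Lemma by_parts_ge0 (f df g : R -> R) (a b : R) :
  a <= b ->
  (forall t, is_derive f t (df t)) -> (forall t, continuous df t) ->
  (forall t, continuous g t) ->
  (forall s t, a <= s <= t -> t <= b -> g s <= g t) ->
  (forall t, a <= t <= b -> 0 <= f t) ->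
  0 <= f b * g b - f a * g a - RInt (fun t => g t * df t) a b.
Proof.
  intros Hab Hf Hdf Hg Hm H.
  pose proof (is_RSInt_by_parts f df g a b Hab Hf Hdf Hg Hm) as L; unfold is_RSInt in L.
  match type of L with filterlim _ _ (locally ?l) =>
    assert (X : Rbar_le (Finite 0) (Finite l)); [| exact X] end.
  refine (filterlim_le (F := Riemann_fine a b) (fun _ => 0) (RS_sum f g) (Finite 0) (Finite _) _ _ L).
  - assert (Hd : 0 < 1) by lra.
    exists (mkposreal _ Hd); intros s _ (P1 & P2 & P3).
    rewrite Rmin_left in P2 by lra; rewrite Rmax_right in P3 by lra.
    destruct (RS_sum_ge0 f g a b Hm H s P1) as [_ Q]; apply Q; [rewrite P2 | rewrite P3]; lra.
  - apply filterlim_const.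
Qed.

(** This is the inequality between the integrals of [f] and of its majorant [m] against [dg]: apply
    positivity to [m - f] and to [m + f]. No derivative of [f] enters the bound. *)
Lemma by_parts_abs_le (f df m dm g : R -> R) (a b : R) :
  a <= b ->
  (forall t, is_derive f t (df t)) -> (forall t, continuous df t) ->
  (forall t, is_derive m t (dm t)) -> (forall t, continuous dm t) ->
  (forall t, continuous g t) ->
  (forall s t, a <= s <= t -> t <= b -> g s <= g t) ->
  (forall t, a <= t <= b -> Rabs (f t) <= m t) ->
  Rabs (f b * g b - f a * g a - RInt (fun t => g t * df t) a b)
    <= m b * g b - m a * g a - RInt (fun t => g t * dm t) a b.
Proof.
  intros Hab Hf Hdf Hm Hdm Hg Hmon H.
  assert (C1 : forall h, (forall t, continuous h t) -> forall t, continuous (fun t => g t * h t) t)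
    by (intros h Hh t; apply (continuous_mult (K := R_AbsRing)); auto).
  apply Rabs_le_between.
  assert (X1 := by_parts_ge0 (fun t => m t - f t) (fun t => dm t - df t) g a b Hab).
  assert (X2 := by_parts_ge0 (fun t => m t + f t) (fun t => dm t + df t) g a b Hab).
  rewrite (RInt_ext (V := R_CompleteNormedModule) _ (fun t => g t * dm t - g t * df t)) in X1
    by (intros; simpl; ring).
  rewrite (RInt_ext (V := R_CompleteNormedModule) _ (fun t => g t * dm t + g t * df t)) in X2
    by (intros; simpl; ring).
  rewrite RInt_Rminus in X1 by (apply ex_RInt_cont, C1; assumption).
  rewrite RInt_Rplus in X2 by (apply ex_RInt_cont, C1; assumption).
  assert (Y1 : forall t, a <= t <= b -> 0 <= m t - f t).
  { intros t Ht; specialize (H t Ht); apply Rabs_le_between in H; lra. }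
  assert (Y2 : forall t, a <= t <= b -> 0 <= m t + f t).
  { intros t Ht; specialize (H t Ht); apply Rabs_le_between in H; lra. }
  assert (Z1 : forall t, is_derive (fun t => m t - f t) t (dm t - df t))
    by (intros; apply (is_derive_minus (V := R_NormedModule)); auto).
  assert (Z2 : forall t, is_derive (fun t => m t + f t) t (dm t + df t))
    by (intros; apply (is_derive_plus (V := R_NormedModule)); auto).
  assert (W1 : forall t, continuous (fun t => dm t - df t) t)
    by (intros; apply (continuous_minus (V := R_NormedModule)); auto).
  assert (W2 : forall t, continuous (fun t => dm t + df t) t)
    by (intros; apply (continuous_plus (V := R_NormedModule)); auto).
  specialize (X1 Z1 W1 Hg Hmon Y1); specialize (X2 Z2 W2 Hg Hmon Y2).
  split; lra.
Qed.

(** * The Mellin transform of 1 - F *)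

Lemma is_Cderive_plus (f g : C -> C) (s l m : C) :
  is_Cderive f s l -> is_Cderive g s m -> is_Cderive (fun z => f z + g z)%C s (l + m)%C.
Proof. exact (is_derive_plus (V := C_NormedModule) f g s l m). Qed.

Lemma is_Cderive_minus (f g : C -> C) (s l m : C) :
  is_Cderive f s l -> is_Cderive g s m -> is_Cderive (fun z => f z - g z)%C s (l - m)%C.
Proof. exact (is_derive_minus (V := C_NormedModule) f g s l m). Qed.

Lemma is_Cderive_const (c s : C) : is_Cderive (fun _ => c) s (RtoC 0).
Proof. exact (is_derive_const (K := C_AbsRing) (V := C_NormedModule) c s). Qed.

Lemma is_Cderive_id (s : C) : is_Cderive (fun z => z) s (RtoC 1).
Proof.
  apply is_Cderive_quad with (M := 0) (d := 1); [lra|]; intros w _.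
  replace (s + w - s - w * 1)%C with (RtoC 0) by ring; rewrite Cmod_0; lra.
Qed.

Lemma is_Cderive_comp_opp (f : C -> C) (s l : C) :
  is_Cderive f (- s)%C l -> is_Cderive (fun z => f (- z)%C) s (- l)%C.
Proof.
  rewrite !is_Cderive_iff; intros H eps He; destruct (H eps He) as [d [Hd Hw]].
  exists d; split; [exact Hd|]; intros w W.
  specialize (Hw (- w)%C); rewrite Cmod_opp in Hw; specialize (Hw W).
  replace (- (s + w))%C with (- s + - w)%C by ring.
  replace (f (- s + - w) - f (- s) - w * - l)%C with (f (- s + - w) - f (- s) - - w * l)%C by ring.
  exact Hw.
Qed.

Lemma is_Cderive_comp_add (f : C -> C) (s c l : C) :
  is_Cderive f (s + c)%C l -> is_Cderive (fun z => f (z + c)%C) s l.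
Proof.
  rewrite !is_Cderive_iff; intros H eps He; destruct (H eps He) as [d [Hd Hw]].
  exists d; split; [exact Hd|]; intros w W.
  replace (s + w + c)%C with (s + c + w)%C by ring; apply Hw, W.
Qed.

Lemma is_Cderive_continuous (f : C -> C) (s l : C) : is_Cderive f s l ->
  forall eps, 0 < eps -> exists d, 0 < d /\ forall w, Cmod w < d -> Cmod (f (s + w) - f s)%C < eps.
Proof.
  intros H eps He; destruct (proj1 (is_Cderive_iff f s l) H 1 Rlt_0_1) as [d [Hd Hw]].
  pose proof (Cmod_ge_0 l).
  exists (Rmin d (eps / (Cmod l + 2))); split; [apply Rmin_pos; [lra | apply Rdiv_lt_0_compat; lra]|].
  intros w W.
  assert (W1 := Rlt_le_trans _ _ _ W (Rmin_l _ _)); assert (W2 := Rlt_le_trans _ _ _ W (Rmin_r _ _)).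
  specialize (Hw w W1).
  replace (f (s + w) - f s)%C with ((f (s + w) - f s - w * l) + w * l)%C by ring.
  eapply Rle_lt_trans; [apply Cmod_triangle|]; rewrite Cmod_mult.
  pose proof (Cmod_ge_0 w).
  assert (Cmod w * (Cmod l + 2) < eps).
  { apply (Rmult_lt_compat_r (Cmod l + 2)) in W2; [| lra].
    replace (eps / (Cmod l + 2) * (Cmod l + 2)) with eps in W2 by (field; lra); lra. }
  nra.
Qed.

Lemma is_Cderive_mult (f g : C -> C) (s l m : C) :
  is_Cderive f s l -> is_Cderive g s m ->
  is_Cderive (fun z => f z * g z)%C s (l * g s + f s * m)%C.
Proof.
  intros Hf Hg; apply is_Cderive_iff; intros eps He.
  pose proof (Cmod_ge_0 (g s)) as Gs; pose proof (Cmod_ge_0 (f s)) as Fs; pose proof (Cmod_ge_0 l) as Ls.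
  (* [b] bounds [f s], [l] and, near [s], [g]; each of the three error terms then gets a third of
     [eps]. *)
  set (b := Cmod (g s) + Cmod (f s) + Cmod l + 1); assert (Hb : 1 <= b) by (unfold b; lra).
  assert (Bf : Cmod (f s) <= b) by (unfold b; lra); assert (Bl : Cmod l <= b) by (unfold b; lra).
  assert (He1 : 0 < eps / (3 * b)) by (apply Rdiv_lt_0_compat; lra).
  destruct (proj1 (is_Cderive_iff f s l) Hf _ He1) as [d1 [Hd1 D1]].
  destruct (proj1 (is_Cderive_iff g s m) Hg _ He1) as [d2 [Hd2 D2]].
  destruct (is_Cderive_continuous g s m Hg _ He1) as [d3 [Hd3 D3]].
  destruct (is_Cderive_continuous g s m Hg 1 Rlt_0_1) as [d4 [Hd4 D4]].
  exists (Rmin (Rmin d1 d2) (Rmin d3 d4)); split; [repeat apply Rmin_pos; lra|]; intros w W.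
  assert (W12 := Rlt_le_trans _ _ _ W (Rmin_l _ _)); assert (W34 := Rlt_le_trans _ _ _ W (Rmin_r _ _)).
  specialize (D1 w (Rlt_le_trans _ _ _ W12 (Rmin_l _ _))).
  specialize (D2 w (Rlt_le_trans _ _ _ W12 (Rmin_r _ _))).
  specialize (D3 w (Rlt_le_trans _ _ _ W34 (Rmin_l _ _))).
  specialize (D4 w (Rlt_le_trans _ _ _ W34 (Rmin_r _ _))).
  pose proof (Cmod_ge_0 w) as Hw.
  assert (G : Cmod (g (s + w)%C) <= b).
  { replace (g (s + w)%C) with ((g (s + w) - g s) + g s)%C by ring.
    eapply Rle_trans; [apply Cmod_triangle|]; unfold b; lra. }
  replace (f (s + w) * g (s + w) - f s * g s - w * (l * g s + f s * m))%C
    with ((f (s + w) - f s - w * l) * g (s + w) + w * (l * (g (s + w) - g s))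
          + f s * (g (s + w) - g s - w * m))%C by ring.
  assert (T : forall x y z, x <= y -> 0 <= x -> 0 <= z <= b -> y = eps / (3 * b) * Cmod w -> x * z <= eps / 3 * Cmod w).
  { intros x y z H1 H2 H3 H4; apply Rle_trans with (y * b).
    - apply Rmult_le_compat; lra.
    - right; rewrite H4; field; lra. }
  eapply Rle_trans; [apply Cmod_triangle|].
  eapply Rle_trans; [apply Rplus_le_compat_r, Cmod_triangle|].
  rewrite !Cmod_mult.
  assert (X1 := T _ _ (Cmod (g (s + w)%C)) D1 (Cmod_ge_0 _) (conj (Cmod_ge_0 _) G) eq_refl).
  assert (X2 := T _ _ (Cmod (f s)) D2 (Cmod_ge_0 _) (conj Fs Bf) eq_refl).
  assert (D3' : Cmod (g (s + w) - g s)%C * Cmod w <= eps / (3 * b) * Cmod w) by (apply Rmult_le_compat_r; lra).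
  assert (X3 := T _ _ (Cmod l) D3' ltac:(apply Rmult_le_pos; apply Cmod_ge_0) (conj Ls Bl) eq_refl).
  lra.
Qed.

Lemma is_Cderive_inv (f : C -> C) (s l : C) :
  is_Cderive f s l -> f s <> 0 -> is_Cderive (fun z => / f z)%C s (- l / (f s * f s))%C.
Proof.
  intros H H0; assert (H' := H).
  pose proof (proj1 (Cmod_gt_0 _) H0) as Hp; set (r := Cmod (f s)) in *.
  rewrite is_Cderive_iff in H |- *; intros eps He.
  pose proof (Cmod_ge_0 l) as Hl.
  (* [e1] and [e3] make each of the two parts of the numerator at most [eps * Cmod w * (r / 4)];
     this suffices because the remaining denominator [f (s + w)] has modulus at least [r / 2]. *)
  set (e1 := eps * r ^ 2 / 4).
  assert (He1 : 0 < e1) by (unfold e1; apply Rdiv_lt_0_compat; [apply Rmult_lt_0_compat; [lra | apply pow_lt; lra] | lra]).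
  destruct (H e1 He1) as [d1 [Hd1 D1]].
  destruct (is_Cderive_continuous f s l H' (r / 2) ltac:(lra)) as [d2 [Hd2 D2]].
  set (e3 := eps * r ^ 3 / (4 * (Cmod l + 1))).
  assert (He3 : 0 < e3).
  { unfold e3; apply Rdiv_lt_0_compat; [apply Rmult_lt_0_compat; [lra | apply pow_lt; lra] | lra]. }
  destruct (is_Cderive_continuous f s l H' e3 He3) as [d3 [Hd3 D3]].
  exists (Rmin d1 (Rmin d2 d3)); split; [repeat apply Rmin_pos; lra|]; intros w W.
  assert (W1 := Rlt_le_trans _ _ _ W (Rmin_l _ _)); assert (W' := Rlt_le_trans _ _ _ W (Rmin_r _ _)).
  assert (W2 := Rlt_le_trans _ _ _ W' (Rmin_l _ _)); assert (W3 := Rlt_le_trans _ _ _ W' (Rmin_r _ _)).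
  specialize (D1 w W1); specialize (D2 w W2); specialize (D3 w W3).
  assert (Hq : r / 2 <= Cmod (f (s + w)%C)).
  { pose proof (Cmod_triangle_sub (f s) (f s - f (s + w))%C) as T.
    replace (f s - (f s - f (s + w)))%C with (f (s + w)%C) in T by ring.
    rewrite <- Cmod_opp in D2; replace (- (f (s + w) - f s))%C with (f s - f (s + w))%C in D2 by ring.
    fold r in T; lra. }
  assert (Hn : f (s + w)%C <> 0) by (apply Cmod_gt_0; lra).
  replace (/ f (s + w) - / f s - w * (- l / (f s * f s)))%C
    with ((- (f (s + w) - f s - w * l) / f s + w * l * (f (s + w) - f s) / (f s * f s)) / f (s + w))%C
    by (field; auto).
  assert (I1 : Cmod (/ f s)%C = / r) by (apply Cmod_inv, H0).
  assert (I2 : Cmod (/ (f s * f s))%C = / (r * r)).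
  { rewrite Cmod_inv, Cmod_mult by (apply Cmult_neq_0; exact H0); reflexivity. }
  unfold Cdiv; rewrite (Cmod_mult _ (/ f (s + w))%C), Cmod_inv by exact Hn.
  apply Rmult_le_reg_r with (Cmod (f (s + w)%C)); [lra|].
  rewrite Rmult_assoc, Rinv_l, Rmult_1_r by lra.
  eapply Rle_trans; [apply Cmod_triangle|].
  rewrite !Cmod_mult, I1, I2, Cmod_opp.
  pose proof (Cmod_ge_0 w) as Hw.
  apply Rle_trans with (eps * Cmod w * (r / 2)); [| apply Rmult_le_compat_l; [nra | exact Hq]].
  assert (A1 : Cmod (f (s + w) - f s - w * l)%C * / r <= eps * Cmod w * (r / 4)).
  { apply Rmult_le_reg_r with r; [lra|]; rewrite Rmult_assoc, Rinv_l, Rmult_1_r by lra.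
    eapply Rle_trans; [exact D1|]; unfold e1; right; field. }
  assert (A2 : Cmod w * Cmod l * Cmod (f (s + w) - f s)%C * / (r * r) <= eps * Cmod w * (r / 4)).
  { apply Rmult_le_reg_r with (r * r); [nra|]; rewrite Rmult_assoc, Rinv_l, Rmult_1_r by nra.
    apply Rle_trans with (Cmod w * (Cmod l * e3)).
    - rewrite Rmult_assoc; apply Rmult_le_compat_l; [exact Hw|]; apply Rmult_le_compat_l; lra.
    - replace (eps * Cmod w * (r / 4) * (r * r)) with (Cmod w * ((Cmod l + 1) * e3))
        by (unfold e3; field; lra).
      apply Rmult_le_compat_l; [exact Hw|]; apply Rmult_le_compat_r; lra. }
  lra.
Qed.

(** For [A > 0] write [lam * exp u = A * exp (u - c)] with [c = ln (A / lam)] and use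
    [exp v >= 1 + v]: a double exponential decays at every exponential rate. *)
Lemma exp_exp_decay (lam A : R) : 0 < lam ->
  exists K, 0 <= K /\ forall u, 0 <= u -> exp (- (lam * exp u)) <= K * exp (- (A * u)).
Proof.
  intros Hl; destruct (Rle_lt_dec A 0) as [HA|HA].
  - exists 1; split; [lra|]; intros u Hu; rewrite Rmult_1_l; apply exp_le.
    pose proof (exp_pos u); nra.
  - set (c := ln (A / lam)).
    exists (exp (- (A * (1 - c)))); split; [left; apply exp_pos|]; intros u Hu.
    rewrite <- exp_plus; apply exp_le.
    assert (E : lam * exp u = A * exp (u - c)).
    { replace u with (c + (u - c)) at 1 by ring; rewrite exp_plus; unfold c at 1.
      rewrite exp_ln by (apply Rdiv_lt_0_compat; lra); field; lra. }
    pose proof (exp_ineq1_le (u - c)); nra.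
Qed.

(** * The tail of F in the logarithmic variable, and N *)

Definition qtail (u : R) : R := 1 - question_mark (exp u).

Lemma continuous_qtail (u : R) : continuous qtail u.
Proof.
  apply (continuous_minus (V := R_NormedModule)); [apply continuous_const|].
  apply (continuous_comp exp question_mark); [apply continuous_exp | apply continuous_question_mark].
Qed.

Lemma qtail_ge0 (u : R) : 0 <= qtail u.
Proof. apply question_mark_tail. Qed.

Lemma qtail_le1 (u : R) : qtail u <= 1.
Proof. unfold qtail; pose proof (question_mark_bounds (exp u)); pose proof (exp_pos u); lra. Qed.

Lemma qtail_0 : qtail 0 = / 2.
Proof. unfold qtail; rewrite exp_0, question_mark_1; lra. Qed.

Lemma qtail_le (u v : R) : u <= v -> qtail v <= qtail u.
Proof.
  intros H; unfold qtail.
  assert (question_mark (exp u) <= question_mark (exp v)); [| lra].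
  apply question_mark_le; split; [left; apply exp_pos | apply exp_le, H].
Qed.

Lemma qtail_opp (u : R) : qtail (- u) = 1 - qtail u.
Proof. unfold qtail; rewrite exp_Ropp, question_mark_inv by apply exp_pos; lra. Qed.

Lemma qtail_decay (A : R) : exists K, 0 <= K /\ forall u, 0 <= u -> Rabs (qtail u) <= K * exp (- (A * u)).
Proof.
  assert (Hln : 0 < ln 2) by (rewrite <- ln_1; apply ln_increasing; lra).
  destruct (exp_exp_decay (ln 2) A Hln) as [K [HK H]].
  exists (2 * K); split; [lra|]; intros u Hu.
  rewrite Rabs_pos_eq by apply qtail_ge0.
  eapply Rle_trans; [apply question_mark_tail|].
  unfold Rpower; replace (- exp u * ln 2) with (- (ln 2 * exp u)) by ring.
  specialize (H u Hu); lra.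
Qed.

Definition Mellin_N (s : C) : C := (1 + s * (Laplace qtail s - Laplace qtail (- s)))%C.

Lemma Laplace_qtail_derive (s : C) : exists l, is_Cderive (Laplace qtail) s l.
Proof.
  destruct (qtail_decay (Re s + 1)) as [K [HK H]].
  eexists; apply (Laplace_derive qtail (Re s + 1) K s continuous_qtail H); lra.
Qed.

Lemma Laplace_qtail_decaying (s : C) : decaying (fun u => Cexp (s * RtoC u) * RtoC (qtail u))%C.
Proof.
  destruct (qtail_decay (Re s + 1)) as [K [HK H]].
  eexists _, K; apply (Laplace_decays qtail (Re s + 1) K s continuous_qtail H); lra.
Qed.

Lemma Mellin_N_derive (s : C) : exists l, is_Cderive Mellin_N s l.
Proof.
  destruct (Laplace_qtail_derive s) as [l1 H1], (Laplace_qtail_derive (- s)%C) as [l2 H2].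
  eexists; unfold Mellin_N; apply is_Cderive_plus; [apply is_Cderive_const|].
  apply is_Cderive_mult; [apply is_Cderive_id|]; apply is_Cderive_minus; [exact H1|].
  apply is_Cderive_comp_opp, H2.
Qed.

Lemma Mellin_N_opp (s : C) : Mellin_N (- s)%C = Mellin_N s.
Proof. unfold Mellin_N; replace (- - s)%C with s by ring; ring. Qed.

Lemma Mellin_N_conj (s : C) : Mellin_N (Cconj s) = Cconj (Mellin_N s).
Proof.
  assert (H : forall z, Laplace qtail (Cconj z) = Cconj (Laplace qtail z)).
  { intros z; destruct (qtail_decay (Re z + 1)) as [K [HK H]].
    apply (Laplace_conj qtail (Re z + 1) K); [exact continuous_qtail | exact H | lra]. }
  unfold Mellin_N; rewrite <- Copp_conj, !H, Cplus_conj, Cmult_conj, Cminus_conj.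
  rewrite Cconj_RtoC.
  reflexivity.
Qed.

(** Here [- qtail] is F(exp t) up to a constant, hence nondecreasing, and [f] is compared with the
    majorant [2 exp (a t)]. In the bound, 1 is the majorant's boundary term at 0, where [qtail] is
    1/2; [2 a K] bounds its integral; [2 K] bounds the boundary term of [f] at [B]. Nothing depends
    on [df], which grows with the imaginary part of [s] in the application. *)
Lemma qtail_by_parts_le (f df : R -> R) (a K B : R) :
  0 <= a -> 0 <= B -> 0 <= K ->
  (forall t, is_derive f t (df t)) -> (forall t, continuous df t) ->
  (forall t, 0 <= t -> Rabs (f t) <= 2 * exp (a * t)) ->
  (forall t, 0 <= t -> Rabs (qtail t) <= K * exp (- ((a + 1) * t))) ->
  Rabs (f 0 / 2 + RInt (fun t => qtail t * df t) 0 B) <= 1 + 2 * a * K + 2 * K.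
Proof.
  intros Ha HB HK Hf Hdf Hm Hq.
  assert (Cm : forall t, continuous (fun t => 2 * a * exp (a * t)) t).
  { intros t; apply (ex_derive_continuous (V := R_NormedModule)); auto_derive; exact I. }
  assert (P := by_parts_abs_le f df (fun t => 2 * exp (a * t)) (fun t => 2 * a * exp (a * t))
     (fun t => - qtail t) 0 B HB Hf Hdf).
  specialize (P ltac:(intros t; auto_derive; [exact I | ring]) Cm).
  specialize (P ltac:(intros t; apply (continuous_opp (V := R_NormedModule)), continuous_qtail)).
  specialize (P ltac:(intros s t H1 H2; pose proof (qtail_le s t ltac:(lra)); lra)).
  specialize (P ltac:(intros t Ht; apply Hm; lra)).
  assert (O : forall h : R -> R, (forall t, continuous h t) ->
     RInt (fun t => - qtail t * h t) 0 B = - RInt (fun t => qtail t * h t) 0 B :> R).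
  { intros h Hh; rewrite (RInt_Rext _ (fun t => -1 * (qtail t * h t))) by (intros; simpl; ring).
    rewrite RInt_Rscal; [ring|]; apply ex_RInt_cont; intros t;
      apply (continuous_mult (K := R_AbsRing)); [apply continuous_qtail | apply Hh]. }
  rewrite !O, qtail_0, Rmult_0_r, exp_0 in P by assumption.
  assert (Q1 : RInt (fun t => qtail t * (2 * a * exp (a * t))) 0 B <= 2 * a * K).
  { apply Rle_trans with (RInt (fun t => (2 * a * K) * exp (- (1 * t))) 0 B).
    - apply RInt_le; [exact HB | | |].
      + apply ex_RInt_cont; intros t; apply (continuous_mult (K := R_AbsRing)); [apply continuous_qtail | apply Cm].
      + eexists; apply exp_decay_integral; lra.
      + intros t Ht; specialize (Hq t ltac:(lra)); rewrite Rabs_pos_eq in Hq by apply qtail_ge0.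
        apply Rle_trans with (K * exp (- ((a + 1) * t)) * (2 * a * exp (a * t))).
        * apply Rmult_le_compat_r; [| exact Hq]; pose proof (exp_pos (a * t)); nra.
        * right; replace (- (1 * t)) with (- ((a + 1) * t) + a * t) by ring; rewrite exp_plus; ring.
    - rewrite (is_RInt_unique _ _ _ _ (exp_decay_integral (2 * a * K) 1 0 B Rlt_0_1)).
      rewrite Rmult_0_r, Ropp_0, exp_0.
      pose proof (exp_pos (- (1 * B))); assert (0 <= 2 * a * K) by nra; nra. }
  assert (Q2 : Rabs (f B * qtail B) <= 2 * K).
  { rewrite Rabs_mult; apply Rle_trans with (2 * exp (a * B) * (K * exp (- ((a + 1) * B)))).
    - apply Rmult_le_compat; try apply Rabs_pos; [apply Hm | apply Hq]; exact HB.
    - replace (- ((a + 1) * B)) with (- (a * B) + - B) by ring; rewrite exp_plus, exp_Ropp.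
      pose proof (exp_pos (a * B)).
      replace (2 * exp (a * B) * (K * (/ exp (a * B) * exp (- B)))) with (2 * K * exp (- B)) by (field; lra).
      assert (exp (- B) <= 1) by (rewrite <- exp_0; apply exp_le; lra).
      pose proof (exp_pos (- B)); nra. }
  assert (Q3 : 0 <= 2 * exp (a * B) * qtail B)
    by (pose proof (exp_pos (a * B)); pose proof (qtail_ge0 B); nra).
  replace (f 0 / 2 + RInt (fun t => qtail t * df t) 0 B)
    with ((f B * - qtail B - f 0 * - / 2 - - RInt (fun t => qtail t * df t) 0 B) + f B * qtail B) by field.
  eapply Rle_trans; [apply Rabs_triang|]; lra.
Qed.

(** With [f u = exp (s u) + exp (- s u)] one has [N s = f 0 / 2] plus the integral of [qtail * df],
    and [f] is bounded by [2 exp (a u)] whatever the imaginary part of [s]. The previous lemma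
    applies to each component. *)
Lemma Mellin_N_bounded (a : R) : 0 <= a ->
  exists K, 0 <= K /\ forall s : C, - a <= Re s <= a -> Cmod (Mellin_N s) <= K.
Proof.
  intros Ha; destruct (qtail_decay (a + 1)) as [K [HK Hq]].
  set (M := 1 + 2 * a * K + 2 * K).
  assert (HM : 0 <= M) by (unfold M; nra).
  exists (M + M); split; [lra|]; intros s Hs.
  set (f := fun u => (Cexp (s * RtoC u) + Cexp (- s * RtoC u))%C).
  set (df := fun u => (s * (Cexp (s * RtoC u) - Cexp (- s * RtoC u)))%C).
  assert (Df : forall u, is_derive_RC f u (df u)).
  { intros u; evar_last.
    - apply is_derive_RC_plus; apply is_derive_RC_exp, is_derive_RC_lin.
    - unfold df; ring. }
  assert (Cdf : forall u, Ccontinuous df u).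
  { intros u; apply Ccontinuous_mult; [apply Ccontinuous_const|].
    apply Ccontinuous_minus; apply Ccontinuous_exp, Ccontinuous_lin. }
  assert (Fm : forall u, 0 <= u -> Cmod (f u) <= 2 * exp (a * u)).
  { intros u Hu; eapply Rle_trans; [apply Cmod_triangle|]; rewrite !Cmod_Cexp.
    assert (exp (Re (s * RtoC u)%C) <= exp (a * u)) by (apply exp_le; unfold Re in *; simpl; nra).
    assert (exp (Re (- s * RtoC u)%C) <= exp (a * u)) by (apply exp_le; unfold Re in *; simpl; nra).
    lra. }
  assert (f0 : f 0 = RtoC 2).
  { unfold f; replace (s * RtoC 0)%C with (RtoC 0) by ring; replace (- s * RtoC 0)%C with (RtoC 0) by ring.
    rewrite Cexp_0, <- RtoC_plus; f_equal; ring. }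
  pose proof (Laplace_qtail_decaying s) as D1; pose proof (Laplace_qtail_decaying (- s)%C) as D2.
  assert (E : Mellin_N s = (1 + HI (fun u => RtoC (qtail u) * df u))%C).
  { unfold Mellin_N, Laplace; f_equal.
    rewrite <- (HI_minus _ _ D1 D2), <- (HI_scal s _ (decaying_minus _ _ D1 D2)).
    symmetry; apply HI_ext; [apply decaying_scal, decaying_minus; assumption|].
    intros u _; unfold df; ring. }
  assert (D : decaying (fun u => RtoC (qtail u) * df u)%C).
  { eapply decaying_ext; [| exact (decaying_scal s _ (decaying_minus _ _ D1 D2))].
    intros u; unfold df; simpl; ring. }
  pose proof (decaying_is_HI _ D) as L; pose proof (decaying_continuous _ D) as Cc.
  (* The bound passes to the limit [B -> oo]; [c] is 1 for the real part and 0 for the imaginary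
     part, the components of [f 0 / 2]. *)
  assert (Lim : forall (G : C -> R) (c x : R),
     filterlim (fun B => c + G (CRint (fun u => RtoC (qtail u) * df u)%C 0 B)) (Rbar_locally p_infty) (locally x) ->
     (forall B, 0 <= B -> Rabs (c + G (CRint (fun u => RtoC (qtail u) * df u)%C 0 B)) <= M) -> Rabs x <= M).
  { intros G c x H1 H2; apply le_epsilon; intros eps He.
    apply (proj1 (Rlim_iff (Rbar_locally p_infty) _ _)) with (eps := eps) in H1; [| exact He].
    destruct (filter_ex _ (filter_and _ _ H1 (filter_infty_ge 0))) as [B [h1 h2]].
    specialize (H2 B h2); apply Rabs_le_between in H2; apply Rabs_lt_between in h1.
    apply Rabs_le_between; lra. }
  rewrite E; eapply Rle_trans; [apply Cmod_le_add|]; apply Rplus_le_compat.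
  - apply (Lim Re 1).
    + change (Re (1 + HI (fun u => RtoC (qtail u) * df u)))%C with (1 + Re (HI (fun u => RtoC (qtail u) * df u)%C)).
      apply (filterlim_comp_2 (F := Rbar_locally p_infty) (G := locally 1)
         (H := locally (Re (HI (fun u => RtoC (qtail u) * df u)%C))));
      [apply filterlim_const | apply Clim_Re; [typeclasses eauto | exact L] |].
      apply (filterlim_plus (V := R_NormedModule)).
    + intros B HB; rewrite CRint_Re by (apply ex_CRint, Cc).
      rewrite (RInt_Rext _ (fun u => qtail u * Re (df u)))
        by (intros; unfold Re; simpl; ring).
      replace 1 with (Re (f 0) / 2) by (rewrite f0; simpl; field).
      apply (qtail_by_parts_le (fun u => Re (f u)) (fun u => Re (df u))); try assumption.
      * intros t; apply is_derive_RC_Re, Df.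
      * intros t; apply Ccontinuous_Re, Cdf.
      * intros t Ht; eapply Rle_trans; [apply re_le_Cmod | apply Fm, Ht].
  - apply (Lim Im 0).
    + change (Im (1 + HI (fun u => RtoC (qtail u) * df u)))%C with (0 + Im (HI (fun u => RtoC (qtail u) * df u)%C)).
      apply (filterlim_comp_2 (F := Rbar_locally p_infty) (G := locally 0)
         (H := locally (Im (HI (fun u => RtoC (qtail u) * df u)%C))));
      [apply filterlim_const | apply Clim_Im; [typeclasses eauto | exact L] |].
      apply (filterlim_plus (V := R_NormedModule)).
    + intros B HB; rewrite CRint_Im by (apply ex_CRint, Cc).
      rewrite (RInt_Rext _ (fun u => qtail u * Im (df u)))
        by (intros; unfold Im; simpl; ring).
      replace 0 with (Im (f 0) / 2) at 1 by (rewrite f0; simpl; field).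
      apply (qtail_by_parts_le (fun u => Im (f u)) (fun u => Im (df u))); try assumption.
      * intros t; apply is_derive_RC_Im, Df.
      * intros t; apply Ccontinuous_Im, Cdf.
      * intros t Ht; eapply Rle_trans; [apply Im_le_Cmod | apply Fm, Ht].
Qed.

Definition TI (f : R -> C) : C := (HI f + HI (fun u => f (- u)%R))%C.

Lemma Cexp_lin_lim0 (s : C) : Re s < 0 ->
  filterlim (fun u => Cexp (s * RtoC u)) (Rbar_locally p_infty) (locally (T := C_R_NormedModule) (RtoC 0)).
Proof.
  intros Hs; apply (proj2 (Clim_iff (Rbar_locally p_infty) _ _)); intros eps He.
  destruct (exp_small (- Re s) 1 eps ltac:(lra) ltac:(lra) He) as [B [HB H]].
  exists B; intros u Hu.
  replace (Cexp (s * RtoC u) - 0)%C with (Cexp (s * RtoC u)) by ring.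
  rewrite Cmod_Cexp; specialize (H u ltac:(lra)); rewrite Rmult_1_l in H.
  replace (Re (s * RtoC u)%C) with (- (- Re s * u)) by (unfold Re; simpl; ring); exact H.
Qed.

Lemma RtoC_neq_0 (x : R) : x <> 0 -> RtoC x <> 0.
Proof. intros H E; apply H; injection E; auto. Qed.

Lemma Re_neq_0 (s : C) : Re s <> 0 -> s <> 0.
Proof. intros H E; apply H; rewrite E; reflexivity. Qed.

Lemma HI_Cexp (s : C) : Re s < 0 -> HI (fun u => Cexp (s * RtoC u)) = (- / s)%C.
Proof.
  intros Hs; assert (Hs0 : s <> 0) by (apply Re_neq_0; lra).
  rewrite (HI_derive (fun u => / s * Cexp (s * RtoC u))%C _ (/ s * 0)%C).
  - replace (s * RtoC 0)%C with (RtoC 0) by ring; rewrite Cexp_0; ring.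
  - intros u; evar_last.
    + apply is_derive_RC_mult; [apply is_derive_RC_const | apply is_derive_RC_exp, is_derive_RC_lin].
    + cbv beta; field; exact Hs0.
  - intros u; apply Ccontinuous_exp, Ccontinuous_lin.
  - apply Clim_scal; [typeclasses eauto | apply Cexp_lin_lim0, Hs].
Qed.

Lemma decaying_Cexp (s : C) : Re s < 0 -> decaying (fun u => Cexp (s * RtoC u)).
Proof.
  intros Hs; exists (- Re s), 1; split; [| split; [lra|]].
  - intros u; apply Ccontinuous_exp, Ccontinuous_lin.
  - intros u Hu; rewrite Cmod_Cexp, Rmult_1_l; apply exp_le; unfold Re; simpl; lra.
Qed.

Lemma qtail_left_decaying (s : C) : 0 < Re s ->
  decaying (fun u => Cexp (s * RtoC (- u)) * RtoC (qtail (- u)))%C.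
Proof.
  intros Hs; exists (Re s), 1; split; [| split; [lra|]].
  - intros u; apply Ccontinuous_mult.
    + apply Ccontinuous_exp, Ccontinuous_mult; [apply Ccontinuous_const|].
      apply Ccontinuous_RtoC, (continuous_opp (V := R_NormedModule)), continuous_id.
    + apply Ccontinuous_RtoC, (continuous_comp (fun u => - u) qtail); [| apply continuous_qtail].
      apply (continuous_opp (V := R_NormedModule)), continuous_id.
  - intros u Hu; rewrite Cmod_mult, Cmod_Cexp, Cmod_R, Rabs_pos_eq by apply qtail_ge0.
    replace (Re (s * RtoC (- u))%C) with (- (Re s * u)) by (unfold Re; simpl; ring).
    pose proof (qtail_le1 (- u)); pose proof (exp_pos (- (Re s * u))); nra.
Qed.

(** On the left half-line [qtail (- u) = 1 - qtail u]. The constant 1 integrates to [/ s], which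
    produces the 1 in [Mellin_N]. *)
Lemma Mellin_N_TI (s : C) : 0 < Re s ->
  Mellin_N s = (s * TI (fun u => Cexp (s * RtoC u) * RtoC (qtail u)))%C.
Proof.
  intros Hs; assert (Hs0 : s <> 0) by (apply Re_neq_0; lra).
  assert (Hs' : Re (- s)%C < 0) by (unfold Re in *; simpl; lra).
  assert (E : HI (fun u => Cexp (s * RtoC (- u)) * RtoC (qtail (- u)))%C
            = (/ s - Laplace qtail (- s))%C).
  { assert (D1 := decaying_Cexp (- s)%C Hs'); assert (D2 := Laplace_qtail_decaying (- s)%C).
    rewrite (HI_ext _ _ (decaying_minus _ _ D1 D2)).
    - rewrite HI_minus, HI_Cexp by assumption; unfold Laplace; field; exact Hs0.
    - intros u _; rewrite qtail_opp, RtoC_minus, RtoC_opp.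
      replace (- s * RtoC u)%C with (s * - RtoC u)%C by ring; ring. }
  unfold TI; rewrite E; unfold Mellin_N, Laplace; field; exact Hs0.
Qed.

(** * N at the positive integers and the moments *)

Lemma Re_limit_RInt (f : R -> C) (g : R -> R) :
  decaying f -> (forall u, Re (f u) = g u) ->
  is_lim (fun B => RInt g 0 B) p_infty (Re (HI f)).
Proof.
  intros D E; pose proof (decaying_is_HI f D) as L.
  apply (Clim_Re (Rbar_locally p_infty)) in L.
  eapply filterlim_ext; [| exact L].
  intros B; cbv beta; rewrite CRint_Re by (apply ex_CRint, decaying_continuous, D).
  apply RInt_Rext; exact E.
Qed.

Lemma pow_exp (n : nat) (u : R) : exp u ^ n = exp (INR n * u).
Proof.
  induction n as [|n IH]; [simpl; rewrite Rmult_0_l, exp_0; reflexivity|].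
  rewrite S_INR, Rmult_plus_distr_r, exp_plus, Rmult_1_l, <- IH; simpl; ring.
Qed.

Lemma Re_Cexp_real (x u q : R) : Re (Cexp (RtoC x * RtoC u) * RtoC q)%C = exp (x * u) * q.
Proof. rewrite <- RtoC_mult, Cexp_RtoC, <- RtoC_mult; reflexivity. Qed.

Lemma continuous_pow_mult (n : nat) (g : R -> R) :
  (forall t, continuous g t) -> forall t, continuous (fun t => t ^ n * g t) t.
Proof.
  intros H t; apply (continuous_mult (K := R_AbsRing)); [| apply H].
  apply (ex_derive_continuous (V := R_NormedModule)); auto_derive; exact I.
Qed.

(** Substitute x = exp u; the factor [exp u] from dx raises the exponent from [n] to [S n]. *)
Lemma moment_tail_integral (n : nat) :
  is_lim (fun b => RInt (fun x => x ^ n * (1 - question_mark x)) 1 b) p_infty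
    (Re (Laplace qtail (RtoC (INR (S n))))).
Proof.
  pose proof (Re_limit_RInt _ _ (Laplace_qtail_decaying (RtoC (INR (S n))))
    (fun u => Re_Cexp_real (INR (S n)) u (qtail u))) as L.
  assert (L2 := filterlim_comp _ _ _ ln _ _ _ _ is_lim_ln_p L).
  eapply filterlim_ext_loc; [| exact L2].
  exists 0; intros b Hb; cbv beta.
  assert (E : RInt (fun u => exp u * (exp u ^ n * (1 - question_mark (exp u)))) 0 (ln b)
      = RInt (fun x => x ^ n * (1 - question_mark x)) (exp 0) (exp (ln b))).
  { apply (RInt_comp (V := R_CompleteNormedModule) (fun x => x ^ n * (1 - question_mark x)) exp exp).
    - intros; apply continuous_pow_mult; intros t.
      apply (continuous_minus (V := R_NormedModule)); [apply continuous_const | apply continuous_question_mark].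
    - intros; split; [apply is_derive_exp | apply continuous_exp]. }
  rewrite exp_0, exp_ln in E by exact Hb; rewrite <- E.
  apply RInt_Rext; intros u; unfold qtail.
  rewrite pow_exp, <- Rmult_assoc, <- exp_plus, S_INR; f_equal; f_equal; ring.
Qed.

(** Substitute x = exp(-u): by inversion [question_mark (exp (- u))] is [qtail u]. *)
Lemma moment_head_integral (n : nat) :
  RInt (fun x => x ^ n * question_mark x) 0 1 = Re (Laplace qtail (- RtoC (INR (S n)))%C).
Proof.
  set (h := fun x => x ^ n * question_mark x).
  assert (Ch : forall t, continuous h t) by (apply continuous_pow_mult; intros; apply continuous_question_mark).
  rewrite <- RtoC_opp.
  pose proof (Re_limit_RInt _ _ (Laplace_qtail_decaying (RtoC (- INR (S n))))
    (fun u => Re_Cexp_real (- INR (S n)) u (qtail u))) as L.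
  fold (Laplace qtail (RtoC (- INR (S n)))) in L.
  assert (E : forall A, RInt (fun u => exp (- INR (S n) * u) * qtail u) 0 A = RInt h (exp (- A)) 1).
  { intros A.
    assert (E : RInt (fun u => - exp (- u) * h (exp (- u))) 0 A = RInt h (exp (- 0)) (exp (- A))).
    { apply (RInt_comp (V := R_CompleteNormedModule) h (fun u => exp (- u)) (fun u => - exp (- u))).
      - intros; apply Ch.
      - intros; split; [auto_derive; [exact I | ring]|].
        apply (ex_derive_continuous (V := R_NormedModule)); auto_derive; exact I. }
    rewrite Ropp_0, exp_0 in E.
    rewrite <- (opp_RInt_swap (V := R_CompleteNormedModule) h 1 (exp (- A))) by (apply ex_RInt_cont, Ch).
    change (opp (RInt h 1 (exp (- A)))) with (- RInt h 1 (exp (- A))); rewrite <- E.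
    replace (- RInt (fun u => - exp (- u) * h (exp (- u))) 0 A)
      with (-1 * RInt (fun u => - exp (- u) * h (exp (- u))) 0 A) by ring.
    rewrite <- RInt_Rscal.
    - apply RInt_Rext; intros u; unfold h, qtail.
      rewrite exp_Ropp, question_mark_inv, <- exp_Ropp, pow_exp by apply exp_pos.
      replace (- INR (S n) * u) with (- u + INR n * - u) by (rewrite S_INR; ring).
      rewrite exp_plus; ring.
    - apply ex_RInt_cont; intros t; apply (continuous_mult (K := R_AbsRing)).
      + apply (ex_derive_continuous (V := R_NormedModule)); auto_derive; exact I.
      + apply (continuous_comp (fun u => exp (- u)) h); [| apply Ch].
        apply (ex_derive_continuous (V := R_NormedModule)); auto_derive; exact I. }
  (* What is missing is the integral over [[0, exp (- A)]], at most [exp (- A)] since the integrand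
     lies in [[0, 1]]. *)
  assert (L' : is_lim (fun B => RInt (fun u => exp (- INR (S n) * u) * qtail u) 0 B) p_infty
                 (RInt h 0 1)).
  { apply (proj2 (Rlim_iff (Rbar_locally p_infty) _ _)); intros eps He.
    destruct (exp_small 1 1 eps Rlt_0_1 Rle_0_1 He) as [B [HB H]].
    exists B; intros A HA; rewrite E.
    specialize (H A ltac:(lra)); rewrite !Rmult_1_l in H.
    set (e := exp (- A)) in *.
    assert (He0 : 0 < e) by apply exp_pos.
    assert (He1 : e <= 1) by (unfold e; rewrite <- exp_0; apply exp_le; lra).
    assert (Chs : RInt h 0 e + RInt h e 1 = RInt h 0 1)
      by (apply (RInt_Chasles (V := R_CompleteNormedModule)); apply ex_RInt_cont, Ch).
    replace (RInt h e 1 - RInt h 0 1) with (- RInt h 0 e) by lra.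
    rewrite Rabs_Ropp; eapply Rle_lt_trans; [| exact H].
    replace e with ((e - 0) * 1) at 2 by ring.
    apply abs_RInt_le_const; [lra | apply ex_RInt_cont, Ch |].
    intros t Ht; unfold h; pose proof (question_mark_bounds t ltac:(lra)).
    assert (0 <= t ^ n <= 1) by (split; [apply pow_le; lra | rewrite <- (pow1 n); apply pow_incr; lra]).
    rewrite Rabs_pos_eq by nra; nra. }
  apply is_lim_unique in L; apply is_lim_unique in L'.
  rewrite L in L'; injection L'; auto.
Qed.

Lemma Mellin_N_moment (L : nat) : (1 <= L)%nat -> Mellin_N (RtoC (INR L)) = RtoC (moment L).
Proof.
  intros HL; destruct L as [|n]; [lia|]; clear HL.
  set (c := INR (S n)); assert (Hc : 0 < c) by (apply lt_0_INR; lia).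
  assert (Im0 : Im (Mellin_N (RtoC c)) = 0).
  { pose proof (Mellin_N_conj (RtoC c)) as H.
    rewrite Cconj_RtoC in H.
    apply (f_equal Im) in H; rewrite im_conj in H; lra. }
  set (q := fun x => x ^ n * (1 - question_mark x)).
  assert (Cq : forall t, continuous q t).
  { apply continuous_pow_mult; intros t.
    apply (continuous_minus (V := R_NormedModule)); [apply continuous_const | apply continuous_question_mark]. }
  assert (Cp : forall t, continuous (fun t => INR (S n) * t ^ n) t).
  { intros t; apply (ex_derive_continuous (V := R_NormedModule)); auto_derive; exact I. }
  assert (Re1 : Re (Mellin_N (RtoC c))
     = 1 + c * (Re (Laplace qtail (RtoC c)) - Re (Laplace qtail (- RtoC c)%C))).
  { unfold Mellin_N, Re; simpl; ring. }
  pose proof (moment_head_integral n) as MH; fold c in MH; rewrite <- MH in Re1.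
  assert (Pn : RInt (fun x => x ^ n) 0 1 = / c).
  { rewrite (is_RInt_unique _ _ _ _ (is_RInt_pow 0 1 n)), pow1; fold c; simpl; field; lra. }
  assert (Hd : RInt q 0 1 = / c - RInt (fun x => x ^ n * question_mark x) 0 1).
  { rewrite <- Pn, <- RInt_Rminus.
    - apply RInt_Rext; intros; unfold q; ring.
    - apply ex_RInt_cont; intros t; apply (ex_derive_continuous (V := R_NormedModule)); auto_derive; exact I.
    - apply ex_RInt_cont, continuous_pow_mult; intros; apply continuous_question_mark. }
  (* Writing F as [1 - (1 - F)] after the integration by parts cancels the two terms that grow like
     [b ^ S n]; what remains converges as [b -> oo]. *)
  assert (S1 : forall b, 0 <= b -> RSInt (fun x => x ^ S n) question_mark 0 b
     = - (b ^ S n * (1 - question_mark b)) + c * RInt q 0 b).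
  { intros b Hb.
    assert (P : is_RSInt (fun x => x ^ S n) question_mark 0 b
       (b ^ S n * question_mark b - 0 ^ S n * question_mark 0
          - RInt (fun t => question_mark t * (INR (S n) * t ^ n)) 0 b)).
    { apply is_RSInt_by_parts; [exact Hb | | exact Cp | apply continuous_question_mark |].
      - intros t; apply is_derive_Reals, (derivable_pt_lim_pow t (S n)).
      - intros s t H1 H2; apply question_mark_le; lra. }
    rewrite (RSInt_unique _ _ _ _ _ P).
    rewrite (RInt_Rext _ (fun t => INR (S n) * t ^ n - c * q t)) by (intros t; unfold q, c; ring).
    assert (Cn : forall t, continuous (fun t => t ^ n) t).
    { intros t; apply (ex_derive_continuous (V := R_NormedModule)); auto_derive; exact I. }
    assert (Ccq : forall t, continuous (fun t => c * q t) t).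
    { intros t; apply (continuous_mult (K := R_AbsRing)); [apply continuous_const | apply Cq]. }
    rewrite RInt_Rminus by (apply ex_RInt_cont; assumption).
    rewrite (RInt_Rscal (INR (S n)) (fun t => t ^ n)), (RInt_Rscal c q) by (apply ex_RInt_cont; assumption).
    rewrite (is_RInt_unique _ _ _ _ (is_RInt_pow 0 b n)); fold c.
    replace (0 ^ S n) with 0 by (simpl; ring); field; lra. }
  assert (Lim1 : is_lim (fun b => b ^ S n * (1 - question_mark b)) p_infty 0).
  { destruct (qtail_decay (c + 1)) as [K [HK Hq]].
    apply (proj2 (Rlim_iff (Rbar_locally p_infty) _ _)); intros eps He.
    destruct (exp_small 1 K eps Rlt_0_1 HK He) as [B [HB H]].
    exists (exp B); intros b Hb.
    assert (Hb0 : 0 < b) by (pose proof (exp_pos B); lra).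
    assert (Hl : B < ln b) by (rewrite <- (ln_exp B); apply ln_increasing; [apply exp_pos | exact Hb]).
    specialize (Hq (ln b) ltac:(lra)); specialize (H (ln b) ltac:(lra)).
    rewrite Rabs_pos_eq in Hq by apply qtail_ge0; unfold qtail in Hq; rewrite exp_ln in Hq by exact Hb0.
    rewrite Rminus_0_r, Rabs_pos_eq
      by (apply Rmult_le_pos; [apply pow_le; lra | apply question_mark_tail]).
    eapply Rle_lt_trans; [| exact H].
    assert (E : b ^ S n = exp (c * ln b)) by (unfold c; rewrite <- pow_exp, exp_ln by exact Hb0; reflexivity).
    rewrite E; apply Rle_trans with (exp (c * ln b) * (K * exp (- ((c + 1) * ln b)))).
    - apply Rmult_le_compat_l; [left; apply exp_pos | exact Hq].
    - right; replace (- (1 * ln b)) with (c * ln b + - ((c + 1) * ln b)) by ring; rewrite exp_plus; ring. }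
  assert (Lim2 : is_lim (fun b => RSInt (fun x => x ^ S n) question_mark 0 b) p_infty
     (Re (Mellin_N (RtoC c)))).
  { apply is_lim_ext_loc with (f := fun b => - (b ^ S n * (1 - question_mark b)) + c * (RInt q 0 1 + RInt q 1 b)).
    - exists 0; intros b Hb; rewrite S1 by lra; f_equal; f_equal.
      apply (RInt_Chasles (V := R_CompleteNormedModule)); apply ex_RInt_cont, Cq.
    - replace (Re (Mellin_N (RtoC c))) with (- 0 + c * (RInt q 0 1 + Re (Laplace qtail (RtoC c)))).
      + apply (is_lim_plus' _ _ _ (- 0) (c * (RInt q 0 1 + Re (Laplace qtail (RtoC c))))).
        * apply (is_lim_opp _ _ (Finite 0)), Lim1.
        * apply (is_lim_scal_l _ c p_infty (Finite (RInt q 0 1 + Re (Laplace qtail (RtoC c))))).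
          apply (is_lim_plus' _ _ _ (RInt q 0 1) (Re (Laplace qtail (RtoC c)))).
          -- apply is_lim_const.
          -- apply moment_tail_integral.
      + rewrite Re1, Hd; field; lra. }
  apply Ceq; [| exact Im0].
  unfold moment; rewrite (is_lim_unique _ _ _ Lim2); reflexivity.
Qed.

(** * The Gamma function as a two-sided integral *)

Definition TIable (f : R -> C) : Prop := decaying f /\ decaying (fun u => f (- u)).

Lemma TIable_plus (f g : R -> C) : TIable f -> TIable g -> TIable (fun u => f u + g u)%C.
Proof. intros [F1 F2] [G1 G2]; split; [exact (decaying_plus _ _ F1 G1) | exact (decaying_plus _ _ F2 G2)]. Qed.

Lemma TIable_minus (f g : R -> C) : TIable f -> TIable g -> TIable (fun u => f u - g u)%C.
Proof. intros [F1 F2] [G1 G2]; split; [exact (decaying_minus _ _ F1 G1) | exact (decaying_minus _ _ F2 G2)]. Qed.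

Lemma TIable_scal (a : C) (f : R -> C) : TIable f -> TIable (fun u => a * f u)%C.
Proof. intros [F1 F2]; split; [exact (decaying_scal a _ F1) | exact (decaying_scal a _ F2)]. Qed.

Lemma TIable_conj (f : R -> C) : TIable f -> TIable (fun u => Cconj (f u)).
Proof. intros [F1 F2]; split; [exact (decaying_conj _ F1) | exact (decaying_conj _ F2)]. Qed.

Lemma TIable_ext (f g : R -> C) : (forall u, f u = g u) -> TIable f -> TIable g.
Proof. intros E [F1 F2]; split; eapply decaying_ext; [exact E | exact F1 | intros; apply E | exact F2]. Qed.

Lemma TI_ext (f g : R -> C) : TIable f -> (forall u, f u = g u) -> TI g = TI f.
Proof.
  intros [F1 F2] E; unfold TI; rewrite (HI_ext f g), (HI_ext (fun u => f (- u)) (fun u => g (- u)));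
    auto.
Qed.

Lemma TI_plus (f g : R -> C) : TIable f -> TIable g -> TI (fun u => f u + g u)%C = (TI f + TI g)%C.
Proof.
  intros [F1 F2] [G1 G2]; unfold TI; rewrite (HI_plus f g F1 G1), (HI_plus _ _ F2 G2); ring.
Qed.

Lemma TI_minus (f g : R -> C) : TIable f -> TIable g -> TI (fun u => f u - g u)%C = (TI f - TI g)%C.
Proof.
  intros [F1 F2] [G1 G2]; unfold TI; rewrite (HI_minus f g F1 G1), (HI_minus _ _ F2 G2); ring.
Qed.

Lemma TI_scal (a : C) (f : R -> C) : TIable f -> TI (fun u => a * f u)%C = (a * TI f)%C.
Proof.
  intros [F1 F2]; unfold TI; rewrite (HI_scal a f F1), (HI_scal a _ F2); ring.
Qed.

Lemma TI_conj (f : R -> C) : TIable f -> TI (fun u => Cconj (f u)) = Cconj (TI f).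
Proof.
  intros [F1 F2]; unfold TI; rewrite (HI_conj f F1), (HI_conj _ F2), Cplus_conj; reflexivity.
Qed.

Lemma TI_Re_ge0 (f : R -> C) : TIable f -> (forall u, 0 <= Re (f u)) -> 0 <= Re (TI f).
Proof.
  intros [F1 F2] H; unfold TI.
  pose proof (HI_Re_ge0 f F1 (fun u _ => H u)).
  pose proof (HI_Re_ge0 _ F2 (fun u _ => H (- u))).
  rewrite Re_plus; lra.
Qed.

Lemma is_derive_RC_comp_opp (f : R -> C) (x : R) (l : C) :
  is_derive_RC f (- x) l -> is_derive_RC (fun u => f (- u)) x (- l)%C.
Proof.
  intros H.
  assert (N : is_derive (fun u : R => - u) x (-1)) by (auto_derive; [exact I | ring]).
  evar_last.
  - exact (is_derive_comp (V := C_R_NormedModule) f (fun u => - u) x l (-1) H N).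
  - apply Ceq; unfold Re, Im; simpl; unfold scal; simpl; unfold mult; simpl; ring.
Qed.

Lemma TI_derive (phi f : R -> C) (l m : C) :
  (forall u, is_derive_RC phi u (f u)) -> TIable f ->
  filterlim phi (Rbar_locally p_infty) (locally (T := C_R_NormedModule) l) ->
  filterlim (fun u => phi (- u)) (Rbar_locally p_infty) (locally (T := C_R_NormedModule) m) ->
  TI f = (l - m)%C.
Proof.
  intros H [F1 F2] L M; unfold TI.
  rewrite (HI_derive phi f l H (decaying_continuous f F1) L).
  rewrite (HI_derive (fun u => (-1) * phi (- u)%R)%C _ ((-1) * m)%C).
  - rewrite Ropp_0; ring.
  - intros u; evar_last.
    + apply is_derive_RC_mult; [apply is_derive_RC_const | apply is_derive_RC_comp_opp, H].
    + cbv beta; ring.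
  - exact (decaying_continuous _ F2).
  - apply Clim_scal; [typeclasses eauto | exact M].
Qed.

Lemma decaying_lim0 (f : R -> C) (K c : R) : 0 < c ->
  (forall u, 0 <= u -> Cmod (f u) <= K * exp (- (c * u))) ->
  filterlim f (Rbar_locally p_infty) (locally (T := C_R_NormedModule) (RtoC 0)).
Proof.
  intros Hc H; apply (proj2 (Clim_iff (Rbar_locally p_infty) _ _)); intros eps He.
  assert (HK : 0 <= K).
  { specialize (H 0 (Rle_refl 0)); rewrite Rmult_0_r, Ropp_0, exp_0 in H.
    pose proof (Cmod_ge_0 (f 0)); lra. }
  destruct (exp_small c K eps Hc HK He) as [B [HB H1]].
  exists B; intros u Hu; replace (f u - 0)%C with (f u) by ring.
  eapply Rle_lt_trans; [apply H | apply H1]; lra.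
Qed.

(** The integrand t^(s-1) exp(-t) dt of the Gamma function under t = exp u. *)
Definition gkernel (s : C) (u : R) : C := (Cexp (s * RtoC u) * RtoC (exp (- exp u)))%C.

Definition Gam (s : C) : C := TI (gkernel s).

Lemma continuous_gk_right (u : R) : continuous (fun u => exp (- exp u)) u.
Proof. apply (ex_derive_continuous (V := R_NormedModule)); auto_derive; exact I. Qed.

Lemma continuous_gk_left (u : R) : continuous (fun u => exp (- exp (- u))) u.
Proof. apply (ex_derive_continuous (V := R_NormedModule)); auto_derive; exact I. Qed.

Lemma gk_right_decay (A : R) :
  exists K, 0 <= K /\ forall u, 0 <= u -> Rabs (exp (- exp u)) <= K * exp (- (A * u)).
Proof.
  destruct (exp_exp_decay 1 A Rlt_0_1) as [K [HK H]]; exists K; split; [exact HK|].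
  intros u Hu; rewrite Rabs_pos_eq by (left; apply exp_pos).
  specialize (H u Hu); rewrite Rmult_1_l in H; exact H.
Qed.

(** Mere boundedness, written as decay at rate 0 to fit the hypothesis of the lemmas on
    [Laplace]. *)
Lemma gk_left_decay (u : R) : 0 <= u -> Rabs (exp (- exp (- u))) <= 1 * exp (- (0 * u)).
Proof.
  intros _; rewrite Rmult_0_l, Ropp_0, exp_0, Rabs_pos_eq by (left; apply exp_pos).
  rewrite Rmult_1_r, <- exp_0; apply exp_le; pose proof (exp_pos (- u)); lra.
Qed.

Lemma gkernel_left (s : C) (u : R) :
  gkernel s (- u) = (Cexp (- s * RtoC u) * RtoC (exp (- exp (- u))))%C.
Proof. unfold gkernel; rewrite RtoC_opp; do 2 f_equal; ring. Qed.

Lemma gkernel_right_decays (s : C) (A : R) : Re s < A -> exists K, decays (gkernel s) (A - Re s) K.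
Proof.
  intros H; destruct (gk_right_decay A) as [K [HK D]]; exists K.
  exact (Laplace_decays _ A K s continuous_gk_right D H).
Qed.

Lemma gkernel_left_decays (s : C) : 0 < Re s -> decays (fun u => gkernel s (- u)) (Re s) 1.
Proof.
  intros H.
  assert (H' : Re (- s)%C < 0) by (unfold Re in *; simpl; lra).
  assert (D := Laplace_decays _ 0 1 (- s)%C continuous_gk_left gk_left_decay H').
  replace (0 - Re (- s)%C) with (Re s) in D by (unfold Re; simpl; ring).
  destruct D as (D1 & D2 & D3); split; [| split; [exact D2|]].
  - intros u; eapply continuous_ext; [| apply D1]; intros v; symmetry; apply gkernel_left.
  - intros u Hu; rewrite gkernel_left; apply D3, Hu.
Qed.

Lemma gkernel_TIable (s : C) : 0 < Re s -> TIable (gkernel s).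
Proof.
  intros H; split.
  - destruct (gkernel_right_decays s (Re s + 1) ltac:(lra)) as [K D]; eexists _, K; exact D.
  - exists (Re s), 1; apply gkernel_left_decays, H.
Qed.

Lemma Gam_Laplace (s : C) : 0 < Re s ->
  Gam s = (Laplace (fun u => exp (- exp u)) s + Laplace (fun u => exp (- exp (- u))) (- s))%C.
Proof.
  intros H; destruct (gkernel_TIable s H) as [_ D].
  unfold Gam, TI; rewrite <- (HI_ext _ _ D (fun u _ => gkernel_left s u)); reflexivity.
Qed.

Lemma Gam_derive (s : C) : 0 < Re s -> exists l, is_Cderive Gam s l.
Proof.
  intros H.
  destruct (gk_right_decay (Re s + 1)) as [K [HK D]].
  assert (H' : Re (- s)%C < 0) by (unfold Re in *; simpl; lra).
  eexists.
  eapply (is_derive_ext_loc (K := C_AbsRing) (V := C_NormedModule)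
    (fun s => Laplace (fun u => exp (- exp u)) s + Laplace (fun u => exp (- exp (- u))) (- s))%C).
  - exists (mkposreal _ H); intros z Hz; symmetry; apply Gam_Laplace.
    assert (Hz' : Cmod (z - s)%C < Re s) by exact Hz.
    pose proof (re_le_Cmod (z - s)%C) as R1.
    change (Re (z - s)%C) with (Re z + - Re s) in R1; apply Rabs_le_between in R1; lra.
  - apply is_Cderive_plus.
    + apply (Laplace_derive _ (Re s + 1) K s continuous_gk_right D); lra.
    + apply is_Cderive_comp_opp.
      apply (Laplace_derive _ 0 1 (- s)%C continuous_gk_left gk_left_decay H').
Qed.

Lemma gkernel_derive (s : C) (u : R) :
  is_derive_RC (gkernel s) u (s * gkernel s u - gkernel (s + 1) u)%C.
Proof.
  assert (D : is_derive (fun u => exp (- exp u)) u (- exp u * exp (- exp u)))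
    by (auto_derive; [exact I | ring]).
  evar_last.
  - apply is_derive_RC_mult; [apply is_derive_RC_exp, is_derive_RC_lin | apply is_derive_RC_RtoC, D].
  - unfold gkernel; cbv beta.
    replace ((s + 1) * RtoC u)%C with (s * RtoC u + RtoC u)%C by ring.
    rewrite Cexp_plus, Cexp_RtoC, RtoC_mult, RtoC_opp; ring.
Qed.

Lemma Re_plus1 (s : C) : Re (s + 1)%C = Re s + 1.
Proof. reflexivity. Qed.

Lemma Re_plus_R (s : C) (x : R) : Re (s + RtoC x)%C = Re s + x.
Proof. reflexivity. Qed.

(** The derivative of [gkernel s] is [s * gkernel s - gkernel (s + 1)], and [gkernel s] tends to 0
    at both ends. *)
Lemma Gam_plus1 (s : C) : 0 < Re s -> Gam (s + 1)%C = (s * Gam s)%C.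
Proof.
  intros H.
  assert (T0 := gkernel_TIable s H).
  assert (T1 : TIable (gkernel (s + 1)%C)) by (apply gkernel_TIable; rewrite Re_plus1; lra).
  assert (E := TI_derive (gkernel s) _ 0 0 (gkernel_derive s)
     (TIable_minus _ _ (TIable_scal s _ T0) T1)).
  destruct (gkernel_right_decays s (Re s + 1) ltac:(lra)) as [K (D1 & D2 & D3)].
  destruct (gkernel_left_decays s H) as (E1 & E2 & E3).
  specialize (E (decaying_lim0 _ _ _ D2 D3) (decaying_lim0 _ _ _ E2 E3)).
  rewrite (TI_minus _ _ (TIable_scal s _ T0) T1), (TI_scal s _ T0) in E.
  unfold Gam; apply (f_equal (fun z => (s * TI (gkernel s) - z)%C)) in E.
  replace (s * TI (gkernel s) - (s * TI (gkernel s) - TI (gkernel (s + 1))))%C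
    with (TI (gkernel (s + 1)%C)) in E by ring.
  rewrite E; ring.
Qed.

Lemma Gam_1 : Gam 1 = 1.
Proof.
  assert (D : forall u, is_derive_RC (fun u => RtoC (- exp (- exp u))) u (gkernel 1 u)).
  { intros u; evar_last.
    - apply is_derive_RC_RtoC; auto_derive; [exact I | reflexivity].
    - unfold gkernel; replace (1 * RtoC u)%C with (RtoC u) by ring.
      rewrite Cexp_RtoC, <- RtoC_mult; f_equal; ring. }
  unfold Gam; rewrite (TI_derive _ _ 0 (RtoC (-1)) D); [creal | | |].
  - apply gkernel_TIable; simpl; lra.
  - destruct (gk_right_decay 1) as [K [HK H]].
    apply (decaying_lim0 _ K 1 Rlt_0_1); intros u Hu.
    rewrite Cmod_R, Rabs_Ropp; apply H, Hu.
  - apply (proj2 (Clim_iff (Rbar_locally p_infty) _ _)); intros eps He.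
    destruct (exp_small 1 1 eps Rlt_0_1 Rle_0_1 He) as [B [HB H]].
    exists B; intros u Hu; rewrite <- RtoC_minus, Cmod_R.
    eapply Rle_lt_trans; [| exact (H u ltac:(lra))]; rewrite !Rmult_1_l.
    pose proof (exp_pos (- u)); pose proof (exp_ineq1_le (- exp (- u))).
    assert (exp (- exp (- u)) <= 1) by (rewrite <- exp_0; apply exp_le; lra).
    rewrite Rabs_pos_eq; lra.
Qed.

Lemma Gam_conj (s : C) : 0 < Re s -> Gam (Cconj s) = Cconj (Gam s).
Proof.
  intros H; unfold Gam; rewrite <- TI_conj by (apply gkernel_TIable, H).
  apply TI_ext; [apply TIable_conj, gkernel_TIable, H|].
  intros u; unfold gkernel; rewrite Cmult_conj, <- Cexp_conj, Cmult_conj.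
  rewrite !Cconj_RtoC; reflexivity.
Qed.

Definition rGam (x : R) : R := Re (Gam (RtoC x)).

Lemma rGam_plus1 (x : R) : 0 < x -> rGam (x + 1) = x * rGam x.
Proof.
  intros H; unfold rGam; rewrite RtoC_plus, Gam_plus1 by exact H.
  generalize (Gam (RtoC x)); intros g; unfold Re; simpl; ring.
Qed.

(** For [u > 0] the integrand dominates the one with [x = 1], whose integral over that half-line is
    [exp (- 1)]; on the other half-line it is nonnegative. *)
Lemma rGam_ge (x : R) : 1 <= x -> exp (- 1) <= rGam x.
Proof.
  intros Hx; unfold rGam, Gam, TI.
  destruct (gkernel_TIable (RtoC x) ltac:(simpl; lra)) as [F1 F2].
  destruct (gkernel_TIable 1 ltac:(simpl; lra)) as [G1 G2].
  assert (P2 := HI_Re_ge0 _ F2).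
  assert (P1 := HI_Re_ge0 _ (decaying_minus _ _ F1 G1)).
  rewrite HI_minus in P1 by assumption.
  assert (E : HI (gkernel 1) = RtoC (exp (-1))).
  { rewrite (HI_derive (fun u => RtoC (- exp (- exp u))) _ 0).
    - rewrite exp_0; replace (- (1)) with (-1) by ring; creal.
    - intros u; evar_last.
      + apply is_derive_RC_RtoC; auto_derive; [exact I | reflexivity].
      + unfold gkernel; replace (1 * RtoC u)%C with (RtoC u) by ring.
        rewrite Cexp_RtoC, <- RtoC_mult; f_equal; ring.
    - exact (decaying_continuous _ G1).
    - destruct (gk_right_decay 1) as [K [HK H]].
      apply (decaying_lim0 _ K 1 Rlt_0_1); intros u Hu.
      rewrite Cmod_R, Rabs_Ropp; apply H, Hu. }
  rewrite E in P1.
  assert (Q : forall y u, Re (gkernel (RtoC y) u) = exp (y * u) * exp (- exp u))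
    by (intros; apply Re_Cexp_real).
  assert (Q1 : forall u, 0 < u -> 0 <= Re (gkernel (RtoC x) u - gkernel 1 u)%C).
  { intros u Hu.
    change (Re (gkernel (RtoC x) u - gkernel 1 u)%C) with (Re (gkernel (RtoC x) u) + - Re (gkernel (RtoC 1) u)).
    rewrite !Q; pose proof (exp_pos (- exp u)).
    assert (exp (1 * u) <= exp (x * u)) by (apply exp_le; nra); nra. }
  assert (Q2 : forall u, 0 < u -> 0 <= Re (gkernel (RtoC x) (- u))).
  { intros u _; rewrite Q; pose proof (exp_pos (- exp (- u))); pose proof (exp_pos (x * - u)); nra. }
  specialize (P1 Q1); specialize (P2 Q2).
  change (Re (HI (gkernel (RtoC x)) - RtoC (exp (-1)))%C) with (Re (HI (gkernel (RtoC x))) + - exp (-1)) in P1.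
  rewrite Re_plus; lra.
Qed.

Lemma rGam_pos (x : R) : 0 < x -> 0 < rGam x.
Proof.
  intros H; pose proof (rGam_ge (x + 1) ltac:(lra)) as G; rewrite rGam_plus1 in G by exact H.
  pose proof (exp_pos (-1)).
  apply (Rmult_lt_reg_l x); lra.
Qed.

(** * Elementary inequalities and a lower bound for Gamma off the real axis *)

Lemma nonneg_of_derive (f df : R -> R) (x : R) :
  f 0 = 0 -> (forall t, is_derive f t (df t)) -> (forall t, 0 <= t -> 0 <= df t) -> 0 <= x -> 0 <= f x.
Proof.
  intros H0 Hd Hp Hx.
  destruct (MVT_gen f 0 x df) as [c [Hc E]].
  - intros; apply Hd.
  - intros t _; apply continuity_pt_filterlim, (ex_derive_continuous (V := R_NormedModule)).
    eexists; apply Hd.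
  - rewrite Rmin_left, Rmax_right in Hc by lra.
    specialize (Hp c ltac:(lra)); rewrite H0 in E; nra.
Qed.

Lemma cos_lower (y : R) : 1 - cos y <= y ^ 2 / 2.
Proof.
  assert (P : forall x, 0 <= x -> 0 <= x - sin x).
  { intros x; apply (nonneg_of_derive (fun x => x - sin x) (fun x => 1 - cos x)).
    - rewrite sin_0; ring.
    - intros t; auto_derive; [exact I | ring].
    - intros t _; pose proof (COS_bound t); lra. }
  assert (Q : forall x, 0 <= x -> 0 <= cos x - 1 + x ^ 2 / 2).
  { intros x; apply (nonneg_of_derive (fun x => cos x - 1 + x ^ 2 / 2) (fun x => x - sin x)).
    - rewrite cos_0; field.
    - intros t; auto_derive; [exact I | field].
    - intros t Ht; apply P, Ht. }
  destruct (Rle_lt_dec 0 y) as [H|H].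
  - specialize (Q y H); lra.
  - specialize (Q (- y) ltac:(lra)); rewrite cos_neg in Q.
    replace ((- y) ^ 2) with (y ^ 2) in Q by ring; lra.
Qed.

(** The second-order Taylor bound for cosh, obtained by integrating twice an inequality between
    derivatives; [cos_lower] is proved in the same way. *)
Lemma sq_le_cosh (v : R) : v ^ 2 <= exp v - 2 + exp (- v).
Proof.
  assert (P : forall x, 0 <= x -> 0 <= exp x - exp (- x) - 2 * x).
  { intros x; apply (nonneg_of_derive (fun x => exp x - exp (- x) - 2 * x) (fun x => exp x + exp (- x) - 2)).
    - rewrite Ropp_0; ring.
    - intros t; auto_derive; [exact I | ring].
    - intros t _; pose proof (exp_ineq1_le t); pose proof (exp_ineq1_le (- t)); lra. }
  assert (Q : forall x, 0 <= x -> 0 <= exp x - 2 + exp (- x) - x ^ 2).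
  { intros x; apply (nonneg_of_derive (fun x => exp x - 2 + exp (- x) - x ^ 2)
       (fun x => exp x - exp (- x) - 2 * x)).
    - rewrite Ropp_0, exp_0; ring.
    - intros t; auto_derive; [exact I | ring].
    - intros t Ht; apply P, Ht. }
  destruct (Rle_lt_dec 0 v) as [H|H].
  - specialize (Q v H); lra.
  - specialize (Q (- v) ltac:(lra)); rewrite Ropp_involutive in Q.
    replace ((- v) ^ 2) with (v ^ 2) in Q by ring; lra.
Qed.

Lemma TI_combination (f g h k : R -> C) (a b c d w : C) :
  TIable f -> TIable g -> TIable h -> TIable k ->
  TIable (fun u => a * ((b * g u - c * f u) + d * h u) - (f u - w * k u))%C /\
  TI (fun u => a * ((b * g u - c * f u) + d * h u) - (f u - w * k u))%C
    = (a * (b * TI g - c * TI f + d * TI h) - (TI f - w * TI k))%C.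
Proof.
  intros F G H K.
  assert (T1 := TIable_minus _ _ (TIable_scal b g G) (TIable_scal c f F)).
  assert (T2 := TIable_plus _ _ T1 (TIable_scal d h H)).
  assert (T3 := TIable_minus _ _ F (TIable_scal w k K)).
  split; [exact (TIable_minus _ _ (TIable_scal a _ T2) T3)|].
  rewrite (TI_minus _ _ (TIable_scal a _ T2) T3), (TI_scal a _ T2).
  rewrite (TI_plus _ _ T1 (TIable_scal d h H)), (TI_minus _ _ (TIable_scal b g G) (TIable_scal c f F)).
  rewrite (TI_minus _ _ F (TIable_scal w k K)), !TI_scal by assumption; reflexivity.
Qed.

(* The weight [exp (x u) exp (- exp u)] concentrates near [u = ln x], so the oscillation
   [exp (i t u)] costs only a factor [1 + O(t^2/x)]; the variance bound
   [(u - ln x)^2 <= exp u / x - 2 + x exp (- u)] is integrated by the functional equation. *)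
Lemma Gam_lower (x t : R) : 1 < x ->
  rGam x * (1 - t ^ 2 / (2 * (x - 1))) <= Cmod (Gam (x, t)).
Proof.
  intros Hx.
  (* [w] turns the phase so that the real part of the rotated kernel is the weight times
     [cos (t * (u - ln x))]. *)
  set (w := Cexp (- (Ci * RtoC (t * ln x)))%C).
  assert (Hw : Cmod w = 1).
  { unfold w; rewrite Cmod_Cexp; unfold Re; simpl; rewrite <- exp_0; f_equal; ring. }
  assert (T0 := gkernel_TIable (RtoC x) ltac:(simpl; lra)).
  assert (Tp := gkernel_TIable (RtoC (x + 1)) ltac:(simpl; lra)).
  assert (Tm := gkernel_TIable (RtoC (x - 1)) ltac:(simpl; lra)).
  assert (Tt := gkernel_TIable (x, t) ltac:(simpl; lra)).
  (* The real part of [f] is the weight times [t ^ 2 / 2] times the variance bound, minus the weight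
     times [1 - cos]; it is nonnegative pointwise. *)
  set (f := fun u => (RtoC (t ^ 2 / 2) *
      ((RtoC (/ x) * gkernel (RtoC (x + 1)) u - RtoC 2 * gkernel (RtoC x) u)
         + RtoC x * gkernel (RtoC (x - 1)) u)
      - (gkernel (RtoC x) u - w * gkernel (x, t) u))%C).
  destruct (TI_combination (gkernel (RtoC x)) (gkernel (RtoC (x + 1))) (gkernel (RtoC (x - 1))) (gkernel (x, t))
     (RtoC (t ^ 2 / 2)) (RtoC (/ x)) (RtoC 2) (RtoC x) w T0 Tp Tm Tt) as [Tf E].
  change (TIable f) in Tf.
  assert (P : 0 <= Re (TI f)).
  { apply TI_Re_ge0; [exact Tf|]; intros u.
    assert (Q : forall y, Re (gkernel (RtoC y) u) = exp (y * u) * exp (- exp u))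
      by (intros; apply Re_Cexp_real).
    assert (W : Re (w * gkernel (x, t) u)%C = exp (x * u) * exp (- exp u) * cos (t * (u - ln x))).
    { unfold w, gkernel; rewrite Cmult_assoc, <- Cexp_plus.
      unfold Cexp, Re, Im; simpl.
      replace (- (0 * (t * ln x) - 1 * 0) + (x * u - t * 0)) with (x * u) by ring.
      replace (- (0 * 0 + 1 * (t * ln x)) + (x * 0 + t * u)) with (t * (u - ln x)) by ring.
      ring. }
    unfold f.
    replace (Re _) with
      (t ^ 2 / 2 * (/ x * Re (gkernel (RtoC (x + 1)) u) - 2 * Re (gkernel (RtoC x) u) + x * Re (gkernel (RtoC (x - 1)) u))
       - (Re (gkernel (RtoC x) u) - Re (w * gkernel (x, t) u)%C)) by (unfold Re; simpl; ring).
    rewrite W, !Q.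
    replace ((x + 1) * u) with (x * u + u) by ring; replace ((x - 1) * u) with (x * u + - u) by ring.
    rewrite !exp_plus.
    assert (S := sq_le_cosh (u - ln x)); assert (Cs := cos_lower (t * (u - ln x))).
    replace (exp (u - ln x)) with (exp u / x) in S
      by (unfold Rminus; rewrite exp_plus, exp_Ropp, exp_ln by lra; reflexivity).
    replace (exp (- (u - ln x))) with (x * exp (- u)) in S
      by (replace (- (u - ln x)) with (ln x + - u) by ring; rewrite exp_plus, exp_ln by lra; reflexivity).
    set (g := exp (x * u) * exp (- exp u)).
    assert (Hg : 0 < g) by (apply Rmult_lt_0_compat; apply exp_pos).
    replace (_ - _) with (g * (t ^ 2 / 2 * (exp u / x - 2 + x * exp (- u)) - (1 - cos (t * (u - ln x)))))
      by (unfold g; field; lra).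
    apply Rmult_le_pos; [lra|].
    assert (t ^ 2 / 2 * (u - ln x) ^ 2 <= t ^ 2 / 2 * (exp u / x - 2 + x * exp (- u))).
    { apply Rmult_le_compat_l; [pose proof (pow2_ge_0 t); lra | exact S]. }
    replace ((t * (u - ln x)) ^ 2 / 2) with (t ^ 2 / 2 * (u - ln x) ^ 2) in Cs by field.
    lra. }
  change (TI f = (RtoC (t ^ 2 / 2) * (RtoC (/ x) * Gam (RtoC (x + 1)) - RtoC 2 * Gam (RtoC x)
      + RtoC x * Gam (RtoC (x - 1))) - (Gam (RtoC x) - w * Gam (x, t)))%C) in E.
  rewrite E in P.
  replace (Re _) with (t ^ 2 / 2 * (/ x * rGam (x + 1) - 2 * rGam x + x * rGam (x - 1))
     - (rGam x - Re (w * Gam (x, t))%C)) in P by (unfold rGam, Re; simpl; ring).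
  rewrite rGam_plus1 in P by lra.
  assert (E1 : rGam x = (x - 1) * rGam (x - 1)).
  { rewrite <- rGam_plus1 by lra; f_equal; ring. }
  assert (E2 : rGam (x - 1) = rGam x / (x - 1)) by (rewrite E1; field; lra).
  rewrite E2 in P.
  pose proof (Re_le_Cmod (w * Gam (x, t))%C) as B; rewrite Cmod_mult, Hw, Rmult_1_l in B.
  replace (t ^ 2 / 2 * (/ x * (x * rGam x) - 2 * rGam x + x * (rGam x / (x - 1))))
    with (rGam x * (t ^ 2 / (2 * (x - 1)))) in P by (field; lra).
  lra.
Qed.

(** * Lower bounds for Gamma in vertical strips *)

Lemma Crising_add (s : C) (n m : nat) :
  Crising s (n + m) = (Crising s n * Crising (s + RtoC (INR n)) m)%C.
Proof.
  induction m as [|m IH].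
  - rewrite Nat.add_0_r; simpl; ring.
  - rewrite Nat.add_succ_r; simpl; rewrite IH, plus_INR, RtoC_plus; ring.
Qed.

Lemma Crising_neq_0 (s : C) (n : nat) :
  (forall k : nat, (k < n)%nat -> s <> RtoC (- INR k)) -> Crising s n <> 0.
Proof.
  induction n as [|n IH]; intros H; simpl.
  - apply RtoC_neq_0; lra.
  - apply Cmult_neq_0; [apply IH; intros; apply H; lia|].
    intros E; apply (H n ltac:(lia)); rewrite RtoC_opp.
    replace s with (s + RtoC (INR n) - RtoC (INR n))%C by ring; rewrite E; ring.
Qed.

Lemma Crising_conj (s : C) (n : nat) : Crising (Cconj s) n = Cconj (Crising s n).
Proof.
  induction n as [|n IH]; simpl; [creal|].
  rewrite IH, Cmult_conj, Cplus_conj; do 2 f_equal; creal.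
Qed.

Lemma Gam_shift_n (s : C) (n : nat) : 0 < Re s ->
  Gam (s + RtoC (INR n))%C = (Crising s n * Gam s)%C.
Proof.
  intros H; induction n as [|n IH].
  - simpl; replace (s + 0)%C with s by ring; ring.
  - rewrite S_INR, RtoC_plus, Cplus_assoc, Gam_plus1, IH.
    + simpl; ring.
    + rewrite Re_plus_R; pose proof (pos_INR n); lra.
Qed.

(** Far enough to the right the correction factor of [Gam_lower] is at least 1/2. *)
Lemma Gam_lower_shift (s : C) : 0 < Re s ->
  exists n0, forall n, (n0 <= n)%nat ->
    rGam (Re s + INR n) / 2 <= Cmod (Gam (s + RtoC (INR n))%C).
Proof.
  intros H; destruct (INR_unbounded (Im s ^ 2 + 2)) as [n0 Hn0].
  exists n0; intros n Hn; apply le_INR in Hn.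
  pose proof (pow2_ge_0 (Im s)) as Q.
  pose proof (Gam_lower (Re s + INR n) (Im s) ltac:(lra)) as L.
  replace (s + RtoC (INR n))%C with (Re s + INR n, Im s) by (creal).
  eapply Rle_trans; [| exact L].
  pose proof (rGam_pos (Re s + INR n) ltac:(lra)).
  assert (Im s ^ 2 / (2 * (Re s + INR n - 1)) <= / 2).
  { apply Rmult_le_reg_r with (2 * (Re s + INR n - 1)); [lra|].
    unfold Rdiv; rewrite Rmult_assoc, Rinv_l by lra; lra. }
  unfold Rdiv at 1; apply Rmult_le_compat_l; lra.
Qed.

(** By the functional equation a zero at [s] would give zeros at all [s + n], against the lower
    bound far to the right. *)
Lemma Gam_neq_0 (s : C) : 0 < Re s -> Gam s <> 0.
Proof.
  intros H E; destruct (Gam_lower_shift s H) as [n0 L]; specialize (L n0 (Nat.le_refl n0)).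
  rewrite Gam_shift_n, E, Cmult_0_r, Cmod_0 in L by exact H.
  pose proof (rGam_pos (Re s + INR n0)); pose proof (pos_INR n0); lra.
Qed.

(** A primitive in [x] of [ln (1 + t^2 / x^2)], which is twice the logarithm of [|x + i t| / x]. *)
Definition log_primitive (t x : R) : R := x * ln (1 + t ^ 2 / x ^ 2) + 2 * t * atan (x / t).

Lemma sq_ratio_ge0 (t x : R) : 0 < x -> 0 <= t ^ 2 / x ^ 2.
Proof. intros H; apply Rdiv_le_0_compat; [apply pow2_ge_0 | apply pow_lt, H]. Qed.

Lemma log_primitive_derive (t x : R) : 0 < t -> 0 < x ->
  is_derive (log_primitive t) x (ln (1 + t ^ 2 / x ^ 2)).
Proof.
  intros Ht Hx; pose proof (sq_ratio_ge0 t x Hx) as Q.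
  assert (P : 0 < x ^ 2) by (apply pow_lt, Hx).
  unfold log_primitive; auto_derive.
  - simpl in Q, P; unfold Rdiv in Q; repeat split; lra.
  - replace (t * (t * 1)) with (t ^ 2) by ring; replace (x * (x * 1)) with (x ^ 2) by ring.
    set (L := ln (1 + t ^ 2 * / x ^ 2)); change (ln (1 + t ^ 2 / x ^ 2)) with L.
    field; repeat split; nra.
Qed.

(** After exponentiation this is [(1 + c)^2 <= (1 + a) (1 + b)]: indeed [c^2 <= a b] because
    [(x + h) (x - h) <= x^2], and then [2 c <= a + b] by the inequality of the means. *)
Lemma log_ratio_midconvex (t x h : R) : 0 <= h < x ->
  2 * ln (1 + t ^ 2 / x ^ 2) <= ln (1 + t ^ 2 / (x + h) ^ 2) + ln (1 + t ^ 2 / (x - h) ^ 2).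
Proof.
  intros Hh.
  pose proof (sq_ratio_ge0 t x ltac:(lra)); pose proof (sq_ratio_ge0 t (x + h) ltac:(lra)).
  pose proof (sq_ratio_ge0 t (x - h) ltac:(lra)).
  set (a := t ^ 2 / (x + h) ^ 2) in *; set (b := t ^ 2 / (x - h) ^ 2) in *; set (c := t ^ 2 / x ^ 2) in *.
  assert (P : c ^ 2 <= a * b).
  { assert (E : a * b = (t ^ 2 * / (x ^ 2 - h ^ 2)) ^ 2) by (unfold a, b; field; repeat split; nra).
    rewrite E; apply pow_incr; split; [assumption|]; unfold c, Rdiv.
    apply Rmult_le_compat_l; [apply pow2_ge_0|]; apply Rinv_le_contravar; [nra|].
    pose proof (pow2_ge_0 h); lra. }
  assert (Q : 2 * c <= a + b).
  { apply Rsqr_incr_0_var; [unfold Rsqr; pose proof (pow2_ge_0 (a - b)); nra | lra]. }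
  replace (2 * ln (1 + c)) with (ln (1 + c) + ln (1 + c)) by ring.
  rewrite <- !ln_mult by lra.
  apply ln_le; nra.
Qed.

(* Hermite-Hadamard at the midpoint. *)
Lemma log_midpoint (t x : R) : 0 < t -> / 2 < x ->
  ln (1 + t ^ 2 / x ^ 2) <= log_primitive t (x + / 2) - log_primitive t (x - / 2).
Proof.
  intros Ht Hx.
  set (g := fun y => ln (1 + t ^ 2 / y ^ 2)).
  (* [f] vanishes at 0, its derivative is nonnegative by midpoint convexity, and its value at 1/2 is
     the difference of the two sides. *)
  set (f := fun h => log_primitive t (x + h) - log_primitive t (x - h) - 2 * h * g x).
  assert (D : forall h, 0 <= h <= / 2 -> is_derive f h (g (x + h) + g (x - h) - 2 * g x)).
  { intros h Hh; evar_last.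
    - apply (is_derive_minus (V := R_NormedModule)); [apply (is_derive_minus (V := R_NormedModule))|].
      + apply (is_derive_comp (log_primitive t) (fun h => x + h));
          [apply log_primitive_derive; lra | auto_derive; [exact I | reflexivity]].
      + apply (is_derive_comp (log_primitive t) (fun h => x - h));
          [apply log_primitive_derive; lra | auto_derive; [exact I | reflexivity]].
      + instantiate (1 := 2 * g x); auto_derive; [exact I | ring].
    - unfold minus, plus, opp, scal; simpl; unfold mult, g; simpl; ring. }
  destruct (MVT_gen f 0 (/ 2) (fun h => g (x + h) + g (x - h) - 2 * g x)) as [h [Hh E]].
  - intros h; rewrite Rmin_left, Rmax_right by lra; intros Hh; apply D; lra.
  - intros h; rewrite Rmin_left, Rmax_right by lra; intros Hh.
    apply continuity_pt_filterlim, (ex_derive_continuous (V := R_NormedModule)).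
    eexists; apply D; lra.
  - rewrite Rmin_left, Rmax_right in Hh by lra.
    pose proof (log_ratio_midconvex t x h ltac:(lra)) as M; fold (g x) (g (x + h)) (g (x - h)) in M.
    change (ln (1 + t ^ 2 / x ^ 2)) with (g x).
    unfold f in E; rewrite Rplus_0_r, Rminus_0_r in E; nra.
Qed.

(** The bound is the limit at infinity in [x]. With [y = t / x] and the inversion formula for atan
    it becomes [ln (1 + y^2) <= 2 y atan y]. *)
Lemma log_primitive_le (t x : R) : 0 < t -> 0 < x -> log_primitive t x <= PI * t.
Proof.
  intros Ht Hx; unfold log_primitive.
  assert (K : forall y, 0 <= y -> 0 <= 2 * y * atan y - ln (1 + y ^ 2)).
  { intros y; apply (nonneg_of_derive (fun y => 2 * y * atan y - ln (1 + y ^ 2)) (fun y => 2 * atan y)).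
    - replace (1 + 0 ^ 2) with 1 by ring; rewrite ln_1; ring.
    - intros z; pose proof (pow2_ge_0 z); auto_derive; [simpl in *; lra | field; simpl in *; lra].
    - intros z Hz; assert (0 <= atan z); [| lra].
      destruct Hz as [Hz|Hz]; [rewrite <- atan_0; left; apply atan_increasing, Hz | rewrite <- Hz, atan_0; lra]. }
  specialize (K (t / x) ltac:(left; apply Rdiv_lt_0_compat; lra)).
  assert (A : atan (x / t) = PI / 2 - atan (t / x)).
  { replace (x / t) with (/ (t / x)) by (field; lra); apply atan_inv, Rdiv_lt_0_compat; lra. }
  rewrite A; replace (t ^ 2 / x ^ 2) with ((t / x) ^ 2) by (field; lra).
  apply (Rmult_le_compat_l x) in K; [| lra].
  replace (x * (2 * (t / x) * atan (t / x) - ln (1 + (t / x) ^ 2)))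
    with (2 * t * atan (t / x) - x * ln (1 + (t / x) ^ 2)) in K by (field; lra).
  lra.
Qed.

(** Drop the atan term, and the 1 inside the logarithm. *)
Lemma log_primitive_ge (t x : R) : 0 < t -> 0 < x -> 2 * x * (ln t - ln x) <= log_primitive t x.
Proof.
  intros Ht Hx; unfold log_primitive.
  assert (A : 0 <= atan (x / t)).
  { rewrite <- atan_0; left; apply atan_increasing, Rdiv_lt_0_compat; lra. }
  assert (B : 2 * (ln t - ln x) <= ln (1 + t ^ 2 / x ^ 2)).
  { rewrite <- ln_div by lra; replace (2 * ln (t / x)) with (ln (t / x) + ln (t / x)) by ring.
    assert (0 < t / x) by (apply Rdiv_lt_0_compat; lra).
    rewrite <- ln_mult by assumption; apply ln_le; [nra|].
    replace (t ^ 2 / x ^ 2) with (t / x * (t / x)) by (field; lra); lra. }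
  nra.
Qed.

Lemma Cmod_ratio (x t : R) : 0 < x -> 0 < t ->
  Cmod (x, t) = x * exp (/ 2 * ln (1 + t ^ 2 / x ^ 2)).
Proof.
  intros Hx Ht; pose proof (sq_ratio_ge0 t x Hx).
  replace (exp (/ 2 * ln (1 + t ^ 2 / x ^ 2))) with (sqrt (1 + t ^ 2 / x ^ 2)).
  2: { rewrite <- Rpower_sqrt by lra; reflexivity. }
  unfold Cmod; simpl fst; simpl snd.
  replace (x ^ 2 + t ^ 2) with (x ^ 2 * (1 + t ^ 2 / x ^ 2)) by (field; lra).
  rewrite sqrt_mult by (try apply pow2_ge_0; lra).
  rewrite sqrt_pow2 by lra; reflexivity.
Qed.

(** The logarithm of each ratio [|x + k + i t| / (x + k)] is at most half the increment of
    [log_primitive] over the unit interval centred at [x + k], and these intervals are adjacent. *)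
Lemma Cmod_Crising_le (x t : R) (n : nat) : / 2 < x -> 0 < t ->
  Cmod (Crising (x, t) n) <=
    Cmod (Crising (RtoC x) n) * exp (/ 2 * (log_primitive t (x + INR n - / 2) - log_primitive t (x - / 2))).
Proof.
  intros Hx Ht; induction n as [|n IH].
  - simpl; rewrite Rplus_0_r, Rminus_eq_0, Rmult_0_r, exp_0, Cmod_1; lra.
  - simpl Crising; rewrite !Cmod_mult.
    pose proof (pos_INR n) as Hn.
    replace ((x, t) + RtoC (INR n))%C with ((x + INR n, t) : C) by (creal).
    rewrite <- RtoC_plus, Cmod_R, Rabs_pos_eq, Cmod_ratio by lra.
    set (c := Cmod (Crising (RtoC x) n)) in *.
    assert (Hc : 0 <= c) by apply Cmod_ge_0.
    pose proof (log_midpoint t (x + INR n) Ht ltac:(lra)) as M.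
    set (L := ln (1 + t ^ 2 / (x + INR n) ^ 2)) in *.
    rewrite S_INR; replace (x + (INR n + 1) - / 2) with (x + INR n + / 2) by field.
    set (A1 := log_primitive t (x + INR n + / 2)) in *.
    set (A0 := log_primitive t (x + INR n - / 2)) in *.
    set (A := log_primitive t (x - / 2)) in *.
    apply Rle_trans with (c * exp (/ 2 * (A0 - A)) * ((x + INR n) * exp (/ 2 * (A1 - A0)))).
    + apply Rmult_le_compat; [apply Cmod_ge_0 | | exact IH |].
      * pose proof (exp_pos (/ 2 * L)); nra.
      * apply Rmult_le_compat_l; [lra|]; apply exp_le; lra.
    + right; replace (/ 2 * (A1 - A)) with (/ 2 * (A0 - A) + / 2 * (A1 - A0)) by ring.
      rewrite exp_plus; ring.
Qed.

(** Shift [Gam (x, t)] and [rGam x] to the right by the same [n], until they are comparable. The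
    ratio of the two rising factorials is at most [exp X], and the bounds on [log_primitive] make
    the estimate of [X] independent of [n]. *)
Lemma Gam_strip_lower (b : R) : 1 <= b ->
  exists K, 0 < K /\ forall x t, 1 <= x <= b -> 0 < t ->
    K * (exp (- (PI * t / 2)) * Rpower t (x - / 2)) <= Cmod (Gam (x, t)).
Proof.
  (* The first factor combines [rGam_ge] with the 1/2 of [Gam_lower_shift]; the second pays for
     [(x - / 2) * ln (x - / 2) <= b ^ 2]. *)
  intros Hb; exists (exp (- 1) / 2 * exp (- b ^ 2)).
  assert (P1 := exp_pos (- 1)).
  split; [apply Rmult_lt_0_compat; [lra | apply exp_pos]|]; intros x t Hx Ht.
  assert (HR : 0 < Re (x, t)) by (simpl; lra).
  destruct (Gam_lower_shift (x, t) HR) as [n L]; specialize (L n (Nat.le_refl n)).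
  rewrite Gam_shift_n, Cmod_mult in L by exact HR; simpl Re in L.
  pose proof (pos_INR n) as Hn.
  assert (E : Rabs (rGam (x + INR n)) = Cmod (Crising (RtoC x) n) * Rabs (rGam x)).
  { assert (R0 : forall y, 0 < y -> Cmod (Gam (RtoC y)) = Rabs (rGam y)).
    { intros y Hy; unfold rGam.
      assert (I0 : Im (Gam (RtoC y)) = 0).
      { pose proof (Gam_conj (RtoC y) Hy) as H.
        rewrite Cconj_RtoC in H.
        apply (f_equal Im) in H; rewrite im_conj in H; lra. }
      rewrite <- Cmod_R; f_equal; apply Ceq; [reflexivity | exact I0]. }
    rewrite <- !R0 by lra; rewrite RtoC_plus, Gam_shift_n, Cmod_mult by (simpl; lra); reflexivity. }
  rewrite !Rabs_pos_eq in E by (left; apply rGam_pos; lra).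
  rewrite E in L.
  pose proof (Cmod_Crising_le x t n ltac:(lra) Ht) as Cr.
  set (c := Cmod (Crising (RtoC x) n)) in *.
  assert (Hc : 0 < c).
  { apply Cmod_gt_0, Crising_neq_0; intros k _ Ek; apply (f_equal Re) in Ek; simpl in Ek.
    pose proof (pos_INR k); lra. }
  set (g := Cmod (Gam (x, t))) in *; assert (Hg : 0 <= g) by apply Cmod_ge_0.
  set (X := / 2 * (log_primitive t (x + INR n - / 2) - log_primitive t (x - / 2))) in *.
  assert (S1 : rGam x / 2 <= exp X * g).
  { apply Rmult_le_reg_l with c; [exact Hc|].
    apply Rle_trans with (c * exp X * g); [| right; ring].
    eapply Rle_trans; [| apply Rmult_le_compat_r; [exact Hg | exact Cr]]; lra. }
  assert (HX : X <= PI * t / 2 - (x - / 2) * ln t + b ^ 2).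
  { pose proof (log_primitive_le t (x + INR n - / 2) Ht ltac:(lra)).
    pose proof (log_primitive_ge t (x - / 2) Ht ltac:(lra)).
    assert ((x - / 2) * ln (x - / 2) <= b ^ 2).
    { assert (ln (x - / 2) <= x - / 2).
      { pose proof (exp_ineq1_le (ln (x - / 2))) as Q; rewrite exp_ln in Q by lra; lra. }
      apply Rle_trans with ((x - / 2) * (x - / 2)); [apply Rmult_le_compat_l; lra | nra]. }
    unfold X; lra. }
  pose proof (rGam_ge x ltac:(lra)) as Gx.
  assert (S2 : exp (- 1) / 2 * exp (- X) <= g).
  { apply Rmult_le_reg_l with (exp X); [apply exp_pos|].
    replace (exp X * (exp (- 1) / 2 * exp (- X))) with (exp (- 1) / 2 * (exp X * exp (- X))) by ring.
    rewrite <- exp_plus, Rplus_opp_r, exp_0; lra. }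
  eapply Rle_trans; [| exact S2].
  rewrite Rmult_assoc; apply Rmult_le_compat_l; [lra|].
  unfold Rpower; rewrite <- !exp_plus; apply exp_le; lra.
Qed.

(** * The reciprocal of Gamma *)

Lemma Clog_right_pos (t : R) : 0 < t -> Clog_right (RtoC t) = RtoC (ln t).
Proof.
  intros H; unfold Clog_right; rewrite Cmod_R, Rabs_pos_eq by lra.
  simpl; replace (0 / t) with 0 by (field; lra); rewrite atan_0; reflexivity.
Qed.

Lemma Gamma_integrand (s : C) (t : R) : 0 < t ->
  (RtoC (exp (- t)) * Cpow_right (RtoC t) (s - 1))%C = (RtoC (/ t) * gkernel s (ln t))%C.
Proof.
  intros H; unfold Cpow_right, gkernel; rewrite Clog_right_pos by exact H.
  replace (s * RtoC (ln t))%C with ((s - 1) * RtoC (ln t) + RtoC (ln t))%C by ring.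
  rewrite Cexp_plus, Cexp_RtoC, exp_ln by exact H.
  replace (RtoC (/ t)) with (/ RtoC t)%C by (symmetry; apply RtoC_inv; lra).
  field; apply RtoC_neq_0; lra.
Qed.

Lemma CRint_sub (f : R -> C) (a b : R) : (forall u, Ccontinuous f u) ->
  CRint f a b = (CRint f 0 b + CRint (fun u => f (- u)%R) 0 (- a))%C.
Proof.
  intros Hf.
  assert (E : CRint f a 0 = CRint (fun u => f (- u)%R) 0 (- a)).
  { assert (Hm : forall u, Ccontinuous (fun u => f (- u)) u).
    { intros u; apply (continuous_comp (fun u => - u) f); [| apply Hf].
      apply (continuous_opp (V := R_NormedModule)), continuous_id. }
    apply (is_RInt_unique (V := C_R_CompleteNormedModule)).
    assert (L := RInt_correct (V := C_R_CompleteNormedModule) _ _ _ (ex_CRint _ 0 (- a) Hm)).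
    replace 0 with (- 0) in L at 1 by ring.
    apply (is_RInt_comp_opp (V := C_R_NormedModule)) in L.
    apply (is_RInt_swap (V := C_R_NormedModule)) in L.
    apply (is_RInt_opp (V := C_R_NormedModule)) in L.
    rewrite opp_opp in L.
    eapply is_RInt_ext; [| exact L].
    intros x _; cbv beta; rewrite Ropp_involutive.
    apply Ceq; unfold Re, Im; simpl; unfold opp; simpl; ring. }
  rewrite <- E, Cplus_comm; symmetry.
  apply (RInt_Chasles (V := C_R_CompleteNormedModule)); apply ex_CRint, Hf.
Qed.

(** Substitution t = exp u on each segment [[a, b]], split at t = 1 into the two half-line integrals
    of [TI]. *)
Lemma Gamma_integral_Gam (s : C) : 0 < Re s -> Gamma_integral s = Gam s.
Proof.
  intros H; unfold Gamma_integral.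
  apply (is_RInt_gen_unique (V := C_R_CompleteNormedModule)).
  destruct (gkernel_TIable s H) as [D1 D2].
  pose proof (decaying_continuous _ D1) as Cg.
  assert (Int : forall a b, 0 < a -> a < b -> is_RInt (V := C_R_NormedModule)
     (fun t : R => (RtoC (exp (- t)) * Cpow_right (RtoC t) (s - 1))%C) a b
     (CRint (gkernel s) 0 (ln b) + CRint (fun u => gkernel s (- u)%R) 0 (- ln a))%C).
  { intros a b Ha Hab; rewrite <- CRint_sub by exact Cg.
    apply (is_RInt_ext (V := C_R_NormedModule)
      (fun t => scal (V := C_R_NormedModule) (/ t) (gkernel s (ln t)))).
    { intros t Ht; rewrite Rmin_left in Ht by lra; rewrite Gamma_integrand by lra.
      apply Ceq; unfold Re, Im; simpl; unfold scal; simpl; unfold mult; simpl; ring. }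
    apply (is_RInt_comp (V := C_R_CompleteNormedModule) (gkernel s) ln Rinv).
    - intros; apply Cg.
    - intros x Hx; rewrite Rmin_left in Hx by lra; split; [apply is_derive_ln; lra|].
      apply (ex_derive_continuous (V := R_NormedModule)); auto_derive; lra. }
  intros P [eps HP].
  assert (He : 0 < eps / 2) by (pose proof (cond_pos eps); lra).
  pose proof (proj1 (Clim_iff (Rbar_locally p_infty) _ _) (decaying_is_HI _ D1) _ He) as [B1 L1].
  pose proof (proj1 (Clim_iff (Rbar_locally p_infty) _ _) (decaying_is_HI _ D2) _ He) as [B2 L2].
  (* The thresholds [exp (- B2)] and [exp B1] make each half-line error smaller than [eps / 2]; the
     comparisons with 1 ensure [a < b]. *)
  apply (Filter_prod _ _ _ (fun a => 0 < a < Rmin 1 (exp (- B2))) (fun b => Rmax 1 (exp B1) < b)).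
  - assert (Hd : 0 < Rmin 1 (exp (- B2))) by (apply Rmin_pos; [lra | apply exp_pos]).
    exists (mkposreal _ Hd); intros a Ha Ha0; split; [exact Ha0|].
    assert (Ha' : Rabs (a - 0) < Rmin 1 (exp (- B2))) by exact Ha.
    rewrite Rminus_0_r, Rabs_pos_eq in Ha' by lra; exact Ha'.
  - exists (Rmax 1 (exp B1)); auto.
  - intros a b [Ha0 Ha] Hb.
    assert (a < 1) by (eapply Rlt_le_trans; [exact Ha | apply Rmin_l]).
    assert (a < exp (- B2)) by (eapply Rlt_le_trans; [exact Ha | apply Rmin_r]).
    assert (1 < b) by (eapply Rle_lt_trans; [apply Rmax_l | exact Hb]).
    assert (exp B1 < b) by (eapply Rle_lt_trans; [apply Rmax_r | exact Hb]).
    eexists; split; [apply Int; simpl; lra|].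
    apply HP; apply C_NormedModule_mixin_compat1; simpl.
    assert (l1 : B1 < ln b) by (rewrite <- (ln_exp B1); apply ln_increasing; [apply exp_pos | assumption]).
    assert (l2 : B2 < - ln a).
    { assert (ln a < ln (exp (- B2))) by (apply ln_increasing; assumption); rewrite ln_exp in *; lra. }
    specialize (L1 _ l1); specialize (L2 _ l2).
    unfold Gam, TI.
    match goal with |- Cmod ?z < _ =>
      replace z with ((CRint (gkernel s) 0 (ln b) - HI (gkernel s))
        + (CRint (fun u => gkernel s (- u)%R) 0 (- ln a) - HI (fun u => gkernel s (- u)%R)))%C
        by (unfold minus, plus, opp; simpl; apply Ceq; unfold Re, Im; simpl; unfold plus, opp; simpl; ring) end.
    eapply Rle_lt_trans; [apply Cmod_triangle|]; lra.
Qed.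

Lemma Gamma_shift_pos (s : C) : 0 < Re s + INR (Gamma_shift s).
Proof.
  unfold Gamma_shift; destruct (archimed (- Re s)) as [A _].
  assert (IZR (up (- Re s)) <= INR (Z.to_nat (up (- Re s)))).
  { rewrite INR_IZR_INZ; apply IZR_le; lia. }
  lra.
Qed.

(** The reciprocal of Gamma as a total function: at a pole of Gamma the numerator [Crising] has a
    zero factor, and the denominator never vanishes. *)
Definition RGam (s : C) : C :=
  (Crising s (Gamma_shift s) / Gam (s + RtoC (INR (Gamma_shift s))))%C.

Lemma Crising_right_neq_0 (s : C) (n : nat) : 0 < Re s -> Crising s n <> 0.
Proof.
  intros H; apply Crising_neq_0; intros k _ E; apply (f_equal Re) in E; simpl in E.
  unfold Re in *; pose proof (pos_INR k); lra.
Qed.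

Lemma RGam_indep (s : C) (n m : nat) : (n <= m)%nat -> 0 < Re s + INR n ->
  (Crising s m / Gam (s + RtoC (INR m)) = Crising s n / Gam (s + RtoC (INR n)))%C.
Proof.
  intros Hnm Hn; replace m with (n + (m - n))%nat by lia.
  rewrite <- Re_plus_R in Hn.
  rewrite Crising_add, plus_INR, RtoC_plus, Cplus_assoc, Gam_shift_n by exact Hn.
  pose proof (Crising_right_neq_0 _ (m - n) Hn); pose proof (Gam_neq_0 _ Hn).
  field; auto.
Qed.

(** [Gamma_shift] jumps as Re s varies; here a single [n] serves a whole neighbourhood or strip. *)
Lemma RGam_eq (s : C) (n : nat) : 0 < Re s + INR n ->
  RGam s = (Crising s n / Gam (s + RtoC (INR n)))%C.
Proof.
  intros Hn; unfold RGam; destruct (Nat.le_ge_cases n (Gamma_shift s)) as [L|L].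
  - apply RGam_indep; assumption.
  - symmetry; apply RGam_indep; [assumption | apply Gamma_shift_pos].
Qed.

Lemma RGam_CGamma (s : C) : (forall k : Z, s <> RtoC (IZR k)) -> (RGam s * CGamma s)%C = 1.
Proof.
  intros H; pose proof (Gamma_shift_pos s) as P; rewrite <- Re_plus_R in P.
  unfold RGam, CGamma; rewrite Gamma_integral_Gam by exact P.
  pose proof (Gam_neq_0 _ P).
  assert (Crising s (Gamma_shift s) <> 0).
  { apply Crising_neq_0; intros k _; rewrite INR_IZR_INZ, <- opp_IZR; apply H. }
  field; auto.
Qed.

Lemma RGam_plus1 (s : C) : RGam s = (s * RGam (s + 1))%C.
Proof.
  destruct (INR_unbounded (- Re s)) as [n Hn].
  rewrite (RGam_eq s (1 + n)), (RGam_eq (s + 1)%C n).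
  - rewrite Crising_add, plus_INR, RtoC_plus, Cplus_assoc.
    replace (Crising s 1) with s by (simpl; ring).
    replace (RtoC (INR 1)) with (RtoC 1) by reflexivity.
    unfold Cdiv; ring.
  - rewrite Re_plus1; lra.
  - rewrite plus_INR; simpl; lra.
Qed.

Lemma RGam_right (s : C) : 0 < Re s -> RGam s = (/ Gam s)%C.
Proof.
  intros H; rewrite (RGam_eq s 0) by (simpl; lra); simpl.
  replace (s + 0)%C with s by ring; field; apply Gam_neq_0, H.
Qed.

Lemma Crising_derive (s : C) (n : nat) : exists l, is_Cderive (fun z => Crising z n) s l.
Proof.
  induction n as [|n [l IH]].
  - exists (RtoC 0); exact (is_Cderive_const (RtoC 1) s).
  - eexists; simpl; apply is_Cderive_mult; [exact IH|].
    apply is_Cderive_plus; [apply is_Cderive_id | apply is_Cderive_const].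
Qed.

Lemma RGam_derive (s : C) : exists l, is_Cderive RGam s l.
Proof.
  destruct (INR_unbounded (1 - Re s)) as [n Hn].
  assert (P : 0 < Re (s + RtoC (INR n))%C) by (rewrite Re_plus_R; lra).
  destruct (Gam_derive _ P) as [l Hl]; destruct (Crising_derive s n) as [m Hm].
  eexists.
  eapply (is_derive_ext_loc (K := C_AbsRing) (V := C_NormedModule)
    (fun z => Crising z n * / Gam (z + RtoC (INR n)))%C).
  - exists (mkposreal 1 Rlt_0_1); intros z Hz; symmetry; apply RGam_eq.
    assert (Hz' : Cmod (z - s)%C < 1) by exact Hz.
    pose proof (re_le_Cmod (z - s)%C) as R1.
    change (Re (z - s)%C) with (Re z + - Re s) in R1; apply Rabs_le_between in R1; lra.
  - apply is_Cderive_mult; [exact Hm|].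
    apply is_Cderive_inv; [apply is_Cderive_comp_add; exact Hl | apply Gam_neq_0, P].
Qed.

Lemma RGam_fact (n : nat) : RGam (RtoC (INR n) + 1)%C = RtoC (/ INR (fact n)).
Proof.
  induction n as [|n IH].
  - simpl; replace (0 + 1)%C with (RtoC 1) by ring; rewrite RGam_right by (simpl; lra).
    rewrite Gam_1; apply Ceq; unfold Re, Im; simpl; field.
  - rewrite RGam_plus1 in IH.
    replace (RtoC (INR n) + 1)%C with (RtoC (INR (S n))) in IH by (rewrite S_INR, RtoC_plus; reflexivity).
    assert (Hn : INR (S n) <> 0) by (apply not_0_INR; lia).
    assert (Hf : INR (fact n) <> 0) by apply INR_fact_neq_0.
    assert (Hn' := RtoC_neq_0 _ Hn).
    replace (RGam (RtoC (INR (S n)) + 1)%C) with (/ RtoC (INR (S n)) * (RtoC (INR (S n)) * RGam (RtoC (INR (S n)) + 1)))%C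
      by (field; exact Hn').
    rewrite IH, <- RtoC_inv, <- RtoC_mult by exact Hn; f_equal.
    rewrite fact_simpl, mult_INR; field; auto.
Qed.

(** Differentiating [RGam z = z * RGam (z + 1)] gives the derivative at [s] as [RGam (s + 1)] plus
    [s] times the derivative at [s + 1]. At [s = 0] only the first summand, 1, survives; at later
    poles only the second. *)
Lemma RGam_at_pole (n : nat) : RGam (RtoC (- INR n)) = 0 /\
  is_Cderive RGam (RtoC (- INR n)) (RtoC ((-1) ^ n * INR (fact n))).
Proof.
  assert (Step : forall s r l, RGam (s + 1)%C = r -> is_Cderive RGam (s + 1)%C l ->
     RGam s = (s * r)%C /\ is_Cderive RGam s (r + s * l)%C).
  { intros s r l Hr Hl; split; [rewrite RGam_plus1, Hr; reflexivity|].
    apply (is_derive_ext (K := C_AbsRing) (V := C_NormedModule) (fun z => z * RGam (z + 1))%C).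
    - intros z; symmetry; apply RGam_plus1.
    - evar_last; [apply is_Cderive_mult; [apply is_Cderive_id | apply is_Cderive_comp_add, Hl]|].
      cbv beta; rewrite Hr; ring. }
  induction n as [|n [IH1 IH2]].
  - destruct (RGam_derive (RtoC (- INR 0) + 1)%C) as [l Hl].
    assert (E : RGam (RtoC (- INR 0) + 1)%C = RtoC 1).
    { simpl; rewrite Ropp_0; pose proof (RGam_fact 0) as Q; simpl in Q; rewrite Q; f_equal; field. }
    destruct (Step _ _ _ E Hl) as [S1 S2]; split.
    + rewrite S1; simpl; rewrite Ropp_0; ring.
    + evar_last; [exact S2|]. simpl; rewrite Ropp_0, Rmult_1_l; ring.
  - assert (E : (RtoC (- INR (S n)) + 1)%C = RtoC (- INR n)) by (rewrite <- RtoC_plus, S_INR; f_equal; ring).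
    rewrite <- E in IH1, IH2.
    destruct (Step _ _ _ IH1 IH2) as [S1 S2]; split.
    + rewrite S1; ring.
    + evar_last; [exact S2|].
      rewrite fact_simpl, mult_INR; rewrite <- RtoC_mult, <- RtoC_plus; f_equal; simpl pow; ring.
Qed.

Lemma Gamma_shift_conj (s : C) : Gamma_shift (Cconj s) = Gamma_shift s.
Proof. reflexivity. Qed.

Lemma RGam_conj (s : C) : RGam (Cconj s) = Cconj (RGam s).
Proof.
  pose proof (Gamma_shift_pos s) as P; rewrite <- Re_plus_R in P.
  unfold RGam; rewrite Gamma_shift_conj, Crising_conj, Cdiv_conj by (apply Gam_neq_0, P).
  rewrite <- Gam_conj, Cplus_conj by exact P.
  rewrite Cconj_RtoC.
  reflexivity.
Qed.

Lemma Crising_strip_le (c x t : R) (n : nat) : Rabs x + INR n <= c -> 1 <= t ->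
  Cmod (Crising (x, t) n) <= (c + 1) ^ n * t ^ n.
Proof.
  intros Hc Ht.
  assert (H : forall m, (m <= n)%nat -> Cmod (Crising (x, t) m) <= (c + 1) ^ m * t ^ m).
  { induction m as [|m IH]; intros Hm.
    - simpl; rewrite Cmod_1; lra.
    - simpl Crising; rewrite Cmod_mult.
      replace ((c + 1) ^ S m * t ^ S m) with ((c + 1) ^ m * t ^ m * ((c + 1) * t)) by (simpl; ring).
      apply Rmult_le_compat; try apply Cmod_ge_0; [apply IH; lia|].
      eapply Rle_trans; [apply Cmod_le_add|].
      replace (Re ((x, t) + RtoC (INR m))%C) with (x + INR m) by (unfold Re; simpl; ring).
      replace (Im ((x, t) + RtoC (INR m))%C) with t by (unfold Im; simpl; ring).
      rewrite (Rabs_pos_eq t) by lra.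
      assert (Rabs (x + INR m) <= c).
      { eapply Rle_trans; [apply Rabs_triang|].
        rewrite (Rabs_pos_eq (INR m)) by apply pos_INR.
        assert (INR m <= INR n) by (apply le_INR; lia); lra. }
      pose proof (Rabs_pos (x + INR m)); nra. }
  apply H; lia.
Qed.

(** A fixed shift [n] moves the strip to the right of 1, where [Gam_strip_lower] applies; the factor
    [t ^ n] from [Crising] cancels the shift in its exponent. Negative [t] follow by conjugation. *)
Lemma RGam_strip (a b : R) : a <= b ->
  exists K, 0 < K /\ forall x t, a <= x <= b -> 1 <= Rabs t ->
    Cmod (RGam (x, t)) <= K * (Rpower (Rabs t) (/ 2 - x) * exp (PI * Rabs t / 2)).
Proof.
  intros Hab; destruct (INR_unbounded (1 - a)) as [n Hn].
  destruct (Gam_strip_lower (Rmax 1 (b + INR n)) (Rmax_l _ _)) as [K [HK G]].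
  set (c := Rmax (Rabs a) (Rabs b) + INR n).
  assert (Hc : 0 <= c).
  { unfold c; pose proof (Rmax_l (Rabs a) (Rabs b)); pose proof (Rabs_pos a); pose proof (pos_INR n); lra. }
  assert (Hcn : 0 < (c + 1) ^ n) by (apply pow_lt; lra).
  exists ((c + 1) ^ n / K); split; [apply Rdiv_lt_0_compat; assumption|].
  assert (Pos : forall x t, a <= x <= b -> 1 <= t ->
     Cmod (RGam (x, t)) <= (c + 1) ^ n / K * (Rpower t (/ 2 - x) * exp (PI * t / 2))).
  { intros x t Hx Ht.
    rewrite (RGam_eq (x, t) n) by (simpl; lra).
    replace ((x, t) + RtoC (INR n))%C with ((x + INR n, t) : C) by (creal).
    assert (L : 1 <= x + INR n <= Rmax 1 (b + INR n)).
    { split; [lra|]; eapply Rle_trans; [| apply Rmax_r]; lra. }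
    specialize (G _ t L ltac:(lra)).
    assert (Cx : Rabs x + INR n <= c).
    { unfold c; apply Rplus_le_compat_r.
      apply Rabs_le_between; pose proof (Rmax_l (Rabs a) (Rabs b)); pose proof (Rmax_r (Rabs a) (Rabs b)).
      pose proof (Rle_abs b); pose proof (Rle_abs (- a)); rewrite Rabs_Ropp in *; lra. }
    pose proof (Crising_strip_le c x t n Cx Ht) as Cr.
    set (E := exp (- (PI * t / 2)) * Rpower t (x + INR n - / 2)) in *.
    assert (HE : 0 < E) by (apply Rmult_lt_0_compat; apply exp_pos).
    assert (HG : 0 < K * E) by (apply Rmult_lt_0_compat; assumption).
    rewrite Cmod_div by (apply Cmod_gt_0; lra).
    apply Rle_trans with ((c + 1) ^ n * t ^ n / (K * E)).
    - unfold Rdiv; apply Rmult_le_compat; [apply Cmod_ge_0 | left; apply Rinv_0_lt_compat; lra | exact Cr |].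
      apply Rinv_le_contravar; assumption.
    - right; replace ((c + 1) ^ n * t ^ n / (K * E)) with ((c + 1) ^ n / K * (t ^ n * / E)) by (field; lra).
      f_equal; unfold E; rewrite <- (Rpower_pow n t) by lra.
      unfold Rpower; rewrite <- exp_plus, <- exp_Ropp, <- !exp_plus; f_equal; field. }
  intros x t Hx Ht; destruct (Rle_lt_dec 0 t) as [S|S].
  - rewrite Rabs_pos_eq in * by exact S; apply Pos; assumption.
  - rewrite Rabs_left in * by exact S.
    rewrite <- Cmod_conj, <- RGam_conj; apply Pos; assumption.
Qed.

(** * Rotating the Gamma integral *)

Lemma is_derive_RC_param (F : R -> R -> C) (DF : R -> R -> C) (a b : R) :
  (forall x u, is_derive_RC (fun x => F x u) x (DF x u)) ->
  (forall x, forall u, Ccontinuous (fun u => F x u) u) ->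
  (forall z : R * R, Ccontinuous (fun z : R * R => DF (fst z) (snd z)) z) ->
  forall x, is_derive_RC (fun x => CRint (fun u => F x u) a b) x (CRint (fun u => DF x u) a b).
Proof.
  intros HD HF HDF x.
  assert (CD : forall y u, Ccontinuous (fun u => DF y u) u).
  { intros y u; apply (continuous_comp_2 (fun _ => y) (fun u : R => u) DF u);
      [apply continuous_const | apply continuous_id | apply HDF]. }
  (* Differentiation under the integral sign for one component; [p] is the real or the imaginary
     part. *)
  assert (Gen : forall (p : C -> R) (H1 : forall f x l, is_derive_RC f x l -> is_derive (fun u => p (f u)) x (p l))
     (H2 : forall (T : UniformSpace) (f : T -> C) x, Ccontinuous f x -> continuous (fun u => p (f u)) x),
     is_derive (fun x => RInt (fun u => p (F x u)) a b) x (RInt (fun u => p (DF x u)) a b)).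
  { intros p H1 H2.
    assert (E : forall v y, Derive (fun z => p (F z v)) y = p (DF y v)).
    { intros v y; apply is_derive_unique, (H1 (fun z => F z v)), HD. }
    rewrite <- (RInt_Rext (fun u => Derive (fun z => p (F z u)) x)) by (intros; apply E).
    apply is_derive_RInt_param.
    - apply filter_forall; intros y u _; eexists; apply (H1 (fun z => F z u)), HD.
    - intros u _; apply continuity_2d_pt_ext with (f := fun y v => p (DF y v)).
      + intros; symmetry; apply E.
      + apply continuity_2d_pt_filterlim.
        exact (H2 _ (fun z : R * R => DF (fst z) (snd z)) (x, u) (HDF (x, u))).
    - apply filter_forall; intros y; apply ex_RInt_cont; intros; apply (H2 _ (fun u => F y u)), HF. }
  apply is_derive_RC_pair.
  - rewrite CRint_Re by (apply ex_CRint, CD).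
    eapply is_derive_ext; [| apply (Gen Re is_derive_RC_Re (@Ccontinuous_Re))].
    intros y; symmetry; apply CRint_Re, ex_CRint, HF.
  - rewrite CRint_Im by (apply ex_CRint, CD).
    eapply is_derive_ext; [| apply (Gen Im is_derive_RC_Im (@Ccontinuous_Im))].
    intros y; symmetry; apply CRint_Im, ex_CRint, HF.
Qed.

(** The continuation of [gkernel s] to complex [v]; [gamma_entire_d] is its complex derivative. *)
Definition gamma_entire (s v : C) : C := (Cexp (s * v) * Cexp (- Cexp v))%C.

Definition gamma_entire_d (s v : C) : C := (s * gamma_entire s v - Cexp v * gamma_entire s v)%C.

Lemma gamma_entire_path (s c w : C) (x : R) :
  is_derive_RC (fun y => gamma_entire s (c + w * RtoC y)) x (w * gamma_entire_d s (c + w * RtoC x))%C.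
Proof.
  assert (L : is_derive_RC (fun y => c + w * RtoC y)%C x w).
  { evar_last; [apply is_derive_RC_plus; [apply is_derive_RC_const | apply is_derive_RC_lin]|]; ring. }
  evar_last.
  - apply is_derive_RC_mult; apply is_derive_RC_exp.
    + apply is_derive_RC_mult; [apply is_derive_RC_const | exact L].
    + apply is_derive_RC_opp, is_derive_RC_exp; exact L.
  - cbv beta; unfold gamma_entire_d, gamma_entire; ring.
Qed.

Lemma Ccontinuous_gamma_entire {T : UniformSpace} (s : C) (f : T -> C) (x : T) :
  Ccontinuous f x -> Ccontinuous (fun y => gamma_entire s (f y)) x.
Proof.
  intros H; apply Ccontinuous_mult; apply Ccontinuous_exp.
  - apply Ccontinuous_mult; [apply Ccontinuous_const | exact H].
  - apply Ccontinuous_opp, Ccontinuous_exp, H.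
Qed.

Lemma Ccontinuous_gamma_entire_d {T : UniformSpace} (s : C) (f : T -> C) (x : T) :
  Ccontinuous f x -> Ccontinuous (fun y => gamma_entire_d s (f y)) x.
Proof.
  intros H; pose proof (Ccontinuous_gamma_entire s f x H) as G.
  apply Ccontinuous_minus; apply Ccontinuous_mult; try exact G.
  - apply Ccontinuous_const.
  - apply Ccontinuous_exp, H.
Qed.

Lemma cos_abs_le (x y : R) : Rabs x <= Rabs y -> Rabs y <= PI -> cos y <= cos x.
Proof.
  intros H1 H2.
  assert (E : forall z, cos z = cos (Rabs z)).
  { intros z; unfold Rabs; destruct (Rcase_abs z); [symmetry; apply cos_neg | reflexivity]. }
  rewrite (E x), (E y); pose proof (Rabs_pos x); pose proof (Rabs_pos y).
  apply cos_decr_1; lra.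
Qed.

(** For imaginary parts below [PI / 2] the real part of [exp (u + w x)] stays positive, at least a
    constant times [exp u], uniformly in [x]. *)
Lemma gamma_entire_bound (s w : C) (u x : R) : Rabs (Im w) < PI / 2 -> 0 <= x <= 1 ->
  Cmod (gamma_entire s (RtoC u + w * RtoC x)) <=
    exp (Cmod s * Cmod w) * (exp (Re s * u) * exp (- (exp (- Rabs (Re w)) * cos (Im w) * exp u))).
Proof.
  intros Hw Hx; unfold gamma_entire; rewrite Cmod_mult, !Cmod_Cexp, <- Rmult_assoc, <- (exp_plus (Cmod s * Cmod w)).
  pose proof PI_RGT_0.
  apply Rmult_le_compat; try (left; apply exp_pos).
  - apply exp_le.
    replace (s * (RtoC u + w * RtoC x))%C with (s * RtoC u + s * w * RtoC x)%C by ring.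
    rewrite Re_plus.
    assert (Re (s * w * RtoC x)%C <= Cmod s * Cmod w).
    { eapply Rle_trans; [apply Re_le_Cmod|].
      rewrite !Cmod_mult, Cmod_R, Rabs_pos_eq by lra.
      pose proof (Cmod_ge_0 s); pose proof (Cmod_ge_0 w); assert (0 <= Cmod s * Cmod w) by nra; nra. }
    replace (Re (s * RtoC u)%C) with (Re s * u) by (unfold Re; simpl; ring); lra.
  - apply exp_le.
    replace (Re (- Cexp (RtoC u + w * RtoC x))%C) with (- (exp (u + Re w * x) * cos (Im w * x)))
      by (unfold Cexp, Re, Im; simpl; f_equal; f_equal; f_equal; ring).
    apply Ropp_le_contravar; rewrite exp_plus.
    assert (A1 : cos (Im w) <= cos (Im w * x)).
    { apply cos_abs_le; [rewrite Rabs_mult, (Rabs_pos_eq x) by lra; pose proof (Rabs_pos (Im w)); nra | lra]. }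
    assert (A2 : 0 <= cos (Im w)) by (apply Rabs_lt_between in Hw; apply cos_ge_0; lra).
    assert (A3 : exp (- Rabs (Re w)) <= exp (Re w * x)).
    { apply exp_le.
      assert (Rabs (Re w * x) <= Rabs (Re w))
        by (rewrite Rabs_mult, (Rabs_pos_eq x) by lra; pose proof (Rabs_pos (Re w)); nra).
      pose proof (Rle_abs (- (Re w * x))); rewrite Rabs_Ropp in *; lra. }
    pose proof (exp_pos u); pose proof (exp_pos (- Rabs (Re w))).
    apply Rle_trans with (exp (Re w * x) * cos (Im w * x) * exp u); [| right; ring].
    apply Rmult_le_compat_r; [lra|]; apply Rmult_le_compat; lra.
Qed.

Lemma gamma_entire_decay (s w : C) : 0 < Re s -> Rabs (Im w) < PI / 2 ->
  exists K c, 0 < c /\ 0 <= K /\ forall u x, 0 <= u -> 0 <= x <= 1 ->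
    Cmod (gamma_entire s (RtoC u + w * RtoC x)) <= K * exp (- (c * u)) /\
    Cmod (gamma_entire s (RtoC (- u) + w * RtoC x)) <= K * exp (- (c * u)).
Proof.
  intros Hs Hw.
  set (lam := exp (- Rabs (Re w)) * cos (Im w)).
  assert (Hl : 0 < lam).
  { apply Rmult_lt_0_compat; [apply exp_pos|]; apply Rabs_lt_between in Hw; apply cos_gt_0; lra. }
  (* On the right, half of the rate [2 * Re s] is spent on the growth [exp (Re s * u)], so both ends
     decay at rate [Re s]. *)
  destruct (exp_exp_decay lam (2 * Re s) Hl) as [K [HK H]].
  set (M := exp (Cmod s * Cmod w)); assert (HM : 0 < M) by apply exp_pos.
  exists (M * (K + 1)), (Re s); split; [exact Hs|]; split; [nra|]; intros u x Hu Hx.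
  assert (Eu := exp_pos (- (Re s * u))).
  split; (eapply Rle_trans; [apply gamma_entire_bound; assumption|]); fold lam M;
    rewrite Rmult_assoc; apply Rmult_le_compat_l; try lra.
  - apply Rle_trans with (exp (Re s * u) * (K * exp (- (2 * Re s * u)))).
    + apply Rmult_le_compat_l; [left; apply exp_pos | apply H, Hu].
    + replace (exp (Re s * u) * (K * exp (- (2 * Re s * u)))) with (K * exp (- (Re s * u))); [nra|].
      replace (- (Re s * u)) with (Re s * u + - (2 * Re s * u)) by ring; rewrite exp_plus; ring.
  - replace (Re s * - u) with (- (Re s * u)) by ring.
    assert (exp (- (lam * exp (- u))) <= 1).
    { rewrite <- exp_0; apply exp_le; pose proof (exp_pos (- u)); nra. }
    pose proof (exp_pos (- (lam * exp (- u)))).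
    apply Rle_trans with (exp (- (Re s * u)) * 1); [apply Rmult_le_compat_l; lra | nra].
Qed.

Lemma Ccontinuous_path {T : UniformSpace} (c w : C) (f : T -> R) (x : T) :
  continuous f x -> Ccontinuous (fun y => c + w * RtoC (f y))%C x.
Proof.
  intros H; apply Ccontinuous_plus; [apply Ccontinuous_const|].
  apply Ccontinuous_mult; [apply Ccontinuous_const | apply Ccontinuous_RtoC, H].
Qed.

Lemma gamma_entire_TIable (s w : C) (x : R) : 0 < Re s -> Rabs (Im w) < PI / 2 -> 0 <= x <= 1 ->
  TIable (fun u => gamma_entire s (RtoC u + w * RtoC x)).
Proof.
  intros Hs Hw Hx; destruct (gamma_entire_decay s w Hs Hw) as (K & c & Hc & HK & H).
  split; exists c, K; (split; [| split; [exact Hc|]]).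
  - intros u; apply Ccontinuous_gamma_entire, Ccontinuous_plus; [| apply Ccontinuous_const].
    apply Ccontinuous_RtoC, continuous_id.
  - intros u Hu; apply (H u x Hu Hx).
  - intros u; apply Ccontinuous_gamma_entire, Ccontinuous_plus; [| apply Ccontinuous_const].
    apply Ccontinuous_RtoC, (continuous_opp (V := R_NormedModule)), continuous_id.
  - intros u Hu; apply (H u x Hu Hx).
Qed.

Lemma TI_limit (f : R -> C) : TIable f ->
  filterlim (fun A => CRint f (- A) A) (Rbar_locally p_infty) (locally (T := C_R_NormedModule) (TI f)).
Proof.
  intros [D1 D2]; unfold TI.
  eapply filterlim_ext; [| apply Clim_plus; [typeclasses eauto | exact (decaying_is_HI _ D1) | exact (decaying_is_HI _ D2)]].
  intros A; cbv beta; rewrite (CRint_sub f (- A) A) by (apply decaying_continuous, D1).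
  rewrite Ropp_involutive; reflexivity.
Qed.

(* Cauchy's theorem on the parallelogram with sides [-A, A] and [w]: moving the segment by [x w]
   changes its integral at a rate given by the two end values, which vanish as [A] grows. *)
Lemma TI_gamma_entire_shift (s w : C) : 0 < Re s -> Rabs (Im w) < PI / 2 ->
  TI (fun u => gamma_entire s (RtoC u + w)) = TI (fun u => gamma_entire s (RtoC u)).
Proof.
  intros Hs Hw.
  destruct (gamma_entire_decay s w Hs Hw) as (K & c & Hc & HK & H).
  set (F := fun x u => gamma_entire s (RtoC u + w * RtoC x)).
  assert (T0 : TIable (F 0)) by (apply gamma_entire_TIable; [assumption | assumption | lra]).
  assert (T1 : TIable (F 1)) by (apply gamma_entire_TIable; [assumption | assumption | lra]).
  assert (E0 : TI (fun u => gamma_entire s (RtoC u)) = TI (F 0)).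
  { apply TI_ext; [exact T0|]; intros u; unfold F; f_equal; ring. }
  assert (E1 : TI (fun u => gamma_entire s (RtoC u + w)) = TI (F 1)).
  { apply TI_ext; [exact T1|]; intros u; unfold F; f_equal; ring. }
  rewrite E0, E1; clear E0 E1.
  assert (Cpair : forall z : R * R, Ccontinuous (fun z : R * R => RtoC (snd z) + w * RtoC (fst z))%C z).
  { intros [x u]; apply Ccontinuous_plus; [apply Ccontinuous_RtoC, continuous_snd|].
    apply Ccontinuous_mult; [apply Ccontinuous_const | apply Ccontinuous_RtoC, continuous_fst]. }
  assert (Cline : forall x u, Ccontinuous (fun u => RtoC u + w * RtoC x)%C u).
  { intros x u; apply Ccontinuous_plus; [apply Ccontinuous_RtoC, continuous_id | apply Ccontinuous_const]. }
  assert (Diff : forall A, 0 <= A ->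
     Cmod (CRint (F 1) (- A) A - CRint (F 0) (- A) A)%C <= 2 * Cmod w * K * exp (- (c * A))).
  { intros A HA.
    set (DE := fun x => (w * (F x A - F x (- A)%R))%C).
    assert (D : forall x, is_derive_RC (fun x => CRint (F x) (- A) A) x (DE x)).
    { intros x; evar_last.
      - apply (is_derive_RC_param F (fun x u => w * gamma_entire_d s (RtoC u + w * RtoC x))%C).
        + intros y u; apply gamma_entire_path.
        + intros y u; apply Ccontinuous_gamma_entire, Cline.
        + intros z; apply Ccontinuous_mult; [apply Ccontinuous_const|].
          apply Ccontinuous_gamma_entire_d, Cpair.
      (* [F] depends only on [u + w x], so its derivative in [x] is [w] times its derivative in [u],
         and the integral over [u] leaves the values at the two ends. *)
      - assert (Cd : forall u, Ccontinuous (fun u => gamma_entire_d s (RtoC u + w * RtoC x)) u)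
          by (intros u; apply Ccontinuous_gamma_entire_d, Cline).
        rewrite CRint_scal by (apply ex_CRint, Cd).
        rewrite (CRint_derive (F x)); [reflexivity | | exact Cd].
        intros u; unfold F.
        pose proof (gamma_entire_path s (w * RtoC x) 1 u) as G.
        evar_last.
        + eapply is_derive_ext; [| exact G]; intros v; simpl; f_equal; ring.
        + rewrite Cmult_1_l; f_equal; ring. }
    assert (CDE : forall x, Ccontinuous DE x).
    { intros x; apply Ccontinuous_mult; [apply Ccontinuous_const|].
      apply Ccontinuous_minus; apply Ccontinuous_gamma_entire, Ccontinuous_path, continuous_id. }
    rewrite <- (CRint_derive _ DE 0 1 D CDE).
    eapply Rle_trans.
    - apply (CRint_le DE (fun _ => 2 * Cmod w * K * exp (- (c * A)))); [lra | apply ex_CRint, CDE | apply ex_RInt_const |].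
      intros x Hx; unfold DE; rewrite Cmod_mult.
      destruct (H A x HA Hx) as [H1 H2].
      assert (Cmod (F x A - F x (- A)%R)%C <= 2 * (K * exp (- (c * A)))).
      { eapply Rle_trans; [apply Cmod_triangle|]; rewrite Cmod_opp; unfold F; lra. }
      pose proof (Cmod_ge_0 w); nra.
    - rewrite RInt_const; unfold scal; simpl; unfold mult; simpl; lra. }
  apply (Clim_unique (Rbar_locally p_infty) (fun A => CRint (F 1) (- A) A)); [apply TI_limit, T1|].
  assert (L : filterlim (fun A => CRint (F 0) (- A) A + (CRint (F 1) (- A) A - CRint (F 0) (- A) A))%C
     (Rbar_locally p_infty) (locally (T := C_R_NormedModule) (TI (F 0) + 0)%C)).
  { apply Clim_plus; [typeclasses eauto | apply TI_limit, T0 |].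
    apply (decaying_lim0 _ (2 * Cmod w * K) c Hc); exact Diff. }
  replace (TI (F 0) + 0)%C with (TI (F 0)) in L by ring.
  eapply filterlim_ext; [| exact L]; intros A; cbv beta; ring.
Qed.

Lemma Cexp_Clog_right (z : C) : 0 < Re z -> Cexp (Clog_right z) = z.
Proof.
  intros Hz.
  assert (Hm : 0 < Cmod z) by (apply Cmod_gt_0, Re_neq_0; lra).
  assert (E : Cmod z = Re z * sqrt (1 + (Im z / Re z)²)).
  { unfold Cmod; change (fst z) with (Re z); change (snd z) with (Im z).
    replace (Re z ^ 2 + Im z ^ 2) with (Re z ^ 2 * (1 + (Im z / Re z)²)) by (unfold Rsqr; field; lra).
    rewrite sqrt_mult, sqrt_pow2; [reflexivity | lra | apply pow2_ge_0 |].
    pose proof (Rle_0_sqr (Im z / Re z)); lra. }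
  assert (S : 0 < sqrt (1 + (Im z / Re z)²)).
  { apply sqrt_lt_R0; pose proof (Rle_0_sqr (Im z / Re z)); lra. }
  apply Ceq; unfold Cexp, Clog_right.
  - change (exp (ln (Cmod z)) * cos (atan (Im z / Re z)) = Re z).
    rewrite exp_ln, cos_atan, E by exact Hm; field; lra.
  - change (exp (ln (Cmod z)) * sin (atan (Im z / Re z)) = Im z).
    rewrite exp_ln, sin_atan, E by exact Hm; field; split; lra.
Qed.

(** With [z = exp w] one has [z exp u = exp (u + w)], so moving the line of integration by
    [w = log z] costs the factor [exp (- s w) = z^-s]. The shift is allowed since the argument of
    [z] is below [PI / 2] in modulus. *)
Lemma Gam_scale (s z : C) : 0 < Re s -> 0 < Re z ->
  TIable (fun u => Cexp (s * RtoC u) * Cexp (- (z * RtoC (exp u))))%C /\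
  TI (fun u => Cexp (s * RtoC u) * Cexp (- (z * RtoC (exp u))))%C = (Gam s / Cpow_right z s)%C.
Proof.
  intros Hs Hz; set (w := Clog_right z).
  assert (Hw : Rabs (Im w) < PI / 2).
  { unfold w, Clog_right, Im; simpl; destruct (atan_bound (snd z / Re z)) as [h1 h2].
    apply Rabs_lt_between; unfold Im; lra. }
  assert (E : forall u, (Cexp (- (s * w)) * gamma_entire s (RtoC u + w * RtoC 1))%C
              = (Cexp (s * RtoC u) * Cexp (- (z * RtoC (exp u))))%C).
  { intros u; unfold gamma_entire.
    replace (RtoC u + w * RtoC 1)%C with (RtoC u + w)%C by ring.
    replace (s * (RtoC u + w))%C with (s * RtoC u + s * w)%C by ring.
    rewrite !Cexp_plus, Cexp_RtoC; unfold w at 3; rewrite Cexp_Clog_right by exact Hz.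
    rewrite Cexp_opp; replace (RtoC (exp u) * z)%C with (z * RtoC (exp u))%C by ring.
    field; apply Cexp_neq_0. }
  assert (T1 : TIable (fun u => gamma_entire s (RtoC u + w * RtoC 1)))
    by (apply gamma_entire_TIable; [exact Hs | exact Hw | lra]).
  assert (T2 := TIable_scal (Cexp (- (s * w))) _ T1); split.
  - eapply TIable_ext; [exact E | exact T2].
  - rewrite (TI_ext _ _ T2) by (intros; apply E).
    rewrite (TI_scal _ _ T1).
    assert (G : TI (fun u => gamma_entire s (RtoC u + w * RtoC 1)) = Gam s).
    { rewrite <- (TI_ext _ (fun u => gamma_entire s (RtoC u + w)) T1) by (intros; f_equal; ring).
      rewrite TI_gamma_entire_shift by assumption; unfold Gam.
      apply TI_ext; [apply gkernel_TIable, Hs|]; intros u.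
      unfold gamma_entire, gkernel; rewrite Cexp_RtoC, <- RtoC_opp, Cexp_RtoC; reflexivity. }
    rewrite G, Cexp_opp; unfold Cpow_right; fold w; unfold Cdiv; ring.
Qed.

(** * Fourier coefficients and Fejer means of Psi *)

Definition zfreq (n : Z) : C := (ln 2 - 2 * PI * Ci * IZR n)%C.

Lemma Re_zfreq (n : Z) : Re (zfreq n) = ln 2.
Proof. unfold zfreq, Re; simpl; ring. Qed.

Lemma Im_zfreq (n : Z) : Im (zfreq n) = - (2 * PI * IZR n).
Proof. unfold zfreq, Im; simpl; ring. Qed.

Lemma cos_sin_2PI_Z (n : Z) : cos (2 * PI * IZR n) = 1 /\ sin (2 * PI * IZR n) = 0.
Proof.
  assert (H : forall k : nat, cos (2 * PI * INR k) = 1 /\ sin (2 * PI * INR k) = 0).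
  { intros k; split.
    - replace (2 * PI * INR k) with (0 + 2 * INR k * PI) by ring; rewrite cos_period; apply cos_0.
    - replace (2 * PI * INR k) with (0 + 2 * INR k * PI) by ring; rewrite sin_period; apply sin_0. }
  destruct (Z_le_gt_dec 0 n) as [L|L].
  - specialize (H (Z.to_nat n)); rewrite INR_IZR_INZ, Z2Nat.id in H by exact L; exact H.
  - specialize (H (Z.to_nat (- n))); rewrite INR_IZR_INZ, Z2Nat.id, opp_IZR in H by lia.
    replace (2 * PI * - IZR n) with (- (2 * PI * IZR n)) in H by ring.
    rewrite cos_neg, sin_neg in H; lra.
Qed.

Lemma Cexp_zfreq (n : Z) : Cexp (zfreq n) = 2.
Proof.
  destruct (cos_sin_2PI_Z n) as [c s].
  apply Ceq; unfold Cexp; cbn [fst snd Re Im].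
  - change (exp (Re (zfreq n)) * cos (Im (zfreq n)) = 2).
    rewrite Re_zfreq, Im_zfreq, exp_ln, cos_neg, c by lra; ring.
  - change (exp (Re (zfreq n)) * sin (Im (zfreq n)) = 0).
    rewrite Im_zfreq, sin_neg, s; ring.
Qed.

Lemma continuous_coef_integrand (n : Z) (x : R) :
  Ccontinuous (fun x : R => (RtoC (Psi x) * Cexp (- (2 * PI * Ci * IZR n * x)))%C) x.
Proof.
  apply Ccontinuous_mult; [apply Ccontinuous_RtoC, continuous_Psi|].
  apply Ccontinuous_exp, Ccontinuous_opp, Ccontinuous_lin.
Qed.

Lemma coef_integrand (n : Z) (x : R) :
  (RtoC (Psi x) * Cexp (- (2 * PI * Ci * IZR n * x)))%C
  = (RtoC (1 - question_mark x) * Cexp (zfreq n * RtoC x))%C.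
Proof.
  replace (zfreq n * RtoC x)%C with (RtoC (x * ln 2) + - (2 * PI * Ci * IZR n * x))%C
    by (unfold zfreq; rewrite RtoC_mult; ring).
  assert (P : Psi x = (1 - question_mark x) * exp (x * ln 2)) by (unfold Psi, Rpower; ring).
  rewrite P, RtoC_mult, Cexp_plus, Cexp_RtoC; ring.
Qed.

(* By parts against dF; the boundary term [[(1 - F) exp (z x)]] on [0, 1] vanishes since [exp z = 2]. *)
Lemma Psi_coef_bound (n : Z) : Cmod (zfreq n) * Cmod (Psi_coef n) <= 2.
Proof.
  set (f := fun x => Cexp (zfreq n * RtoC x)).
  assert (Df : forall x, is_derive_RC f x (zfreq n * f x)%C)
    by (intros x; apply is_derive_RC_exp, is_derive_RC_lin).
  assert (Cf : forall x, Ccontinuous (fun x => zfreq n * f x)%C x)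
    by (intros x; apply Ccontinuous_mult; [apply Ccontinuous_const | apply Ccontinuous_exp, Ccontinuous_lin]).
  assert (Hln : 0 < ln 2) by (rewrite <- ln_1; apply ln_increasing; lra).
  assert (Fm : forall x, 0 <= x <= 1 -> Cmod (f x) <= 2).
  { intros x Hx; unfold f; rewrite Cmod_Cexp.
    replace (Re (zfreq n * RtoC x)%C) with (Re (zfreq n) * x) by (unfold Re; simpl; ring).
    rewrite Re_zfreq; rewrite <- (exp_ln 2) at 2 by lra; apply exp_le; nra. }
  assert (Cg : forall t, continuous (fun x => question_mark x - 1) t).
  { intros t; apply (continuous_minus (V := R_NormedModule)); [apply continuous_question_mark | apply continuous_const]. }
  (* The bound 1 is the supremum 2 of [p] times the increment 1/2 of F over [[0, 1]]; it is applied
     to the real and to the imaginary part. *)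
  assert (B : forall p dp : R -> R, (forall t, is_derive p t (dp t)) -> (forall t, continuous dp t) ->
     (forall t, 0 <= t <= 1 -> Rabs (p t) <= 2) -> p 1 = 2 * p 0 ->
     Rabs (RInt (fun t => (1 - question_mark t) * dp t) 0 1) <= 1).
  { intros p dp H1 H2 H3 H4.
    assert (Q := by_parts_abs_le p dp (fun _ => 2) (fun _ => 0) (fun x => question_mark x - 1) 0 1 Rle_0_1
      H1 H2 ltac:(intros; apply (is_derive_const (V := R_NormedModule))) ltac:(intros; apply continuous_const) Cg
      ltac:(intros; assert (question_mark s <= question_mark t) by (apply question_mark_le; lra); lra) H3).
    cbv beta in Q; rewrite question_mark_0, question_mark_1, H4 in Q.
    rewrite (RInt_Rext (fun t => (question_mark t - 1) * 0) (fun _ => 0)) in Q by (intros; ring).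
    rewrite RInt_const in Q; unfold scal in Q; simpl in Q; unfold mult in Q; simpl in Q.
    rewrite (RInt_Rext (fun t => (question_mark t - 1) * dp t) (fun t => -1 * ((1 - question_mark t) * dp t))) in Q
      by (intros; ring).
    rewrite RInt_Rscal in Q.
    - assert (E : forall J, 2 * p 0 * (/ 2 - 1) - p 0 * (0 - 1) - -1 * J = J) by (intros; field).
      rewrite E in Q; lra.
    - apply ex_RInt_cont; intros t; apply (continuous_mult (K := R_AbsRing)); [| apply H2].
      apply (continuous_minus (V := R_NormedModule)); [apply continuous_const | apply continuous_question_mark]. }
  assert (f1 : f 1 = RtoC 2).
  { unfold f; replace (zfreq n * RtoC 1)%C with (zfreq n) by ring; apply Cexp_zfreq. }
  assert (f0 : f 0 = RtoC 1).
  { unfold f; replace (zfreq n * RtoC 0)%C with (RtoC 0) by ring; apply Cexp_0. }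
  assert (Cq : forall x, Ccontinuous (fun x => RtoC (1 - question_mark x) * (zfreq n * f x))%C x).
  { intros x; apply Ccontinuous_mult; [| apply Cf]; apply Ccontinuous_RtoC.
    apply (continuous_minus (V := R_NormedModule)); [apply continuous_const | apply continuous_question_mark]. }
  assert (E : (zfreq n * Psi_coef n)%C = CRint (fun x => RtoC (1 - question_mark x) * (zfreq n * f x))%C 0 1).
  { unfold Psi_coef; rewrite <- CRint_scal by (apply ex_CRint; intros; apply continuous_coef_integrand).
    apply (RInt_ext (V := C_R_CompleteNormedModule)); intros x _; rewrite coef_integrand; unfold f.
    creal. }
  rewrite <- Cmod_mult, E; eapply Rle_trans; [apply Cmod_le_add|].
  replace 2 with (1 + 1) by ring; apply Rplus_le_compat.
  - rewrite CRint_Re by (apply ex_CRint, Cq).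
    rewrite (RInt_Rext _ (fun t => (1 - question_mark t) * Re (zfreq n * f t)%C))
      by (intros t; generalize (zfreq n * f t)%C; intros z; unfold Re; simpl; ring).
    apply (B (fun t => Re (f t))).
    + intros t; apply (is_derive_RC_Re f), Df.
    + intros t; apply (Ccontinuous_Re (fun t => zfreq n * f t)%C), Cf.
    + intros t Ht; eapply Rle_trans; [apply re_le_Cmod | apply Fm, Ht].
    + rewrite f1, f0; simpl; ring.
  - rewrite CRint_Im by (apply ex_CRint, Cq).
    rewrite (RInt_Rext _ (fun t => (1 - question_mark t) * Im (zfreq n * f t)%C))
      by (intros t; generalize (zfreq n * f t)%C; intros z; unfold Im; simpl; ring).
    apply (B (fun t => Im (f t))).
    + intros t; apply (is_derive_RC_Im f), Df.
    + intros t; apply (Ccontinuous_Im (fun t => zfreq n * f t)%C), Cf.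
    + intros t Ht; eapply Rle_trans; [apply Im_le_Cmod | apply Fm, Ht].
    + rewrite f1, f0; simpl; ring.
Qed.

(** * Fejer kernel and uniform convergence of the Fejer means *)

Fixpoint Csum (f : nat -> C) (N : nat) : C :=
  match N with O => RtoC 0 | S m => (Csum f m + f m)%C end.

Fixpoint sym_sum (a : Z -> C) (m : nat) : C :=
  match m with
  | O => a 0%Z
  | S k => (sym_sum a k + (a (Z.of_nat (S k)) + a (- Z.of_nat (S k))%Z))%C
  end.

Definition fejer_mean (a : Z -> C) (N : nat) : C := (/ RtoC (INR N) * Csum (sym_sum a) N)%C.

Fixpoint dirichlet (m : nat) (v : R) : R :=
  match m with O => 1 | S k => dirichlet k v + 2 * cos (2 * PI * INR (S k) * v) end.

(** Not normalised: this is [N] times the usual Fejer kernel. *)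
Fixpoint fejer (N : nat) (v : R) : R :=
  match N with O => 0 | S m => fejer m v + dirichlet m v end.

Lemma dirichlet_identity (m : nat) (v : R) :
  dirichlet m v * (2 - 2 * cos (2 * PI * v)) = 2 * cos (2 * PI * INR m * v) - 2 * cos (2 * PI * INR (S m) * v).
Proof.
  induction m as [|m IH].
  - replace (2 * PI * INR 1 * v) with (2 * PI * v) by (simpl; ring).
    replace (2 * PI * INR 0 * v) with 0 by (simpl; ring); rewrite cos_0; simpl; ring.
  - cbn [dirichlet]; rewrite Rmult_plus_distr_r, IH.
    set (c := 2 * PI * INR (S m) * v).
    replace (2 * PI * INR m * v) with (c - 2 * PI * v) by (unfold c; rewrite S_INR; ring).
    replace (2 * PI * INR (S (S m)) * v) with (c + 2 * PI * v) by (unfold c; rewrite !S_INR; ring).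
    rewrite cos_minus, cos_plus; ring.
Qed.

(** The closed form sin^2(pi N v) / sin^2(pi v), stated without division so that it also holds at
    integers. *)
Lemma fejer_identity (N : nat) (v : R) :
  fejer N v * (2 - 2 * cos (2 * PI * v)) = 2 - 2 * cos (2 * PI * INR N * v).
Proof.
  induction N as [|N IH].
  - simpl; replace (2 * PI * 0 * v) with 0 by ring; rewrite cos_0; ring.
  - cbn [fejer]; rewrite Rmult_plus_distr_r, IH, dirichlet_identity; ring.
Qed.

(** The closed form gives the sign except at integers [v], where it degenerates to 0 = 0; there all
    the cosines equal 1. *)
Lemma fejer_ge0 (N : nat) (v : R) : 0 <= fejer N v.
Proof.
  pose proof (COS_bound (2 * PI * v)) as B.
  destruct (Req_dec (cos (2 * PI * v)) 1) as [E|E].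
  - assert (S0 : sin (2 * PI * v) = 0).
    { pose proof (sin2_cos2 (2 * PI * v)) as P; rewrite E in P; unfold Rsqr in P.
      apply Rsqr_0_uniq; unfold Rsqr; lra. }
    assert (Cn : forall n, cos (2 * PI * INR n * v) = 1).
    { induction n as [|n IH].
      - simpl; replace (2 * PI * 0 * v) with 0 by ring; apply cos_0.
      - replace (2 * PI * INR (S n) * v) with (2 * PI * INR n * v + 2 * PI * v) by (rewrite S_INR; ring).
        rewrite cos_plus, IH, E, S0; ring. }
    assert (D : forall m, 0 <= dirichlet m v).
    { induction m as [|m IH]; cbn [dirichlet]; [lra | rewrite Cn; lra]. }
    induction N as [|N IH]; cbn [fejer]; [lra | specialize (D N); lra].
  - pose proof (fejer_identity N v) as F; pose proof (COS_bound (2 * PI * INR N * v)).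
    apply Rmult_le_reg_r with (2 - 2 * cos (2 * PI * v)); lra.
Qed.

Lemma fejer_le (N : nat) (v eta : R) : 0 < eta <= 2 - 2 * cos (2 * PI * v) -> fejer N v <= 4 / eta.
Proof.
  intros H; pose proof (fejer_identity N v) as F; pose proof (COS_bound (2 * PI * INR N * v)).
  pose proof (fejer_ge0 N v).
  apply Rmult_le_reg_r with eta; [lra|]; unfold Rdiv; rewrite Rmult_assoc, Rinv_l, Rmult_1_r by lra; nra.
Qed.

Lemma continuous_dirichlet (m : nat) (x y : R) : continuous (fun y => dirichlet m (x - y)) y.
Proof.
  induction m as [|m IH]; cbn [dirichlet]; [apply continuous_const|].
  apply (continuous_plus (V := R_NormedModule)); [exact IH|].
  apply (ex_derive_continuous (V := R_NormedModule)); auto_derive; exact I.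
Qed.

Lemma continuous_fejer (N : nat) (x y : R) : continuous (fun y => fejer N (x - y)) y.
Proof.
  induction N as [|N IH]; cbn [fejer]; [apply continuous_const|].
  apply (continuous_plus (V := R_NormedModule)); [exact IH | apply continuous_dirichlet].
Qed.

Lemma continuous_Psi_mult (g : R -> R) : (forall y, continuous g y) -> forall y, continuous (fun y => Psi y * g y) y.
Proof. intros H y; apply (continuous_mult (K := R_AbsRing)); [apply continuous_Psi | apply H]. Qed.

Lemma cos_wave_continuous (c x y : R) : continuous (fun y => 2 * cos (c * (x - y))) y.
Proof. apply (ex_derive_continuous (V := R_NormedModule)); auto_derive; exact I. Qed.

Lemma dirichlet_integral (m : nat) (x : R) : RInt (fun y => dirichlet m (x - y)) 0 1 = 1.
Proof.
  induction m as [|m IH]; cbn [dirichlet].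
  - rewrite RInt_const; unfold scal; simpl; unfold mult; simpl; ring.
  - rewrite RInt_Rplus, IH.
    + assert (Z0 : RInt (fun y => 2 * cos (2 * PI * INR (S m) * (x - y))) 0 1 = 0); [| rewrite Z0; apply Rplus_0_r].
      assert (Hm : INR (S m) <> 0) by (apply not_0_INR; lia).
      pose proof PI_neq0.
      apply is_RInt_unique; evar_last.
      * apply (is_RInt_derive (V := R_CompleteNormedModule)
          (fun y => - (2 / (2 * PI * INR (S m))) * sin (2 * PI * INR (S m) * (x - y)))).
        -- intros y _; set (c := INR (S m)) in *; auto_derive; [exact I|].
           replace (x + - y) with (x - y) by ring; field; auto.
        -- intros y _; apply cos_wave_continuous.
      * change (- (2 / (2 * PI * INR (S m))) * sin (2 * PI * INR (S m) * (x - 1))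
          + - (- (2 / (2 * PI * INR (S m))) * sin (2 * PI * INR (S m) * (x - 0))) = 0).
        replace (2 * PI * INR (S m) * (x - 0)) with (2 * PI * INR (S m) * (x - 1) + 2 * INR (S m) * PI) by ring.
        rewrite sin_period; ring.
    + apply ex_RInt_cont; intros; apply continuous_dirichlet.
    + apply ex_RInt_cont; intros; apply cos_wave_continuous.
Qed.

Lemma fejer_integral (N : nat) (x : R) : RInt (fun y => fejer N (x - y)) 0 1 = INR N.
Proof.
  induction N as [|N IH]; cbn [fejer].
  - rewrite RInt_const; unfold scal; simpl; unfold mult; simpl; ring.
  - rewrite RInt_Rplus, IH, dirichlet_integral, S_INR; [reflexivity | |];
      apply ex_RInt_cont; intros; [apply continuous_fejer | apply continuous_dirichlet].
Qed.

Lemma CRint_RtoC (g : R -> R) (a b : R) : (forall x, continuous g x) ->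
  CRint (fun x => RtoC (g x)) a b = RtoC (RInt g a b).
Proof.
  intros H; assert (Cg : forall x, Ccontinuous (fun x => RtoC (g x)) x) by (intros; apply Ccontinuous_RtoC, H).
  apply Ceq.
  - rewrite CRint_Re by (apply ex_CRint, Cg); reflexivity.
  - rewrite CRint_Im by (apply ex_CRint, Cg); simpl; rewrite RInt_const.
    unfold scal; simpl; unfold mult; simpl; ring.
Qed.

Definition Psi_harmonic (x : R) (n : Z) : C := (Psi_coef n * Cexp (2 * PI * Ci * IZR n * x))%C.

Lemma Psi_harmonic_pair (x : R) (k : nat) :
  (Psi_harmonic x (Z.of_nat k) + Psi_harmonic x (- Z.of_nat k))%C
  = RtoC (RInt (fun y => Psi y * (2 * cos (2 * PI * INR k * (x - y)))) 0 1).
Proof.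
  unfold Psi_harmonic, Psi_coef.
  rewrite !(Cmult_comm (CRint _ _ _)).
  rewrite <- !CRint_scal by (apply ex_CRint; intros; apply continuous_coef_integrand).
  rewrite <- CRint_plus
    by (apply ex_CRint; intros; apply Ccontinuous_mult; [apply Ccontinuous_const | apply continuous_coef_integrand]).
  rewrite <- CRint_RtoC by (apply continuous_Psi_mult; intros; apply cos_wave_continuous).
  apply (RInt_ext (V := C_R_CompleteNormedModule)); intros y _.
  rewrite opp_IZR, <- INR_IZR_INZ.
  assert (E : forall t : R, (Cexp (Ci * RtoC t) + Cexp (- (Ci * RtoC t)))%C = RtoC (2 * cos t)).
  { intros t; unfold Cexp, Re, Im; apply Ceq; unfold Re, Im; simpl.
    - replace (0 * t - 1 * 0) with 0 by ring; replace (- 0) with 0 by ring; rewrite exp_0.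
      replace (0 * 0 + 1 * t) with t by ring; rewrite cos_neg; ring.
    - replace (0 * t - 1 * 0) with 0 by ring; replace (- 0) with 0 by ring; rewrite exp_0.
      replace (0 * 0 + 1 * t) with t by ring; rewrite sin_neg; ring. }
  rewrite RtoC_mult, <- E.
  set (A := (2 * PI * Ci * INR k * x)%C); set (B := (2 * PI * Ci * INR k * y)%C).
  replace (2 * PI * Ci * RtoC (- INR k) * x)%C with (- A)%C by (unfold A; rewrite RtoC_opp; ring).
  replace (2 * PI * Ci * RtoC (- INR k) * y)%C with (- B)%C by (unfold B; rewrite RtoC_opp; ring).
  replace (Ci * RtoC (2 * PI * INR k * (x - y)))%C with (A + - B)%C
    by (unfold A, B; rewrite !RtoC_mult, RtoC_minus; ring).
  replace (- (A + - B))%C with (- A + - - B)%C by ring.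
  rewrite !Cexp_plus; creal.
Qed.

Lemma sym_sum_dirichlet (x : R) (m : nat) :
  sym_sum (Psi_harmonic x) m = RtoC (RInt (fun y => Psi y * dirichlet m (x - y)) 0 1).
Proof.
  induction m as [|m IH]; cbn [sym_sum dirichlet].
  - unfold Psi_harmonic, Psi_coef.
    rewrite <- CRint_RtoC by (apply continuous_Psi_mult; intros; apply continuous_const).
    replace (2 * PI * Ci * 0 * x)%C with (RtoC 0) by ring; rewrite Cexp_0, Cmult_1_r.
    apply (RInt_ext (V := C_R_CompleteNormedModule)); intros y _.
    replace (- (2 * PI * Ci * 0 * y))%C with (RtoC 0) by ring; rewrite Cexp_0, Rmult_1_r, Cmult_1_r; reflexivity.
  - rewrite IH, Psi_harmonic_pair, <- RtoC_plus, <- RInt_Rplus.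
    + f_equal; apply RInt_Rext; intros; ring.
    + apply ex_RInt_cont, continuous_Psi_mult; intros; apply continuous_dirichlet.
    + apply ex_RInt_cont, continuous_Psi_mult; intros; apply cos_wave_continuous.
Qed.

Lemma Csum_fejer (x : R) (N : nat) :
  Csum (sym_sum (Psi_harmonic x)) N = RtoC (RInt (fun y => Psi y * fejer N (x - y)) 0 1).
Proof.
  induction N as [|N IH]; cbn [Csum fejer].
  - rewrite (RInt_Rext _ (fun _ => 0)) by (intros; ring).
    rewrite RInt_const; unfold scal; simpl; unfold mult; simpl; f_equal; ring.
  - rewrite IH, sym_sum_dirichlet, <- RtoC_plus, <- RInt_Rplus.
    + f_equal; apply RInt_Rext; intros; ring.
    + apply ex_RInt_cont, continuous_Psi_mult; intros; apply continuous_fejer.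
    + apply ex_RInt_cont, continuous_Psi_mult; intros; apply continuous_dirichlet.
Qed.

(** The distance modulo 1 is measured by [2 - 2 cos (2 PI (x - y))], the quantity that divides in
    the closed form of the Fejer kernel. *)
Lemma Psi_unif (eps : R) : 0 < eps ->
  exists eta, 0 < eta /\ forall x y, 2 - 2 * cos (2 * PI * (x - y)) < eta -> Rabs (Psi y - Psi x) <= eps.
Proof.
  intros He.
  (* By periodicity [y] will be moved into [[1, 2)] and [x] to within 1/4 of it, so [[0, 3]]
     contains both. *)
  destruct (Heine_cor2 (f := Psi) (a := 0) (b := 3)
    ltac:(intros; apply continuity_pt_filterlim, continuous_Psi) (mkposreal eps He)) as [d Hd].
  simpl in Hd.
  set (r := Rmin d (/ 4)).
  assert (r1 : 0 < r) by (apply Rmin_pos; [apply cond_pos | lra]).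
  assert (r2 : r <= / 4) by apply Rmin_r.
  assert (r3 : r <= d) by apply Rmin_l.
  pose proof PI_RGT_0 as Pp.
  exists (2 - 2 * cos (2 * PI * r)); split.
  { assert (cos (2 * PI * r) < 1); [| lra].
    rewrite <- cos_0; apply cos_decreasing_1; nra. }
  intros x y H.
  (* [n] is an integer nearest to [x - y], so that [q] is the signed distance modulo 1. *)
  set (n := Int_part (x - y + / 2)); set (m := Int_part y).
  destruct (base_fp (x - y + / 2)) as [f1 f2]; unfold frac_part in f1, f2; fold n in f1, f2.
  destruct (base_fp y) as [g1 g2]; unfold frac_part in g1, g2; fold m in g1, g2.
  set (q := x - y - IZR n) in *.
  assert (Hq : - / 2 <= q <= / 2) by (unfold q; lra).
  assert (Ec : cos (2 * PI * (x - y)) = cos (2 * PI * Rabs q)).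
  { destruct (cos_sin_2PI_Z n) as [c s].
    replace (2 * PI * (x - y)) with (2 * PI * q + 2 * PI * IZR n) by (unfold q; ring).
    rewrite cos_plus, c, s.
    unfold Rabs; destruct (Rcase_abs q); [| ring].
    replace (2 * PI * - q) with (- (2 * PI * q)) by ring; rewrite cos_neg; ring. }
  rewrite Ec in H.
  assert (Hqr : Rabs q < r).
  { destruct (Rlt_le_dec (Rabs q) r) as [L|L]; [exact L | exfalso].
    assert (Rabs q <= / 2) by (apply Rabs_le_between; lra).
    assert (cos (2 * PI * Rabs q) <= cos (2 * PI * r)) by (apply cos_decr_1; nra).
    lra. }
  rewrite <- (Psi_shift_Z (1 - m) y), <- (Psi_shift_Z (1 - m - n) x).
  rewrite !minus_IZR; left.
  apply Rabs_lt_between in Hqr.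
  apply Hd; [lra | unfold q in *; lra |].
  replace (y + (1 - IZR m) - (x + (1 - IZR m - IZR n))) with (- q) by (unfold q; ring).
  rewrite Rabs_Ropp; apply Rabs_lt_between; lra.
Qed.

Lemma fejer_uniform (eps : R) : 0 < eps ->
  exists N0, forall N, (N0 <= N)%nat -> (1 <= N)%nat -> forall x,
    Cmod (fejer_mean (Psi_harmonic x) N - RtoC (Psi x))%C <= eps.
Proof.
  intros He; destruct (Psi_unif (eps / 2) ltac:(lra)) as [eta [Heta H]].
  (* Near [x] the oscillation [eps / 2] meets the total mass [N]; elsewhere the oscillation 2 meets
     a kernel of at most [4 / eta]. The choice of [N0] makes [8 / eta] at most [eps / 2 * N]. *)
  destruct (INR_unbounded (16 / eta / eps)) as [N0 HN0].
  exists N0; intros N HN H1 x; apply le_INR in HN; apply (le_INR 1) in H1; simpl in H1.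
  unfold fejer_mean; rewrite Csum_fejer.
  assert (Cf : forall y, continuous (fun y => fejer N (x - y)) y) by (intros; apply continuous_fejer).
  assert (E : (/ RtoC (INR N) * RtoC (RInt (fun y => Psi y * fejer N (x - y))%R 0 1) - RtoC (Psi x))%C
     = RtoC (/ INR N * RInt (fun y => (Psi y - Psi x) * fejer N (x - y)) 0 1)).
  { rewrite <- RtoC_inv, <- RtoC_mult, <- RtoC_minus by lra; f_equal.
    rewrite (RInt_Rext (fun y => (Psi y - Psi x) * fejer N (x - y))
      (fun y => Psi y * fejer N (x - y) - Psi x * fejer N (x - y))) by (intros; ring).
    rewrite RInt_Rminus, RInt_Rscal, fejer_integral; [field; lra | | |]; apply ex_RInt_cont; [exact Cf | |].
    - apply continuous_Psi_mult, Cf.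
    - intros y; apply (continuous_mult (K := R_AbsRing)); [apply continuous_const | apply Cf]. }
  rewrite E, Cmod_R, Rabs_mult, Rabs_inv, (Rabs_pos_eq (INR N)) by lra.
  assert (Ce : forall y, continuous (fun y => eps / 2 * fejer N (x - y)) y).
  { intros y; apply (continuous_mult (K := R_AbsRing)); [apply continuous_const | apply Cf]. }
  assert (Cd : forall y, continuous (fun y => (Psi y - Psi x) * fejer N (x - y)) y).
  { intros y; apply (continuous_mult (K := R_AbsRing)); [| apply Cf].
    apply (continuous_minus (V := R_NormedModule)); [apply continuous_Psi | apply continuous_const]. }
  assert (B : Rabs (RInt (fun y => (Psi y - Psi x) * fejer N (x - y)) 0 1) <= eps / 2 * INR N + 8 / eta).
  { eapply Rle_trans; [apply abs_RInt_le; [lra | apply ex_RInt_cont, Cd]|].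
    rewrite <- (fejer_integral N x), <- RInt_Rscal by (apply ex_RInt_cont, Cf).
    replace (8 / eta) with (RInt (fun _ => 8 / eta) 0 1)
      by (rewrite RInt_const; unfold scal; simpl; unfold mult; simpl; ring).
    rewrite <- RInt_Rplus; [| apply ex_RInt_cont, Ce | apply ex_RInt_const].
    apply RInt_le; [lra | | |].
    - apply (ex_RInt_norm (fun y => (Psi y - Psi x) * fejer N (x - y))), ex_RInt_cont, Cd.
    - apply ex_RInt_cont; intros y; apply (continuous_plus (V := R_NormedModule)); [apply Ce | apply continuous_const].
    - intros y _; rewrite Rabs_mult, (Rabs_pos_eq (fejer N (x - y))) by apply fejer_ge0.
      pose proof (fejer_ge0 N (x - y)) as F0.
      assert (0 < 8 / eta) by (apply Rdiv_lt_0_compat; lra).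
      destruct (Rlt_le_dec (2 - 2 * cos (2 * PI * (x - y))) eta) as [L|L].
      + specialize (H x y L); nra.
      + pose proof (fejer_le N (x - y) eta (conj Heta L)) as F1.
        assert (Rabs (Psi y - Psi x) <= 2).
        { apply Rabs_le_between; pose proof (Psi_bounds x); pose proof (Psi_bounds y); lra. }
        replace (8 / eta) with (2 * (4 / eta)) by (field; lra).
        pose proof (Rabs_pos (Psi y - Psi x)); nra. }
  apply Rmult_le_reg_l with (INR N); [lra|]; rewrite <- Rmult_assoc, Rinv_r, Rmult_1_l by lra.
  eapply Rle_trans; [exact B|].
  assert (8 / eta <= eps / 2 * INR N); [| lra].
  replace (8 / eta) with (eps / 2 * (16 / eta / eps)) by (field; lra).
  apply Rmult_le_compat_l; lra.
Qed.

(** * The zeta function *)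

Lemma ln_2_pos : 0 < ln 2.
Proof. rewrite <- ln_1; apply ln_increasing; lra. Qed.

(** The coefficient is at most [2 / r] with [r = Cmod (zfreq n)], the power contributes
    [r^(- Re s)], and the argument of [zfreq n] is below [PI / 2]. The exponent [1 + Re s] gives
    absolute convergence. *)
Lemma zeta_M_term_bound (s : C) (n : Z) : 0 < Re s ->
  Cmod (zeta_M_term s n) <=
    2 * exp (Rabs (Im s) * (PI / 2)) * exp (- ((1 + Re s) * ln (Cmod (zfreq n)))).
Proof.
  intros Hs; pose proof ln_2_pos as L2.
  assert (Hz : 0 < Cmod (zfreq n)) by (apply Cmod_gt_0, Re_neq_0; rewrite Re_zfreq; lra).
  unfold zeta_M_term; change (ln 2 - 2 * PI * Ci * IZR n)%C with (zfreq n).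
  unfold Cpow_right; rewrite Cmod_div, Cmod_Cexp by apply Cexp_neq_0.
  pose proof (Psi_coef_bound n) as P.
  set (r := Cmod (zfreq n)) in *; set (A := atan (Im (zfreq n) / Re (zfreq n))).
  replace (Re (s * Clog_right (zfreq n))%C) with (Re s * ln r - Im s * A)
    by (unfold Clog_right, A, r, Re, Im; simpl; ring).
  assert (HA : Im s * A <= Rabs (Im s) * (PI / 2)).
  { eapply Rle_trans; [apply Rle_abs|]; rewrite Rabs_mult; apply Rmult_le_compat_l; [apply Rabs_pos|].
    pose proof (atan_bound (Im (zfreq n) / Re (zfreq n))) as B; fold A in B; apply Rabs_le_between; lra. }
  assert (Hc : Cmod (Psi_coef n) <= 2 * exp (- ln r)).
  { rewrite exp_Ropp, exp_ln by exact Hz; apply Rmult_le_reg_l with r; [exact Hz|].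
    replace (r * (2 * / r)) with 2 by (field; lra); exact P. }
  unfold Rdiv at 1; rewrite <- exp_Ropp.
  apply Rle_trans with (2 * exp (- ln r) * exp (- (Re s * ln r - Im s * A))).
  - apply Rmult_le_compat_r; [left; apply exp_pos | exact Hc].
  - rewrite !Rmult_assoc; apply Rmult_le_compat_l; [lra|].
    rewrite <- !exp_plus; apply exp_le; lra.
Qed.

Lemma zfreq_ge (n : Z) : Rabs (IZR n) <= Cmod (zfreq n).
Proof.
  eapply Rle_trans; [| apply Im_le_Cmod]; rewrite Im_zfreq, Rabs_Ropp, Rabs_mult.
  rewrite (Rabs_pos_eq (2 * PI)) by (pose proof PI_RGT_0; lra).
  pose proof PI2_1; pose proof (Rabs_pos (IZR n)); nra.
Qed.

(** The integral test by telescoping: the mean value theorem for [- x^-p / p] on [[k + 1, k + 2]]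
    bounds each term by [b k - b (S k)]. *)
Lemma ex_series_power (p : R) : 0 < p -> ex_series (fun k => exp (- ((1 + p) * ln (INR k + 2)))).
Proof.
  intros Hp; set (b := fun k => / p * exp (- (p * ln (INR k + 1)))).
  apply (ex_series_le (K := R_AbsRing) (V := R_CompleteNormedModule) _ (fun k => b k - b (S k))).
  - intros k; unfold norm; simpl; unfold abs; simpl.
    rewrite Rabs_pos_eq by (left; apply exp_pos).
    pose proof (pos_INR k) as Hk; unfold b; rewrite S_INR.
    destruct (MVT_gen (fun x => - (/ p * exp (- (p * ln x)))) (INR k + 1) (INR k + 2)
      (fun x => / x * exp (- (p * ln x)))) as [c [Hc E]].
    + intros x; rewrite Rmin_left by lra; intros Hx; auto_derive; [lra | field; lra].
    + intros x; rewrite Rmin_left by lra; intros Hx.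
      apply continuity_pt_filterlim.
      apply (ex_derive_continuous (V := R_NormedModule) (fun x => - (/ p * exp (- (p * ln x))))); auto_derive; lra.
    + rewrite Rmin_left, Rmax_right in Hc by lra.
      replace (INR k + 1 + 1) with (INR k + 2) by ring.
      replace (/ p * exp (- (p * ln (INR k + 1))) - / p * exp (- (p * ln (INR k + 2))))
        with (/ c * exp (- (p * ln c))) by lra.
      assert (Ec : / c = exp (- ln c)) by (rewrite exp_Ropp, exp_ln by lra; reflexivity).
      rewrite Ec, <- exp_plus; apply exp_le.
      assert (ln c <= ln (INR k + 2)) by (apply ln_le; lra); nra.
  - exists (b O).
    apply (filterlim_ext (fun n => b O - b (S n))).
    { intros n; induction n as [|n IH]; [rewrite sum_O; reflexivity|].
      rewrite sum_Sn, <- IH; unfold plus; simpl; ring. }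
    apply (proj2 (Rlim_iff eventually _ _)); intros eps He.
    destruct (exp_small p (/ p) eps Hp ltac:(left; apply Rinv_0_lt_compat; lra) He) as [B [HB H]].
    destruct (INR_unbounded (exp B)) as [N HN].
    exists N; intros n Hn; apply le_INR in Hn.
    replace (b O - b (S n) - b O) with (- b (S n)) by ring.
    rewrite Rabs_Ropp; unfold b; rewrite S_INR.
    pose proof (pos_INR n).
    rewrite Rabs_pos_eq by (apply Rmult_le_pos; [left; apply Rinv_0_lt_compat; lra | left; apply exp_pos]).
    apply H; rewrite <- (ln_exp B); apply ln_le; [apply exp_pos | lra].
Qed.

Lemma ex_series_zeta_side (s : C) (f : nat -> Z) : 0 < Re s ->
  (forall k, Rabs (IZR (f (S (S k)))) >= INR k + 2) ->
  exists l, is_series (K := R_AbsRing) (V := C_R_NormedModule) (fun k => zeta_M_term s (f k)) l.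
Proof.
  intros Hs Hf; set (M := 2 * exp (Rabs (Im s) * (PI / 2))).
  assert (HM : 0 < M) by (unfold M; pose proof (exp_pos (Rabs (Im s) * (PI / 2))); lra).
  (* Without its first two terms, either side of the bilateral series is dominated by powers of
     [k + 2]. *)
  apply (ex_series_incr_n (V := C_R_NormedModule) _ 2).
  apply (ex_series_le (K := R_AbsRing) (V := C_R_CompleteNormedModule) _
    (fun k => M * exp (- ((1 + Re s) * ln (INR k + 2))))).
  - intros k; change (norm (zeta_M_term s (f (2 + k)%nat))) with
      (norm (K := R_AbsRing) (V := C_R_NormedModule) (zeta_M_term s (f (S (S k))))).
    rewrite C_R_norm; eapply Rle_trans; [apply zeta_M_term_bound, Hs|]; fold M.
    apply Rmult_le_compat_l; [lra|]; apply exp_le.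
    specialize (Hf k); pose proof (zfreq_ge (f (S (S k)))) as Z1; pose proof (pos_INR k).
    assert (ln (INR k + 2) <= ln (Cmod (zfreq (f (S (S k)))))) by (apply ln_le; lra).
    nra.
  - apply (ex_series_scal (V := R_NormedModule)), ex_series_power, Hs.
Qed.

(** [sum_n] includes its upper index and the negative side starts at -1, so the index [m] there
    reaches [- (m + 1)], matching [S m] on the other side. *)
Lemma sym_sum_split (a : Z -> C) (m : nat) :
  sym_sum a (S m) =
    (sum_n (G := C_R_NormedModule) (fun k => a (Z.of_nat k)) (S m)
     + sum_n (G := C_R_NormedModule) (fun k => a (- Z.of_nat (S k))%Z) m)%C.
Proof.
  induction m as [|m IH].
  - cbn [sym_sum]; rewrite sum_Sn, !sum_O.
    change (plus (a (Z.of_nat 0)) (a (Z.of_nat 1))) with (a (Z.of_nat 0) + a (Z.of_nat 1))%C.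
    simpl Z.of_nat; ring.
  - change (sym_sum a (S (S m))) with
      (sym_sum a (S m) + (a (Z.of_nat (S (S m))) + a (- Z.of_nat (S (S m)))%Z))%C.
    rewrite IH, (sum_Sn (G := C_R_NormedModule) (fun k => a (Z.of_nat k)) (S m)),
      (sum_Sn (G := C_R_NormedModule) (fun k => a (- Z.of_nat (S k))%Z) m).
    change (@plus C_R_NormedModule) with Cplus; ring.
Qed.

Lemma sym_sum_limit (a : Z -> C) (lp lm : C) :
  is_series (K := R_AbsRing) (V := C_R_NormedModule) (fun k => a (Z.of_nat k)) lp ->
  is_series (K := R_AbsRing) (V := C_R_NormedModule) (fun k => a (- Z.of_nat (S k))%Z) lm ->
  filterlim (sym_sum a) eventually (locally (T := C_R_NormedModule) (lp + lm)%C).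
Proof.
  intros Hp Hm.
  apply (proj2 (Clim_iff eventually _ _)); intros eps He.
  assert (He2 : 0 < eps / 2) by lra.
  destruct (proj1 (Clim_iff eventually _ _) Hp _ He2) as [N1 H1].
  destruct (proj1 (Clim_iff eventually _ _) Hm _ He2) as [N2 H2].
  exists (S (N1 + N2)); intros n Hn; destruct n as [|n]; [lia|].
  rewrite sym_sum_split.
  specialize (H1 (S n) ltac:(lia)); specialize (H2 n ltac:(lia)).
  match goal with |- Cmod (?x + ?y - _)%C < _ =>
    replace (x + y - (lp + lm))%C with ((x - lp) + (y - lm))%C by ring end.
  eapply Rle_lt_trans; [apply Cmod_triangle|]; lra.
Qed.

Lemma Cesaro_C (f : nat -> C) (l : C) :
  filterlim f eventually (locally (T := C_R_NormedModule) l) ->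
  filterlim (fun N => / RtoC (INR N) * Csum f N)%C eventually (locally (T := C_R_NormedModule) l).
Proof.
  intros H; apply (proj2 (Clim_iff eventually _ _)); intros eps He.
  assert (He2 : 0 < eps / 2) by lra.
  destruct (proj1 (Clim_iff eventually _ _) H _ He2) as [M HM].
  (* [B] absorbs the terms before index [M]; every later one is within [eps / 2] of [l]. *)
  assert (B : exists B, forall N, Cmod (Csum f N - RtoC (INR N) * l)%C <= B + INR N * (eps / 2)).
  { assert (G : forall K, (K <= M)%nat -> exists B, 0 <= B /\ forall N, (N <= K)%nat -> Cmod (Csum f N - RtoC (INR N) * l)%C <= B).
    { induction K as [|K IH]; intros HK.
      - exists 0; split; [lra|]; intros N HN; replace N with O by lia; simpl.
        replace (0 - 0 * l)%C with (RtoC 0) by ring; rewrite Cmod_0; lra.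
      - destruct (IH ltac:(lia)) as [B [HB0 HB]].
        exists (B + Cmod (Csum f (S K) - RtoC (INR (S K)) * l)%C); split; [pose proof (Cmod_ge_0 (Csum f (S K) - RtoC (INR (S K)) * l)%C); lra|].
        intros N HN; destruct (Nat.eq_dec N (S K)) as [->|HN']; [lra|].
        specialize (HB N ltac:(lia)); pose proof (Cmod_ge_0 (Csum f (S K) - RtoC (INR (S K)) * l)%C); lra. }
    destruct (G M (Nat.le_refl M)) as [B [HB0 HB]]; exists B; intros N.
    induction N as [|N IH].
    - specialize (HB O ltac:(lia)); simpl INR in *; lra.
    - destruct (Nat.le_gt_cases (S N) M) as [L|L].
      + specialize (HB (S N) L); pose proof (pos_INR (S N)); nra.
      + cbn [Csum]; rewrite S_INR, RtoC_plus.
        replace (Csum f N + f N - (RtoC (INR N) + 1) * l)%C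
          with ((Csum f N - RtoC (INR N) * l) + (f N - l))%C by ring.
        eapply Rle_trans; [apply Cmod_triangle|]; specialize (HM N ltac:(lia)); lra. }
  destruct B as [B HB].
  destruct (INR_unbounded (Rmax 1 (B / (eps / 2)))) as [N0 HN0].
  exists N0; intros N HN; apply le_INR in HN.
  assert (H1 : 1 < INR N) by (pose proof (Rmax_l 1 (B / (eps / 2))); lra).
  assert (H2 : B / (eps / 2) < INR N) by (pose proof (Rmax_r 1 (B / (eps / 2))); lra).
  assert (HN0' : RtoC (INR N) <> 0) by (apply RtoC_neq_0; lra).
  replace (/ RtoC (INR N) * Csum f N - l)%C with (/ RtoC (INR N) * (Csum f N - RtoC (INR N) * l))%C
    by (field; exact HN0').
  rewrite Cmod_mult, Cmod_inv, Cmod_R, Rabs_pos_eq by (try exact HN0'; lra).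
  apply Rmult_lt_reg_l with (INR N); [lra|].
  rewrite <- Rmult_assoc, Rinv_r, Rmult_1_l by lra.
  eapply Rle_lt_trans; [apply HB|].
  assert (B < INR N * (eps / 2)).
  { apply (Rmult_lt_compat_r (eps / 2)) in H2; [| exact He2].
    replace (B / (eps / 2) * (eps / 2)) with B in H2 by (field; lra); exact H2. }
  lra.
Qed.

(** x^(s-1) 2^-x dx in the variable u = log x. *)
Definition weight (s : C) (u : R) : C := (Cexp (s * RtoC u) * Cexp (- (RtoC (ln 2) * RtoC (exp u))))%C.

Lemma weight_harmonic (s : C) (n : Z) : 0 < Re s ->
  TIable (fun u => weight s u * Psi_harmonic (exp u) n)%C /\
  TI (fun u => weight s u * Psi_harmonic (exp u) n)%C = (Gam s * zeta_M_term s n)%C.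
Proof.
  intros Hs; pose proof ln_2_pos as L2.
  destruct (Gam_scale s (zfreq n) Hs ltac:(rewrite Re_zfreq; exact L2)) as [T E].
  assert (Q : forall u, (Psi_coef n * (Cexp (s * RtoC u) * Cexp (- (zfreq n * RtoC (exp u)))))%C
     = (weight s u * Psi_harmonic (exp u) n)%C).
  { intros u; unfold weight, Psi_harmonic, zfreq.
    replace (- ((ln 2 - 2 * PI * Ci * IZR n) * RtoC (exp u)))%C
      with (- (RtoC (ln 2) * RtoC (exp u)) + 2 * PI * Ci * IZR n * RtoC (exp u))%C by ring.
    rewrite Cexp_plus; ring. }
  assert (T2 := TIable_scal (Psi_coef n) _ T); split.
  - eapply TIable_ext; [exact Q | exact T2].
  - rewrite (TI_ext _ _ T2 Q), (TI_scal _ _ T), E.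
    unfold zeta_M_term; change (ln 2 - 2 * PI * Ci * IZR n)%C with (zfreq n); unfold Cdiv; ring.
Qed.

Lemma weight_sym_sum (s : C) (m : nat) : 0 < Re s ->
  TIable (fun u => weight s u * sym_sum (Psi_harmonic (exp u)) m)%C /\
  TI (fun u => weight s u * sym_sum (Psi_harmonic (exp u)) m)%C = (Gam s * sym_sum (zeta_M_term s) m)%C.
Proof.
  intros Hs; induction m as [|m [T E]]; [exact (weight_harmonic s 0 Hs)|].
  destruct (weight_harmonic s (Z.of_nat (S m)) Hs) as [T1 E1].
  destruct (weight_harmonic s (- Z.of_nat (S m)) Hs) as [T2 E2].
  assert (T12 := TIable_plus _ _ T1 T2); assert (T3 := TIable_plus _ _ T T12).
  cbn [sym_sum].
  assert (Q : forall u, (weight s u * sym_sum (Psi_harmonic (exp u)) m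
     + (weight s u * Psi_harmonic (exp u) (Z.of_nat (S m)) + weight s u * Psi_harmonic (exp u) (- Z.of_nat (S m))%Z))%C
     = (weight s u * (sym_sum (Psi_harmonic (exp u)) m
          + (Psi_harmonic (exp u) (Z.of_nat (S m)) + Psi_harmonic (exp u) (- Z.of_nat (S m))%Z)))%C)
    by (intros; ring).
  split; [eapply TIable_ext; [exact Q | exact T3]|].
  rewrite (TI_ext _ _ T3 Q), (TI_plus _ _ T T12), (TI_plus _ _ T1 T2), E, E1, E2; ring.
Qed.

Lemma weight_Csum (s : C) (N : nat) : 0 < Re s ->
  TIable (fun u => weight s u * Csum (sym_sum (Psi_harmonic (exp u))) N)%C /\
  TI (fun u => weight s u * Csum (sym_sum (Psi_harmonic (exp u))) N)%C
    = (Gam s * Csum (sym_sum (zeta_M_term s)) N)%C.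
Proof.
  intros Hs; induction N as [|N [T E]].
  - destruct (weight_sym_sum s 0 Hs) as [T0 _].
    assert (T := TIable_scal 0 _ T0).
    assert (Q : forall u, (0 * (weight s u * sym_sum (Psi_harmonic (exp u)) 0))%C = (weight s u * Csum (sym_sum (Psi_harmonic (exp u))) 0)%C)
      by (intros; cbn [Csum]; ring).
    split; [eapply TIable_ext; [exact Q | exact T]|].
    rewrite (TI_ext _ _ T Q), (TI_scal _ _ T0); cbn [Csum]; ring.
  - destruct (weight_sym_sum s N Hs) as [T1 E1].
    assert (T2 := TIable_plus _ _ T T1).
    assert (Q : forall u, (weight s u * Csum (sym_sum (Psi_harmonic (exp u))) N + weight s u * sym_sum (Psi_harmonic (exp u)) N)%C
      = (weight s u * Csum (sym_sum (Psi_harmonic (exp u))) (S N))%C) by (intros; cbn [Csum]; ring).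
    split; [eapply TIable_ext; [exact Q | exact T2]|].
    rewrite (TI_ext _ _ T2 Q), (TI_plus _ _ T T1), E, E1; cbn [Csum]; ring.
Qed.

Lemma weight_bound (s : C) : 0 < Re s ->
  exists K, 0 <= K /\ forall u, 0 <= u ->
    Cmod (weight s u) <= K * exp (- (1 * u)) /\ Cmod (weight s (- u)) <= 1 * exp (- (Re s * u)).
Proof.
  intros Hs; pose proof ln_2_pos as L2.
  destruct (exp_exp_decay (ln 2) (Re s + 1) L2) as [K [HK H]].
  assert (W : forall u, Cmod (weight s u) = exp (Re s * u) * exp (- (ln 2 * exp u))).
  { intros u; unfold weight; rewrite Cmod_mult, !Cmod_Cexp; f_equal; f_equal; unfold Re; simpl; ring. }
  exists K; split; [exact HK|]; intros u Hu; rewrite !W; split.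
  - apply Rle_trans with (exp (Re s * u) * (K * exp (- ((Re s + 1) * u)))).
    + apply Rmult_le_compat_l; [left; apply exp_pos | apply H, Hu].
    + right; replace (- (1 * u)) with (Re s * u + - ((Re s + 1) * u)) by ring; rewrite exp_plus; ring.
  - replace (Re s * - u) with (- (Re s * u)) by ring.
    assert (exp (- (ln 2 * exp (- u))) <= 1).
    { rewrite <- exp_0; apply exp_le; pose proof (exp_pos (- u)); nra. }
    pose proof (exp_pos (- (Re s * u))); nra.
Qed.

Lemma zeta_fejer_limit (s : C) : 0 < Re s ->
  filterlim (fun N => Gam s * fejer_mean (zeta_M_term s) N)%C eventually
    (locally (T := C_R_NormedModule) (TI (fun u => Cexp (s * RtoC u) * RtoC (qtail u))%C)).
Proof.
  intros Hs; destruct (weight_bound s Hs) as [K [HK W]].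
  assert (TQ : TIable (fun u => Cexp (s * RtoC u) * RtoC (qtail u))%C).
  { split; [apply Laplace_qtail_decaying | apply qtail_left_decaying, Hs]. }
  assert (Q : forall u, (Cexp (s * RtoC u) * RtoC (qtail u))%C = (weight s u * RtoC (Psi (exp u)))%C).
  { intros u; unfold weight, qtail; rewrite question_mark_Psi, RtoC_mult.
    replace (- (RtoC (ln 2) * RtoC (exp u)))%C with (RtoC (- exp u * ln 2))
      by (rewrite RtoC_mult, RtoC_opp; ring).
    rewrite Cexp_RtoC; unfold Rpower; ring. }
  apply (proj2 (Clim_iff eventually _ _)); intros eps He.
  (* [M - 1] bounds the integral of the modulus of the weight: [K / 1] on the right half-line and
     [1 / Re s] on the left. *)
  set (M := K / 1 + 1 / Re s + 1).
  assert (HM : 1 <= M).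
  { unfold M; assert (0 <= 1 / Re s) by (apply Rdiv_le_0_compat; lra); lra. }
  assert (He2 : 0 < eps / (2 * M)) by (apply Rdiv_lt_0_compat; lra).
  destruct (fejer_uniform _ He2) as [N0 HN0].
  exists (S N0); intros N HN.
  destruct (weight_Csum s N Hs) as [T E].
  assert (T1 := TIable_scal (/ RtoC (INR N)) _ T).
  assert (T2 := TIable_minus _ _ T1 TQ).
  replace (Gam s * fejer_mean (zeta_M_term s) N - TI (fun u => Cexp (s * RtoC u) * RtoC (qtail u)))%C
    with (TI (fun u => / RtoC (INR N) * (weight s u * Csum (sym_sum (Psi_harmonic (exp u))) N)
                   - Cexp (s * RtoC u) * RtoC (qtail u)))%C.
  2: { rewrite (TI_minus _ _ T1 TQ), (TI_scal _ _ T), E; unfold fejer_mean; ring. }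
  assert (B : forall u, Cmod (/ RtoC (INR N) * (weight s u * Csum (sym_sum (Psi_harmonic (exp u))) N)
                   - Cexp (s * RtoC u) * RtoC (qtail u))%C <= eps / (2 * M) * Cmod (weight s u)).
  { intros u; rewrite Q.
    replace (/ RtoC (INR N) * (weight s u * Csum (sym_sum (Psi_harmonic (exp u))) N) - weight s u * RtoC (Psi (exp u)))%C
      with ((fejer_mean (Psi_harmonic (exp u)) N - RtoC (Psi (exp u))) * weight s u)%C
      by (unfold fejer_mean; ring).
    rewrite Cmod_mult; apply Rmult_le_compat_r; [apply Cmod_ge_0|].
    apply HN0; lia. }
  destruct T2 as [D1 D2]; unfold TI at 1.
  eapply Rle_lt_trans; [apply Cmod_triangle|].
  assert (L1 := HI_le _ 1 (eps / (2 * M) * K)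
    (conj (decaying_continuous _ D1) (conj Rlt_0_1 (fun u Hu =>
      Rle_trans _ _ _ (B u) (Rle_trans _ _ _ (Rmult_le_compat_l _ _ _ (Rlt_le _ _ He2) (proj1 (W u Hu)))
        (Req_le _ _ (eq_sym (Rmult_assoc _ _ _)))))))).
  assert (L2 := HI_le _ (Re s) (eps / (2 * M) * 1)
    (conj (decaying_continuous _ D2) (conj Hs (fun u Hu =>
      Rle_trans _ _ _ (B (- u)) (Rle_trans _ _ _ (Rmult_le_compat_l _ _ _ (Rlt_le _ _ He2) (proj2 (W u Hu)))
        (Req_le _ _ (eq_sym (Rmult_assoc _ _ _)))))))).
  eapply Rle_lt_trans; [apply Rplus_le_compat; [exact L1 | exact L2]|].
  assert (EM : M - 1 = K / 1 + 1 / Re s) by (unfold M; ring); clearbody M.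
  replace (eps / (2 * M) * K / 1 + eps / (2 * M) * 1 / Re s) with (eps / (2 * M) * (M - 1))
    by (rewrite EM; field; lra).
  apply Rlt_le_trans with (eps / (2 * M) * M); [apply Rmult_lt_compat_l; lra|].
  replace (eps / (2 * M) * M) with (eps / 2) by (field; lra); lra.
Qed.

Definition zeta_M (s : C) : C := (Mellin_N s * RGam (s + 1))%C.

Lemma zeta_M_series (s : C) : 0 < Re s -> is_bilateral_series (zeta_M_term s) (zeta_M s).
Proof.
  intros Hs.
  destruct (ex_series_zeta_side s Z.of_nat Hs) as [lp Hp].
  { intros k; rewrite <- INR_IZR_INZ, !S_INR, Rabs_pos_eq by (pose proof (pos_INR k); lra); lra. }
  destruct (ex_series_zeta_side s (fun k => (- Z.of_nat (S k))%Z) Hs) as [lm Hm].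
  { intros k; rewrite opp_IZR, Rabs_Ropp, <- INR_IZR_INZ, !S_INR, Rabs_pos_eq by (pose proof (pos_INR k); lra); lra. }
  (* The real and the complex module structures on C yield convertible notions of series. *)
  exists lp, lm; split; [exact Hp | split; [exact Hm|]].
  assert (L := Cesaro_C _ _ (sym_sum_limit _ _ _ Hp Hm)).
  apply (Clim_scal eventually _ (Gam s)) in L.
  assert (E := Clim_unique eventually _ _ _ L (zeta_fejer_limit s Hs)).
  assert (G := Gam_neq_0 s Hs); assert (Hs0 : s <> 0) by (apply Re_neq_0; lra).
  assert (R : RGam (s + 1)%C = (/ s * / Gam s)%C).
  { pose proof (RGam_plus1 s) as P; rewrite RGam_right in P by exact Hs.
    rewrite P; field; exact Hs0. }
  unfold zeta_M; rewrite R, Mellin_N_TI, <- E by exact Hs; field; auto.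
Qed.

(** The derivative [l] of [Mellin_N] stays unknown: at the zeros of [RGam (s + 1)] it is multiplied
    by 0. *)
Lemma zeta_M_derive (s : C) (d : C) : is_Cderive RGam (s + 1)%C d ->
  exists l, is_Cderive zeta_M s (l * RGam (s + 1) + Mellin_N s * d)%C.
Proof.
  intros H; destruct (Mellin_N_derive s) as [l Hl]; exists l.
  exact (is_Cderive_mult Mellin_N (fun z => RGam (z + 1)%C) s l d Hl (is_Cderive_comp_add RGam s 1 d H)).
Qed.

Lemma zeta_M_conj (s : C) : zeta_M (Cconj s) = Cconj (zeta_M s).
Proof.
  unfold zeta_M; rewrite Cmult_conj, <- Mellin_N_conj, <- RGam_conj, Cplus_conj.
  rewrite Cconj_RtoC.
  reflexivity.
Qed.

Theorem theorem6 :
  exists zeta : C -> C,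
    entire zeta /\
    (forall s : C, 0 < Re s -> is_bilateral_series (zeta_M_term s) (zeta s)) /\
    (forall s : C, (forall k : Z, s <> RtoC (IZR k)) ->
       (zeta s * CGamma s = - (zeta (- s) * CGamma (- s)))%C) /\
    (forall L : nat, (1 <= L)%nat ->
       zeta (RtoC (INR L)) = RtoC (moment L / INR (fact L))) /\
    (forall L : nat, (1 <= L)%nat ->
       zeta (RtoC (- INR L)) = RtoC 0 /\
       is_derive (K := C_AbsRing) (V := C_NormedModule) zeta (RtoC (- INR L))
         (RtoC (INR (fact (L - 1)) * (-1) ^ (L - 1) * moment L))) /\
    (forall x : R, Im (zeta (RtoC x)) = 0) /\
    (forall s : C, zeta (Cconj s) = Cconj (zeta s)) /\
    (forall a b : R, a <= b ->
       exists K T : R, 0 < K /\ 0 < T /\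
         forall sigma t : R, a <= sigma <= b -> T <= Rabs t ->
           Cmod (zeta (sigma, t)) <=
             K * (Rpower (Rabs t) (- sigma - 1 / 2) * exp (PI * Rabs t / 2))).
Proof.
  refine (ex_intro _ zeta_M (conj _ (conj _ (conj _ (conj _ (conj _ (conj _ (conj _ _)))))))).
  - intros s; destruct (RGam_derive (s + 1)%C) as [d Hd].
    destruct (zeta_M_derive s d Hd) as [l Hl]; eexists; exact Hl.
  - exact zeta_M_series.
  (* Off the integers the product with Gamma is [Mellin_N s / s], an even function over an odd
     one. *)
  - assert (H : forall s, (forall k : Z, s <> RtoC (IZR k)) -> (zeta_M s * CGamma s = Mellin_N s * / s)%C).
    { intros s Hs; assert (Hs0 : s <> 0) by (apply (Hs 0%Z)).
      pose proof (RGam_CGamma s Hs) as E; rewrite RGam_plus1 in E.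
      unfold zeta_M; transitivity (Mellin_N s * / s * (s * RGam (s + 1) * CGamma s))%C.
      - field; exact Hs0.
      - rewrite E; ring. }
    intros s Hs; assert (Hs0 : s <> 0) by (apply (Hs 0%Z)).
    rewrite !H, Mellin_N_opp; [field; exact Hs0 | | exact Hs].
    intros k E; apply (Hs (- k)%Z); rewrite opp_IZR, RtoC_opp, <- E; ring.
  - intros L HL; unfold zeta_M; rewrite Mellin_N_moment, RGam_fact, <- RtoC_mult by exact HL; reflexivity.
  (* Since [- L + 1 = - n] is a zero of [RGam], only [Mellin_N (- L)] times the derivative of [RGam]
     remains, and evenness turns [Mellin_N (- L)] into the moment. *)
  - intros L HL; destruct L as [|n]; [lia|]; destruct (RGam_at_pole n) as [E D].
    assert (P : (RtoC (- INR (S n)) + 1)%C = RtoC (- INR n)) by (rewrite <- RtoC_plus, S_INR; f_equal; ring).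
    rewrite <- P in E, D; split; [unfold zeta_M; rewrite E; ring|].
    destruct (zeta_M_derive _ _ D) as [l Hl].
    evar_last; [exact Hl|].
    rewrite E, RtoC_opp, Mellin_N_opp, Mellin_N_moment, Cmult_0_r, Cplus_0_l, <- RtoC_mult by exact HL.
    f_equal; replace (S n - 1)%nat with n by lia; ring.
  - intros x; pose proof (zeta_M_conj (RtoC x)) as H.
    rewrite Cconj_RtoC in H.
    apply (f_equal Im) in H; rewrite im_conj in H; lra.
  - exact zeta_M_conj.
  - intros a b Hab.
    destruct (Mellin_N_bounded (Rmax (Rabs a) (Rabs b))) as [M [HM HN]].
    { pose proof (Rmax_l (Rabs a) (Rabs b)); pose proof (Rabs_pos a); lra. }
    (* The argument of [RGam] is [s + 1]: the strip moves by 1, and [/ 2 - (x + 1)] is the exponent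
       [- x - 1 / 2]. *)
    destruct (RGam_strip (a + 1) (b + 1) ltac:(lra)) as [K [HK HR]].
    exists ((M + 1) * K), 1; split; [apply Rmult_lt_0_compat; lra | split; [lra|]].
    intros x t Hx Ht; unfold zeta_M; rewrite Cmod_mult.
    replace ((x, t) + 1)%C with ((x + 1, t) : C) by (creal).
    specialize (HR (x + 1) t ltac:(lra) Ht).
    replace (/ 2 - (x + 1)) with (- x - 1 / 2) in HR by field.
    rewrite Rmult_assoc; apply Rmult_le_compat; try apply Cmod_ge_0; [| exact HR].
    apply Rle_trans with M; [| lra]; apply HN; simpl.
    apply Rabs_le_between.
    pose proof (Rmax_l (Rabs a) (Rabs b)); pose proof (Rmax_r (Rabs a) (Rabs b)).
    pose proof (Rle_abs b); pose proof (Rle_abs (- a)) as Q; rewrite Rabs_Ropp in Q.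
    apply Rabs_le_between; lra.
Qed.
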